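(* Let $(kQ,d)$ be a dg quiver algebra concentrated in (homologically) non-negative degrees, with finitely many arrows in each degree, and let $i$ be a vertex of $Q$ with no loops of degree $0$ attached to it. Then the derived endomorphism ring of the left Aihara–Iyama silting mutation of $kQ$ at $i$, i.e. of $P_i^*\oplus\bigoplus_{j\neq i}P_j$, is given by the mutated dg quiver algebra $(kM,\partial)$; that is, the two are quasi-isomorphic as dg algebras.
   Context: Dg quiver algebra. $k$ is a field and $Q$ is a quiver with vertex set $\{1,\dots,n\}$ whose arrows $\varphi\in Q_1$ carry degrees $|\varphi|\in\mathbb Z_{\ge 0}$, with finitely many arrows in each degree. Write $\mathrm s_\varphi,\mathrm t_\varphi$ for the start and end vertex of an arrow (or path). Paths are composed from right to left ($\psi\varphi$ means first $\varphi$, then $\psi$); a path ''starts with'' its rightmost arrow. $e_j$ is the trivial path at $j$. $kQ$ is the graded path algebra, and $d$ is a $k$-linear differential of degree $-1$ on $kQ$ with $d^2=0$, $d(e_j)=0$, $d(pq)=d(p)q+(-1)^{|p|}p\,d(q)$ (so $d$ preserves start and end vertices). Silting mutation. Put $\Lambda=kQ$, $P_j=e_j\Lambda$ (right dg $\Lambda$-modules; an arrow $\varphi$ acts by left multiplication $P_{\mathrm s_\varphi}\to P_{\mathrm t_\varphi}$). Let $A$ be the set of arrows of degree $0$ starting in $i$ (none is a loop). Put $P_i^*=\operatorname{Cone}\big(P_i\to\bigoplus_{\alpha\in A}P_{\mathrm t_\alpha}\big)$, where the map has components $\alpha$; it is a left approximation of $P_i$ by the other $P_j$. The left silting mutation of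 $kQ$ at $i$ is $P_i^*\oplus\bigoplus_{j\ne i}P_j$; its derived endomorphism ring is its derived endomorphism dg algebra. Mutated quiver $M$. Let $\chi(j)=1$ if $j=i$ and $0$ otherwise. $M$ has the same vertices as $Q$ and the following arrows (degrees denoted $\|\cdot\|$); $\alpha,\beta$ always denote elements of $A$: (1) $\varphi\colon j\to j'$ for each $\varphi\colon j\to j'$ in $Q_1\setminus A$, with $\|\varphi\|=|\varphi|-\chi(\mathrm s_\varphi)+\chi(\mathrm t_\varphi)$; (1') $\alpha^*\colon j\to i$ for each $\alpha\colon i\to j$ in $A$, with $\|\alpha^*\|=0$; (2) $\alpha\varphi\colon j\to j'$ for each $\varphi\colon j\to i$ in $Q_1$ and $\alpha\colon i\to j'$ in $A$, with $\|\alpha\varphi\|=\|\varphi\|-1$; (3) $\varphi\alpha^{-1}\colon j\to j'$ for each $\varphi\colon i\to j'$ in $Q_1\setminus A$ and $\alpha\colon i\to j$ in $A$, with $\|\varphi\alpha^{-1}\|=\|\varphi\|+1$; (4) $\alpha\varphi\beta^{-1}\colon j\to j'$ for each $\varphi\colon i\to i$ in $Q_1$, $\alpha\colon i\to j'$, $\beta\colon i\to j$ in $A$, with $\|\alpha\varphi\beta^{-1}\|=\|\varphi\|$. The symbols $\alpha\varphi$, $\varphi\alpha^{-1}$, $\alpha\varphi\beta^{-1}$ are single arrows of $M$. A path of $Q$ not starting with an arrow of $A$ is read as a path of $M$ by merging each occurring $\alpha\in A$ with the arrow $\varphi$ preceding it into the arrow $\alpha\varphi$. Notation. If $q$ is a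 linear combination of paths of $M$ whose leftmost arrows are of the form $\varphi$ or $\varphi\beta^{-1}$ with $\varphi\in Q_1$ ending in $i$, then $\alpha q$ is obtained by replacing that arrow by $\alpha\varphi$ resp. $\alpha\varphi\beta^{-1}$. If the rightmost arrows are of the form $\varphi$ or $\beta\varphi$ with $\varphi\in Q_1\setminus A$ starting in $i$, then $q\alpha^{-1}$ is obtained by replacing that arrow by $\varphi\alpha^{-1}$ resp. $\beta\varphi\alpha^{-1}$. Reduction and decoration. For a linear combination $p$ of paths of $Q$, $\operatorname{red}(p)$ is obtained by removing all paths that start with an arrow of $A$, and $p/\alpha$ by keeping only the paths starting with $\alpha$ and removing this $\alpha$; so $p=\operatorname{red}(p)+\sum_{\alpha\in A}(p/\alpha)\,\alpha$. For a path $p$ of $Q$ not starting with an arrow of $A$, $\operatorname{dec}(p)\in kM$ is obtained by inserting $\Delta=1-\sum_{\alpha\in A}\alpha^{-1}\alpha$ wherever $p$ passes through $i$, coming in through an arrow $\varphi\in Q_1$ and leaving through an arrow $\psi\in Q_1\setminus A$ (i.e. $\psi\varphi$ is replaced by $\psi\Delta\varphi=\psi\varphi-\sum_{\alpha\in A}(\psi\alpha^{-1})(\alpha\varphi)$), and expanding; if $\varphi$ is a loop at $i$ that gets $\alpha$ on its left and $\beta^{-1}$ on its right, the arrow $\alpha\varphi\beta^{-1}$ is meant. $\operatorname{dec}$ is extended linearly. Differential $\partial$ on $kM$ (extended by linearity and the graded Leibniz rule with respect to $\|\cdot\|$): $\partial(\varphi)=\operatorname{dec}(\operatorname{red}(d\varphi))$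 if $\mathrm t_\varphi\ne i$, and $\partial(\varphi)=\sum_{\alpha\in A}\alpha^*\,\alpha\varphi-\operatorname{dec}(\operatorname{red}(d\varphi))$ if $\mathrm t_\varphi=i$; $\partial(\alpha\varphi)=\operatorname{dec}(\alpha\operatorname{red}(d\varphi))$; $\partial(\alpha^* )=0$; $\partial(\varphi\alpha^{-1})=\partial(\varphi)\alpha^{-1}+(-1)^{\|\varphi\|}\varphi\alpha^*-(-1)^{\chi(\mathrm t_\varphi)}\operatorname{dec}(d\varphi/\alpha)$; $\partial(\alpha\varphi\beta^{-1})=\partial(\alpha\varphi)\beta^{-1}+(-1)^{\|\alpha\varphi\|}\alpha\varphi\,\beta^*-\alpha\operatorname{dec}(d\varphi/\beta)$. Quasi-isomorphic means connected by a zigzag of quasi-isomorphisms of dg algebras.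
   Formalization: The formal theorem assumes in addition that, if some arrow of degree 0 starts in i, the trivial path e_i does not occur in dφ for any loop φ at i; otherwise the formulas for ∂ involve the undefined terms dec(α e_i) and e_i α^{-1}. *)

(* Defs.v *)
From HB Require Import structures.
From mathcomp Require Import all_boot all_order all_algebra.
From mathcomp Require Import boolp functions finmap.
From mathcomp.multinomials Require Import monalg.

Set Implicit Arguments.
Unset Strict Implicit.
Unset Printing Implicit Defensive.

Import GRing.Theory.
Local Open Scope ring_scope.

Section Gradings.
Variables (k : fieldType) (V : lmodType k).
Implicit Types H : int -> V -> Prop.

Definition homogeneous_sum H (x : V) : Prop :=
  exists l : seq (int * V),
    (forall p, p \in l -> H p.1 p.2) /\ x = \sum_(p <- l) p.2.

(* V is the internal direct sum of its homogeneous components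
   [set x | H m x], m in Z. *)
Record is_grading H : Prop := IsGrading {
  grading0 : forall m, H m 0;
  gradingP : forall m c x y, H m x -> H m y -> H m (c *: x + y);
  grading_sum : forall x, homogeneous_sum H x;
  grading_direct : forall (s : seq int) (f : int -> V),
    uniq s -> (forall m, H m (f m)) -> \sum_(m <- s) f m = 0 ->
    forall m, m \in s -> f m = 0 }.

Lemma homogeneous_sum_closed H :
  (forall m c x, H m x -> H m (c *: x)) ->
  forall c x y, homogeneous_sum H x -> homogeneous_sum H y ->
  homogeneous_sum H (c *: x + y).
Proof.
move=> HZ c x y [l1 [h1 ->]] [l2 [h2 ->]].
exists ([seq (p.1, c *: p.2) | p <- l1] ++ l2); split.
  by move=> p; rewrite mem_cat => /orP[/mapP[q /h1 hq ->]|/h2//]; apply: HZ.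
by rewrite big_cat big_map scaler_sumr.
Qed.

Lemma homogeneous_sum0 H : homogeneous_sum H 0.
Proof. by exists [::]; rewrite big_nil. Qed.

Lemma homogeneous_sum1 H m x : H m x -> homogeneous_sum H x.
Proof.
by move=> h; exists [:: (m, x)]; rewrite big_seq1; split=> // p /[!inE] /eqP->.
Qed.

Lemma homogeneous_sumD H x y :
  homogeneous_sum H x -> homogeneous_sum H y -> homogeneous_sum H (x + y).
Proof.
move=> [l1 [h1 ->]] [l2 [h2 ->]]; exists (l1 ++ l2); rewrite big_cat; split=> //.
by move=> p; rewrite mem_cat => /orP[/h1|/h2].
Qed.

Lemma homogeneous_sum_ind H (P : V -> Prop) :
  P 0 -> (forall x y, P x -> P y -> P (x + y)) ->
  (forall m x, H m x -> P x) -> forall x, homogeneous_sum H x -> P x.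
Proof.
move=> P0 PD PH x [l [hl ->]]; rewrite big_seq; apply: big_ind => // p /hl.
exact: PH.
Qed.

Section Sign.
Variables (H : int -> V -> Prop) (hH : is_grading H).

Lemma grading_big (I : eqType) m (r : seq I) (P : pred I) (F : I -> V) :
  (forall j, j \in r -> P j -> H m (F j)) -> H m (\sum_(j <- r | P j) F j).
Proof.
move=> hF; rewrite big_seq_cond; apply: big_ind.
- exact: grading0.
- by move=> x y hx hy; rewrite -[x]scale1r; apply: (gradingP hH).
- by move=> j /andP[]; apply: hF.
Qed.

Lemma gradingZ m c x : H m x -> H m (c *: x).
Proof. by move=> hx; rewrite -[_ *: _]addr0; apply: gradingP => //; apply: grading0. Qed.

Lemma sign_welldef (l : seq (int * V)) :
  (forall p, p \in l -> H p.1 p.2) -> \sum_(p <- l) p.2 = 0 ->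
  \sum_(p <- l) (-1) ^ p.1 *: p.2 = 0.
Proof.
move=> hl l0; pose s := undup [seq p.1 | p <- l].
pose f m := \sum_(p <- l | p.1 == m) p.2.
have us : uniq s by apply: undup_uniq.
have split_deg (F : int * V -> V) :
    \sum_(p <- l) F p = \sum_(m <- s) \sum_(p <- l | p.1 == m) F p.
  rewrite (exchange_big_dep xpredT) //= big_seq [RHS]big_seq.
  apply: eq_bigr => p pl; under eq_bigl do rewrite eq_sym.
  rewrite (big_rem p.1) /= ?mem_undup; last by apply/mapP; exists p.
  rewrite eqxx big_seq_cond big1 ?addr0 // => m.
  by rewrite mem_rem_uniq // !inE => /andP[/andP[/negbTE->]].
have f0 m : m \in s -> f m = 0.
  apply: (grading_direct hH us) => [m'|]; last by rewrite -split_deg.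
  by apply: grading_big => p /hl hp /eqP <-.
rewrite split_deg big_seq big1 // => m /f0 fm.
rewrite (eq_bigr (fun p => (-1) ^ m *: p.2)) => [|p /eqP-> //].
by rewrite -scaler_sumr [\sum_(p <- l | _) _]fm scaler0.
Qed.

Lemma sign_op_exists :
  exists s : V -> V, linear s /\ forall m x, H m x -> s x = (-1) ^ m *: x.
Proof.
have [L hL] := choice (grading_sum hH).
pose s x := \sum_(p <- L x) (-1) ^ p.1 *: p.2.
have sE l x : (forall p, p \in l -> H p.1 p.2) -> x = \sum_(p <- l) p.2 ->
    s x = \sum_(p <- l) (-1) ^ p.1 *: p.2.
  move=> hl xE; apply/eqP; rewrite -subr_eq0 -sumrN; apply/eqP.
  pose l' := L x ++ [seq (p.1, - p.2) | p <- l].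
  have := @sign_welldef l'; rewrite /l' !big_cat !big_map /=.
  rewrite -(hL x).2 sumrN -xE subrr; under [X in _ + X]eq_bigr do rewrite scalerN.
  apply=> // p; rewrite mem_cat => /orP[/(hL x).1 //|/mapP[q /hl hq ->]] /=.
  by rewrite -scaleN1r; apply: gradingZ.
exists s; split=> [c x y|m x hx].
  rewrite (sE ([seq (p.1, c *: p.2) | p <- L x] ++ L y)).
  - rewrite big_cat big_map /= scaler_sumr; congr (_ + _).
    by apply: eq_bigr => p _; rewrite !scalerA mulrC.
  - move=> p; rewrite mem_cat => /orP[/mapP[q /(hL x).1 hq ->]|/(hL y).1 //].
    exact: gradingZ.
  - by rewrite big_cat big_map /= -scaler_sumr -(hL x).2 -(hL y).2.
rewrite (sE [:: (m, x)]) ?big_seq1 // => p /[!inE] /eqP -> //.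
Qed.

(* The sign involution: x |-> (-1)^m x on elements of degree m. *)
Definition sign_op : V -> V := sval (cid sign_op_exists).

Lemma sign_op_linear : linear sign_op.
Proof. by rewrite /sign_op; case: cid => s [] /=. Qed.

Lemma sign_opE m x : H m x -> sign_op x = (-1) ^ m *: x.
Proof. by rewrite /sign_op; case: cid => s [] /= _; apply. Qed.

End Sign.
End Gradings.

Lemma signzD (k : fieldType) (m n : int) : (-1 : k) ^ (m + n) = (-1) ^ m * (-1) ^ n.
Proof. by rewrite expfzDr // oppr_eq0 oner_eq0. Qed.

Lemma signzz (k : fieldType) (m : int) : (-1 : k) ^ m * (-1) ^ m = 1.
Proof. by rewrite -exprMz_comm ?mulrNN ?mulr1 ?exp1rz //; apply: unitrN1. Qed.

Section Subspace.
Variables (k : fieldType) (V : lmodType k) (P : V -> Prop).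

Definition subspace (hP : P 0 /\ (forall c x y, P x -> P y -> P (c *: x + y))) :=
  {x : V | `[< P x >]}.

Hypothesis hP : P 0 /\ (forall c x y, P x -> P y -> P (c *: x + y)).
HB.instance Definition _ := SubChoice.on (subspace hP).

Lemma subspace_closed : GRing.subsemimod_closed (fun x : V => `[< P x >]).
Proof.
case: hP => h0 hL; split; first split; first exact/asboolP.
  by move=> x y /asboolP hx /asboolP hy; apply/asboolP; rewrite -[x]scale1r; apply: hL.
by move=> c x /asboolP hx; apply/asboolP; rewrite -[_ *: _]addr0; apply: hL.
Qed.

HB.instance Definition _ := GRing.SubChoice_isSubLmodule.Build k V
  (fun x : V => `[< P x >]) (subspace hP) subspace_closed.

Definition to_subspace x (hx : P x) : subspace hP := exist _ x (asboolT hx).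
Lemma subspaceP (x : subspace hP) : P (val x).
Proof. exact: asboolW (valP x). Qed.
End Subspace.

(* Not an algType: MathComp's algebras are nonzero, while the dg endomorphism
   algebra of a dg module may be zero. *)
Record grAlgebra (k : fieldType) := GrAlgebra {
  ga_car :> lmodType k;
  ga_one : ga_car;
  ga_mul : ga_car -> ga_car -> ga_car;
  ga_hom : int -> ga_car -> Prop;
  ga_mulA : associative ga_mul;
  ga_mul1l : left_id ga_one ga_mul;
  ga_mul1r : right_id ga_one ga_mul;
  ga_linl : forall y, linear (ga_mul^~ y);
  ga_linr : forall x, linear (ga_mul x);
  ga_grading : is_grading ga_hom;
  ga_hom1 : ga_hom 0 ga_one;
  ga_homM : forall m n x y, ga_hom m x -> ga_hom n y -> ga_hom (m + n) (ga_mul x y) }.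

Arguments ga_one {k}.
Notation "x ** y" := (ga_mul x y) (at level 40, left associativity) : ring_scope.

(* Homological grading: differentials have degree -1. *)
Record is_differential (k : fieldType) (R : grAlgebra k) (d : R -> R) : Prop :=
  IsDifferential {
  diff_linear : linear d;
  diff_hom : forall m x, ga_hom m x -> ga_hom (m - 1) (d x);
  diff_sq : forall x, d (d x) = 0;
  diff_leibniz : forall m x y, ga_hom m x ->
    d (x ** y) = d x ** y + (-1) ^ m *: (x ** d y) }.

Record dgAlgebra (k : fieldType) := DgAlgebra {
  dga_alg :> grAlgebra k;
  dga_d : dga_alg -> dga_alg;
  dga_diff : is_differential dga_d }.

(* For a map f commuting with the differentials dA and dB: f induces a
   bijection ker dA / im dA -> ker dB / im dB. *)
Definition homology_bijective (A B : zmodType) (dA : A -> A) (dB : B -> B)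
    (f : A -> B) : Prop :=
  (forall x, dA x = 0 -> (exists y, f x = dB y) -> exists z, x = dA z) /\
  (forall y, dB y = 0 -> exists2 x, dA x = 0 & exists z, y - f x = dB z).

Record is_dga_morphism (k : fieldType) (A B : dgAlgebra k) (f : A -> B) : Prop :=
  IsDgaMorphism {
  dgam_linear : linear f;
  dgam_one : f (ga_one A) = ga_one B;
  dgam_mul : forall x y, f (x ** y) = f x ** f y;
  dgam_hom : forall m x, ga_hom m x -> ga_hom m (f x);
  dgam_d : forall x, f (dga_d x) = dga_d (f x) }.

Definition dga_quasi_iso (k : fieldType) (A B : dgAlgebra k) (f : A -> B) : Prop :=
  is_dga_morphism f /\ homology_bijective (@dga_d k A) (@dga_d k B) f.

Inductive quasi_isomorphic (k : fieldType) : dgAlgebra k -> dgAlgebra k -> Prop :=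
| Zigzag_refl A : quasi_isomorphic A A
| Zigzag_fwd (A B C : dgAlgebra k) (f : A -> B) :
    dga_quasi_iso f -> quasi_isomorphic B C -> quasi_isomorphic A C
| Zigzag_bwd (A B C : dgAlgebra k) (f : B -> A) :
    dga_quasi_iso f -> quasi_isomorphic B C -> quasi_isomorphic A C.

(* Right dg modules. *)
Record dgModule (k : fieldType) (L : dgAlgebra k) := DgModule {
  dgm_car :> lmodType k;
  dgm_act : dgm_car -> L -> dgm_car;
  dgm_hom : int -> dgm_car -> Prop;
  dgm_d : dgm_car -> dgm_car;
  dgm_linl : forall a, linear (dgm_act^~ a);
  dgm_linr : forall x, linear (dgm_act x);
  dgm_act1 : forall x, dgm_act x (ga_one L) = x;
  dgm_actM : forall x a b, dgm_act x (a ** b) = dgm_act (dgm_act x a) b;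
  dgm_grading : is_grading dgm_hom;
  dgm_homM : forall m n x a, dgm_hom m x -> ga_hom n a -> dgm_hom (m + n) (dgm_act x a);
  dgm_d_linear : linear dgm_d;
  dgm_d_hom : forall m x, dgm_hom m x -> dgm_hom (m - 1) (dgm_d x);
  dgm_d_sq : forall x, dgm_d (dgm_d x) = 0;
  dgm_leibniz : forall m x a, dgm_hom m x ->
    dgm_d (dgm_act x a) = dgm_act (dgm_d x) a + (-1) ^ m *: dgm_act x (dga_d a) }.

Section DgModules.
Variables (k : fieldType) (L : dgAlgebra k).
Implicit Types X Y : dgModule L.

Record dgm_hom_of_degree X Y (m : int) (f : X -> Y) : Prop := DgmHom {
  dgmh_linear : linear f;
  dgmh_act : forall x a, f (dgm_act x a) = dgm_act (f x) a;
  dgmh_deg : forall p x, dgm_hom p x -> dgm_hom (m + p) (f x) }.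

Definition is_dgm_morphism X Y (f : X -> Y) : Prop :=
  dgm_hom_of_degree 0 f /\ forall x, f (dgm_d x) = dgm_d (f x).

Definition dgm_quasi_iso X Y (f : X -> Y) : Prop :=
  is_dgm_morphism f /\ homology_bijective (@dgm_d k L X) (@dgm_d k L Y) f.

Definition acyclic X : Prop := forall x : X, dgm_d x = 0 -> exists y, x = dgm_d y.

(* The complex Hom_L(X, Y), with differential f |-> d f - (-1)^|f| f d, is
   acyclic for all acyclic Y. *)
Definition K_projective X : Prop :=
  forall Y, acyclic Y -> forall m (f : X -> Y), dgm_hom_of_degree m f ->
    (forall x, dgm_d (f x) - (-1) ^ m *: f (dgm_d x) = 0) ->
    exists2 g : X -> Y, dgm_hom_of_degree (m + 1) g &
      forall x, f x = dgm_d (g x) - (-1) ^ (m + 1) *: g (dgm_d x).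

End DgModules.

Section DgEnd.
Variables (k : fieldType) (L : dgAlgebra k) (X : dgModule L).

Definition dgend_hom (m : int) (f : X -> X) : Prop := dgm_hom_of_degree m f.

Lemma dgend_hom0 m : dgend_hom m 0.
Proof.
split=> [c x y|x a|p x _] /=; first by rewrite scaler0 addr0.
  have := dgm_linl a (-1) (0 : X) 0; rewrite scaler0 addr0 => ->.
  by rewrite scaleN1r addNr.
exact: grading0 (dgm_grading X) _.
Qed.

Lemma dgend_homP m c f g :
  dgend_hom m f -> dgend_hom m g -> dgend_hom m (c *: f + g).
Proof.
move=> [fl fa fd] [gl ga gd]; split=> [b x y|x a|p x hx] /=.
- rewrite /= !fctE /= fl gl !scalerDr !scalerA addrACA [c * b]mulrC.
  by [].
- by rewrite !fctE /= fa ga (dgm_linl a).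
- by apply: (gradingP (dgm_grading X)); [apply: fd | apply: gd].
Qed.

Lemma dgend_homZ m c f : dgend_hom m f -> dgend_hom m (c *: f).
Proof. by move=> hf; rewrite -[_ *: _]addr0; apply: dgend_homP => //; apply: dgend_hom0. Qed.

Lemma dgend_subspace : homogeneous_sum dgend_hom 0 /\
  (forall c f g, homogeneous_sum dgend_hom f -> homogeneous_sum dgend_hom g ->
     homogeneous_sum dgend_hom (c *: f + g)).
Proof.
split; first exact: homogeneous_sum0.
by move=> c f g; apply: homogeneous_sum_closed => m b h; apply: dgend_homZ.
Qed.

(* The L-linear endomorphisms of X that are finite sums of homogeneous ones. *)
Definition dgend_car : lmodType k := subspace dgend_subspace.

Definition dgend_lin (f : X -> X) : Prop :=
  linear f /\ forall x a, f (dgm_act x a) = dgm_act (f x) a.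

Lemma dgend_carP (f : X -> X) : homogeneous_sum dgend_hom f -> dgend_lin f.
Proof.
move: f; apply: homogeneous_sum_ind.
- by case: (dgend_hom0 0).
- move=> f g [fl fa] [gl ga]; split=> [b x y|x a] /=.
    by rewrite !fctE /= fl gl !scalerDr addrACA.
  by rewrite !fctE /= fa ga -[in RHS](scale1r (f x)) (dgm_linl a) scale1r.
- by move=> m f [].
Qed.

Lemma linearB (V W : lmodType k) (f : V -> W) : linear f ->
  [/\ f 0 = 0, {morph f : x y / x + y}, {morph f : x / - x},
      {morph f : x y / x - y} & forall c, {morph f : x / c *: x}].
Proof.
move=> fl; have f0 : f 0 = 0.
  by have := fl (-1) 0 0; rewrite scaler0 addr0 => ->; rewrite scaleN1r addNr.
have fD : {morph f : x y / x + y} by move=> x y; rewrite -[x]scale1r fl !scale1r.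
have fZ c : {morph f : x / c *: x} by move=> x; rewrite -[_ *: _]addr0 fl f0 addr0.
have fN : {morph f : x / - x} by move=> x; rewrite -scaleN1r fZ scaleN1r.
by split=> // x y; rewrite fD fN.
Qed.

Definition dgend_sign : X -> X := sign_op (dgm_grading X).

Lemma dgend_signK x : dgend_sign (dgend_sign x) = x.
Proof.
have [s0 sD _ _ sZ] := linearB (sign_op_linear (dgm_grading X)).
rewrite /dgend_sign; move: (grading_sum (dgm_grading X) x); move: x.
apply: homogeneous_sum_ind => [|x y hx hy|m x hx]; first by rewrite !s0.
  by rewrite !sD hx hy.
by rewrite !(sign_opE _ hx) sZ (sign_opE _ hx) scalerA signzz scale1r.
Qed.

Lemma dgend_signC m f x : dgend_hom m f ->
  dgend_sign (f x) = (-1) ^ m *: f (dgend_sign x).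
Proof.
move=> [/linearB[f0 fD _ _ fZ] _ fd].
have [s0 sD _ _ sZ] := linearB (sign_op_linear (dgm_grading X)).
rewrite /dgend_sign; move: (grading_sum (dgm_grading X) x); move: x.
apply: homogeneous_sum_ind => [|x y hx hy|p x hx]; first by rewrite !(s0, f0) scaler0.
  by rewrite !(fD, sD) hx hy scalerDr.
by rewrite (sign_opE _ hx) (sign_opE _ (fd _ _ hx)) fZ signzD scalerA.
Qed.

Lemma dgend_sign_d x : dgend_sign (dgm_d x) = - dgm_d (dgend_sign x).
Proof.
have [s0 sD _ _ sZ] := linearB (sign_op_linear (dgm_grading X)).
have [d0 dD _ _ dZ] := linearB (@dgm_d_linear _ _ X).
rewrite /dgend_sign; move: (grading_sum (dgm_grading X) x); move: x.
apply: homogeneous_sum_ind => [|x y hx hy|p x hx]; first by rewrite !(s0, d0) oppr0.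
  by rewrite !(dD, sD) hx hy opprD.
rewrite (sign_opE _ hx) (sign_opE _ (dgm_d_hom hx)) dZ signzD -scaleNr.
by rewrite exprN1 invrN1 mulrN1.
Qed.

(* On f of degree m this is d f - (-1)^m f d. *)
Definition dgend_diff (f : X -> X) : X -> X :=
  fun x => dgm_d (f x) - dgend_sign (f (dgend_sign (dgm_d x))).

Lemma dgend_diffE m f x : dgend_hom m f ->
  dgend_diff f x = dgm_d (f x) - (-1) ^ m *: f (dgm_d x).
Proof. by move=> hf; rewrite /dgend_diff (dgend_signC _ hf) dgend_signK. Qed.

Lemma dgend_diff_hom m f : dgend_hom m f -> dgend_hom (m - 1) (dgend_diff f).
Proof.
move=> hf; have := hf => -[fl fa fd].
have [f0 fD fN fB fZ] := linearB fl.
have [d0 dD _ _ dZ] := linearB (@dgm_d_linear _ _ X).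
split=> [c x y|x a|p x hx].
- rewrite !(dgend_diffE _ hf) fl !(@dgm_d_linear _ _ X) fl.
  rewrite !scalerDr opprD addrACA scalerN !scalerA.
  by rewrite [c * _]mulrC.
- rewrite !(dgend_diffE _ hf); move: (grading_sum (dgm_grading X) x); move: x.
  have aD y : {morph (@dgm_act _ _ X)^~ y : u v / u + v} by
    case: (linearB (@dgm_linl _ _ X y)).
  have aB y : {morph (@dgm_act _ _ X)^~ y : u v / u - v} by
    case: (linearB (@dgm_linl _ _ X y)).
  have a0 y : dgm_act (0 : X) y = 0 by case: (linearB (@dgm_linl _ _ X y)).
  have aZ y c : {morph (@dgm_act _ _ X)^~ y : u / c *: u} by
    case: (linearB (@dgm_linl _ _ X y)).
  apply: homogeneous_sum_ind => [|x y hx hy|p x hx].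
  + by rewrite !(a0, f0, d0, scaler0, subr0).
  + rewrite aD !(fD, dD, scalerDr, opprD) addrACA hx hy -aD; congr dgm_act.
    by rewrite addrACA.
  rewrite (dgm_leibniz _ hx) fD fZ !fa (dgm_leibniz _ (fd _ _ hx)) aB aZ.
  rewrite signzD scalerDr opprD addrACA scalerA subrr addr0.
  by [].
- rewrite (dgend_diffE _ hf) [X in dgm_hom _ X]addrC -scaleNr.
  apply: (gradingP (dgm_grading X)).
    by rewrite addrAC -addrA; apply/fd/dgm_d_hom.
  by rewrite addrAC; apply/dgm_d_hom/fd.
Qed.

Lemma dgend_diff_linear : linear dgend_diff.
Proof.
move=> c f g; apply/funext => x; rewrite /dgend_diff !fctE /=.
have sl : linear dgend_sign by apply: sign_op_linear.
rewrite sl (@dgm_d_linear _ _ X).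
by rewrite scalerBr opprD addrACA.
Qed.

Lemma dgend_hom_id : dgend_hom 0 id.
Proof. by split=> // p x; rewrite add0r. Qed.

Lemma dgend_hom_comp m p f g :
  dgend_hom m f -> dgend_hom p g -> dgend_hom (m + p) (f \o g).
Proof.
move=> [fl fa fd] [gl ga gd]; split=> [c x y|x a|q x hx] /=.
- by rewrite gl fl.
- by rewrite ga fa.
- by rewrite -addrA; apply/fd/gd.
Qed.

Lemma dgend_comp_car f g : homogeneous_sum dgend_hom f ->
  homogeneous_sum dgend_hom g -> homogeneous_sum dgend_hom (f \o g).
Proof.
move=> hf hg; move: f hf; apply: homogeneous_sum_ind.
- exact: homogeneous_sum0.
- by move=> f1 f2 h1 h2; apply: (homogeneous_sumD h1 h2).
move=> m f hf; move: g hg; apply: homogeneous_sum_ind.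
- have [/linearB[f0 _ _ _ _] _ _] := hf.
  rewrite (_ : f \o 0 = 0); first exact: homogeneous_sum0.
  by apply/funext => x; rewrite /= f0.
- move=> g1 g2 h1 h2; have [/linearB[_ fD _ _ _] _ _] := hf.
  rewrite (_ : f \o (g1 + g2) = (f \o g1) + (f \o g2)); first exact: homogeneous_sumD.
  by apply/funext => x; rewrite /= fD.
- by move=> p g hg; apply: homogeneous_sum1 (dgend_hom_comp hf hg).
Qed.

Lemma dgend_diff_car f : homogeneous_sum dgend_hom f ->
  homogeneous_sum dgend_hom (dgend_diff f).
Proof.
have [D0 DD _ _ _] := linearB dgend_diff_linear.
move: f; apply: homogeneous_sum_ind.
- by rewrite D0; apply: homogeneous_sum0.
- by move=> f g hf hg; rewrite DD; apply: homogeneous_sumD.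
- by move=> m f /dgend_diff_hom; apply: homogeneous_sum1.
Qed.

Definition dgend_one : dgend_car :=
  to_subspace dgend_subspace (homogeneous_sum1 dgend_hom_id).
Definition dgend_mul (f g : dgend_car) : dgend_car :=
  to_subspace dgend_subspace (dgend_comp_car (subspaceP f) (subspaceP g)).
Definition dgend_d (f : dgend_car) : dgend_car :=
  to_subspace dgend_subspace (dgend_diff_car (subspaceP f)).
Definition dgend_deg (m : int) (f : dgend_car) : Prop := dgend_hom m (val f).

Lemma dgend_grading : is_grading dgend_deg.
Proof.
split.
- by move=> m; apply: dgend_hom0.
- by move=> m c f g; apply: dgend_homP.
- move=> f; have [l [hl fE]] := subspaceP f.
  have : homogeneous_sum dgend_deg (\sum_(p <- l) insubd (0 : dgend_car) p.2).
    rewrite big_seq; apply: big_ind => [||p /hl hp].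
    - exact: homogeneous_sum0.
    - exact: homogeneous_sumD.
    apply: (@homogeneous_sum1 _ _ _ p.1); rewrite /dgend_deg val_insubd.
    by rewrite (asboolT (homogeneous_sum1 hp)).
  congr (homogeneous_sum _ _); apply: val_inj; rewrite fE raddf_sum.
  rewrite big_seq [RHS]big_seq; apply: eq_bigr => p /hl hp.
  by rewrite /= val_insubd (asboolT (homogeneous_sum1 hp)).
move=> s f us hf sf0 m ms; apply/val_inj/funext => x; change (val (f m) x = 0).
move: (grading_sum (dgm_grading X) x); move: x.
have fl m' : linear (val (f m')) by case: (hf m').
apply: homogeneous_sum_ind => [|x y hx hy|p x hx].
- by case: (linearB (fl m)).
- by case: (linearB (fl m)) => _ -> _ _ _; rewrite hx hy addr0.
pose s' := [seq m' + p | m' <- s].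
have us' : uniq s' by rewrite map_inj_uniq //; apply: addIr.
have := @grading_direct _ _ _ (dgm_grading X) s' (fun q => val (f (q - p)) x) us'.
move=> /(_ _ _ (m + p)); rewrite addrK; apply; last exact: map_f.
- by move=> q; rewrite -{1}[q](subrK p); case: (hf (q - p)) => _ _; apply.
rewrite big_map; under eq_bigr do rewrite addrK.
by move/(congr1 val): sf0 => /(congr1 (@^~ x)); rewrite raddf_sum fct_sumE.
Qed.

Lemma dgend_linr (f : dgend_car) : linear (dgend_mul f).
Proof.
move=> c g h; apply: val_inj; apply/funext => x /=.
by case: (dgend_carP (subspaceP f)) => fl _; rewrite fl.
Qed.

Definition dgend_alg : grAlgebra k.
Proof.
refine (@GrAlgebra k dgend_car dgend_one dgend_mul dgend_deg
  _ _ _ _ dgend_linr dgend_grading _ _).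
- abstract (by move=> f g h; apply: val_inj).
- abstract (by move=> f; apply: val_inj).
- abstract (by move=> f; apply: val_inj).
- abstract (by move=> g c f h; apply: val_inj).
- abstract (exact: dgend_hom_id).
- abstract (by move=> m n f g; apply: dgend_hom_comp).
Defined.

Lemma dgend_is_differential : @is_differential k dgend_alg dgend_d.
Proof.
have [d0 dD dN dB dZ] := linearB (@dgm_d_linear _ _ X).
have [s0 sD sN sB sZ] := linearB (sign_op_linear (dgm_grading X)).
rewrite -/dgend_sign in s0 sD sN sB sZ.
split.
- by move=> c f g; apply: val_inj; apply: dgend_diff_linear.
- by move=> m f; apply: dgend_diff_hom.
- move=> f; apply: val_inj; apply/funext => x /=.
  have [/linearB[f0 _ fN _ _] _] := dgend_carP (subspaceP f).
  rewrite /dgend_diff dB sB !(dgend_sign_d, dN, dgm_d_sq, sN, fN, dgend_signK).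
  by rewrite f0 !oppr0 addr0 !opprK add0r subrr.
- move=> m f g hf; apply: val_inj; apply/funext => x /=.
  rewrite !fctE /= [in RHS](dgend_diffE _ hf) /dgend_diff /=.
  have [/linearB[f0 _ fN fB _] _ _] := hf.
  rewrite fB (dgend_signC _ hf) scalerBr addrA subrK.
  by [].
Qed.

Definition dgEnd : dgAlgebra k := DgAlgebra dgend_is_differential.
End DgEnd.

(* B computes the derived endomorphism dg algebra RHom_L(X, X): the dg
   endomorphism algebra of a K-projective resolution of X. *)
Definition is_derived_End (k : fieldType) (L : dgAlgebra k) (X : dgModule L)
    (B : dgAlgebra k) : Prop :=
  exists (P : dgModule L) (f : P -> X),
    [/\ K_projective P, dgm_quasi_iso f & quasi_isomorphic (dgEnd P) B].

Section GradingConstructions.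
Variable k : fieldType.

Lemma grading_shift (V : lmodType k) (H : int -> V -> Prop) (n : int) :
  is_grading H -> is_grading (fun m => H (m - n)).
Proof.
move=> hH; split=> [m|m c x y|x|s f us hf sf m ms].
- exact: grading0.
- exact: gradingP.
- have [l [hl ->]] := grading_sum hH x.
  exists [seq (p.1 + n, p.2) | p <- l]; rewrite big_map; split=> // p.
  by case/mapP => q /hl hq -> /=; rewrite addrK.
have us' : uniq [seq m' - n | m' <- s] by rewrite map_inj_uniq //; apply: addIr.
have := grading_direct hH (f := fun m' => f (m' + n)) us'.
move=> /(_ _ _ (m - n)); rewrite subrK; apply; last exact: map_f.
- by move=> m'; rewrite -{1}[m'](addrK n).
- by rewrite big_map; under eq_bigr do rewrite subrK.
Qed.

Lemma grading_pair (V W : lmodType k) (H : int -> V -> Prop) (K : int -> W -> Prop) :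
  is_grading H -> is_grading K ->
  is_grading (fun m (p : V * W) => H m p.1 /\ K m p.2).
Proof.
move=> hH hK; split=> [m|m c x y [? ?] [? ?]|[x y]|s f us hf sf m ms].
- by split; apply: grading0.
- by split; apply: gradingP.
- rewrite (_ : (x, y) = (x, 0) + (0, y)); last first.
    by congr pair; rewrite /= ?addr0 ?add0r.
  apply: homogeneous_sumD.
    move: x (grading_sum hH x); apply: homogeneous_sum_ind.
    + exact: homogeneous_sum0.
    + move=> u v hu hv; have := homogeneous_sumD hu hv.
      by congr homogeneous_sum; congr pair; rewrite /= addr0.
    + by move=> m u hu; apply: (@homogeneous_sum1 _ _ _ m); split=> //; apply: grading0.
  move: y (grading_sum hK y); apply: homogeneous_sum_ind.
  + exact: homogeneous_sum0.
  + move=> u v hu hv; have := homogeneous_sumD hu hv.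
    by congr homogeneous_sum; congr pair; rewrite /= addr0.
  + by move=> m u hu; apply: (@homogeneous_sum1 _ _ _ m); split=> //; apply: grading0.
have f1 : (f m).1 = 0.
  apply: (grading_direct hH us (f := fun m' => (f m').1)) => // [m'|].
    by case: (hf m').
  by rewrite -(raddf_sum fst) sf.
have f2 : (f m).2 = 0.
  apply: (grading_direct hK us (f := fun m' => (f m').2)) => // [m'|].
    by case: (hf m').
  by rewrite -(raddf_sum snd) sf.
by rewrite [f m]surjective_pairing f1 f2.
Qed.

End GradingConstructions.

Section ProjectiveModules.
Variables (k : fieldType) (L : dgAlgebra k).

Definition dg_idempotent (x : L) : Prop := [/\ ga_hom 0 x, x ** x = x & dga_d x = 0].

Lemma ga_mul0l (x : L) : 0 ** x = 0.
Proof. by case: (linearB (@ga_linl _ L x)). Qed.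

Lemma ga_mul0r (x : L) : x ** 0 = 0.
Proof. by case: (linearB (@ga_linr _ L x)). Qed.

Variables (I : finType) (e : I -> L).

Lemma projsum_subspace :
  let P (x : {ffun I -> L}) := forall a, e a ** x a = x a in
  P 0 /\ (forall c x y, P x -> P y -> P (c *: x + y)).
Proof.
split=> [a|c x y hx hy a].
  by rewrite !ffunE; case: (linearB (@ga_linr _ L (e a))).
by rewrite !ffunE (ga_linr (e a)) hx hy.
Qed.

Definition projsum_car : lmodType k := subspace projsum_subspace.

Hypothesis he : forall a, dg_idempotent (e a).

Definition projsum_hom (m : int) (x : projsum_car) : Prop :=
  forall a, ga_hom m (val x a).

Lemma projsum_act_subproof (x : projsum_car) (b : L) a :
  e a ** [ffun a => val x a ** b] a = [ffun a => val x a ** b] a.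
Proof. by rewrite !ffunE ga_mulA (subspaceP x). Qed.
Definition projsum_act (x : projsum_car) (b : L) : projsum_car :=
  to_subspace projsum_subspace (projsum_act_subproof x b).

Lemma projsum_d_subproof (x : projsum_car) a :
  e a ** [ffun a => dga_d (val x a)] a = [ffun a => dga_d (val x a)] a.
Proof.
have [e0 _ de] := he a.
rewrite !ffunE -[in RHS](subspaceP x) (diff_leibniz (dga_diff L) _ e0) de.
by rewrite ga_mul0l add0r scale1r.
Qed.
Definition projsum_d (x : projsum_car) : projsum_car :=
  to_subspace projsum_subspace (projsum_d_subproof x).

Lemma projsum_inj_subproof a (y : L) b :
  e b ** [ffun b => if b == a then e b ** y else 0] b
  = [ffun b => if b == a then e b ** y else 0] b.
Proof.
rewrite !ffunE; case: eqP => _; last by case: (linearB (@ga_linr _ L (e b))).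
by rewrite ga_mulA; case: (he b) => _ ->.
Qed.
Definition projsum_inj a (y : L) : projsum_car :=
  to_subspace projsum_subspace (projsum_inj_subproof a y).

Lemma projsum_grading : is_grading projsum_hom.
Proof.
have gL := ga_grading L.
split=> [m a|m c x y hx hy a|x|s f us hf sf m ms].
- by rewrite /= ffunE; apply: grading0.
- by rewrite /= !ffunE; apply: gradingP.
- have -> : x = \sum_a projsum_inj a (val x a).
    apply/val_inj/ffunP => b; rewrite raddf_sum sum_ffunE (bigD1 b) //=.
    rewrite big1 => [|a]; rewrite !ffunE ?eqxx ?addr0 ?(subspaceP x) //.
    by rewrite eq_sym => /negbTE->.
  apply: big_ind => [||a _]; [exact: homogeneous_sum0 | exact: homogeneous_sumD |].
  move: (val x a) (grading_sum gL (val x a)); apply: homogeneous_sum_ind.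
  + have -> : projsum_inj a 0 = 0; last exact: homogeneous_sum0.
    apply/val_inj/ffunP => b; rewrite !ffunE; case: eqP => // _.
    by case: (linearB (@ga_linr _ L (e b))).
  + move=> u v hu hv; have -> : projsum_inj a (u + v) = projsum_inj a u + projsum_inj a v.
      apply/val_inj/ffunP => b; rewrite !ffunE; case: eqP => [_|]; rewrite ?addr0 //.
      by case: (linearB (@ga_linr _ L (e b))).
    exact: homogeneous_sumD.
  move=> m u hu; apply: (@homogeneous_sum1 _ _ _ m) => b; rewrite ffunE.
  case: eqP => _; last exact: grading0.
  by rewrite -[m]add0r; apply: ga_homM => //; case: (he b).
apply/val_inj/ffunP => a; rewrite [RHS]ffunE.
apply: (grading_direct gL us (f := fun m' => val (f m') a)) => // [m'|]; first exact: hf.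
by move/(congr1 val)/ffunP/(_ a): sf; rewrite raddf_sum sum_ffunE ffunE.
Qed.

(* The right dg module \bigoplus_(a : I) e_a L. *)
Definition projsum : dgModule L.
Proof.
refine (@DgModule k L projsum_car projsum_act projsum_hom projsum_d
  _ _ _ _ projsum_grading _ _ _ _ _).
- abstract (by move=> b c x y; apply/val_inj/ffunP => a; rewrite !ffunE (ga_linl b)).
- abstract (by move=> x c u v; apply/val_inj/ffunP => a; rewrite !ffunE (ga_linr (val x a))).
- abstract (by move=> x; apply/val_inj/ffunP => a; rewrite !ffunE ga_mul1r).
- abstract (by move=> x b c; apply/val_inj/ffunP => a; rewrite !ffunE ga_mulA).
- abstract (by move=> m n x b hx hb a; rewrite ffunE; apply: ga_homM).
- abstract (by move=> c x y; apply/val_inj/ffunP => a; rewrite !ffunE (diff_linear (dga_diff L))).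
- abstract (by move=> m x hx a; rewrite ffunE; apply: (diff_hom (dga_diff L))).
- abstract (by move=> x; apply/val_inj/ffunP => a; rewrite !ffunE (diff_sq (dga_diff L))).
- abstract (by move=> m x b hx; apply/val_inj/ffunP => a; rewrite !ffunE (diff_leibniz (dga_diff L) _ (hx a))).
Defined.

Lemma projsum_linE c (x y : projsum) a :
  val (c *: x + y) a = c *: val x a + val y a.
Proof. by rewrite ffunE; congr (_ + _); apply: ffunE. Qed.

Lemma projsum_actE (x : projsum) b a : val (dgm_act x b) a = val x a ** b.
Proof. exact: ffunE. Qed.

Lemma projsum_dE (x : projsum) a : val (dgm_d x) a = dga_d (val x a).
Proof. exact: ffunE. Qed.

End ProjectiveModules.

Section SumAndCone.
Variables (k : fieldType) (L : dgAlgebra k) (X Y : dgModule L).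

Definition dgm_sum : dgModule L.
Proof.
refine (@DgModule k L (X * Y)%type
  (fun p a => (dgm_act p.1 a, dgm_act p.2 a))
  (fun m p => dgm_hom m p.1 /\ dgm_hom m p.2)
  (fun p => (dgm_d p.1, dgm_d p.2))
  _ _ _ _ (grading_pair (dgm_grading X) (dgm_grading Y)) _ _ _ _ _).
- abstract (by move=> a c x y; rewrite /= !(dgm_linl a)).
- abstract (by move=> x c a b; rewrite /= !dgm_linr).
- abstract (by move=> [x y]; rewrite /= !dgm_act1).
- abstract (by move=> x a b; rewrite /= !dgm_actM).
- abstract (by move=> m n x a [? ?] ha; split; apply: dgm_homM).
- abstract (by move=> c x y; rewrite /= !dgm_d_linear).
- abstract (by move=> m x [? ?]; split; apply: dgm_d_hom).
- abstract (by move=> x; rewrite /= !dgm_d_sq).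
- abstract (by move=> m x a [h1 h2]; rewrite /= (dgm_leibniz _ h1) (dgm_leibniz _ h2)).
Defined.

Variables (f : X -> Y) (hf : is_dgm_morphism f).

(* Cone(f) = Y (+) X[1], d (y, x) = (d y + f x, - d x). *)
Definition dgm_cone : dgModule L.
Proof.
refine (@DgModule k L (Y * X)%type
  (fun p a => (dgm_act p.1 a, dgm_act p.2 a))
  (fun m p => dgm_hom m p.1 /\ dgm_hom (m - 1) p.2)
  (fun p => (dgm_d p.1 + f p.2, - dgm_d p.2))
  _ _ _ _ (grading_pair (dgm_grading Y) (grading_shift 1 (dgm_grading X))) _ _ _ _ _).
- abstract (by move=> a c x y; rewrite /= !(dgm_linl a)).
- abstract (by move=> x c a b; rewrite /= !dgm_linr).
- abstract (by move=> [x y]; rewrite /= !dgm_act1).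
- abstract (by move=> x a b; rewrite /= !dgm_actM).
- abstract (by move=> m n x a [? ?] ha; split; last rewrite addrAC; apply: dgm_homM).
- abstract (move=> c x y; rewrite /= !dgm_d_linear (dgmh_linear hf.1) opprD -scalerN;
    by congr pair; rewrite /= scalerDr addrACA).
- abstract (move=> m x [? h]; split;
    [ rewrite -[dgm_d x.1]scale1r; apply: (gradingP (dgm_grading Y));
      [ exact: dgm_d_hom
      | by rewrite -[m - 1]add0r; apply: (dgmh_deg hf.1) ]
    | by rewrite -scaleN1r; apply: (gradingZ (dgm_grading X)); apply: dgm_d_hom ]).
- abstract (move=> x; have [_ _ fN _ _] := linearB (dgmh_linear hf.1);
    have [_ dD dN _ _] := linearB (@dgm_d_linear _ _ X);
    have [_ eD _ _ _] := linearB (@dgm_d_linear _ _ Y);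
    by rewrite /= !(dD, dN, opprK, fN, dgm_d_sq, hf.2) eD dgm_d_sq add0r subrr).
- abstract (move=> m x a [h1 h2];
    rewrite /= (dgm_leibniz _ h1) (dgm_leibniz _ h2) (dgmh_act hf.1);
    have [_ aD _ _ _] := linearB (@dgm_linl _ _ Y a);
    have [_ _ aN _ _] := linearB (@dgm_linl _ _ X a);
    congr pair; rewrite /= ?aD ?aN; [by rewrite addrAC |];
    by rewrite opprD signzD exprN1 invrN1 mulrN1 scaleNr opprK).
Defined.

End SumAndCone.

Section LinearExtension.
Variables (k : fieldType) (K : choiceType) (V : lmodType k).

(* The k-linear map kK -> V extending f : K -> V. *)
Definition lin_ext (f : K -> V) (x : {malg k[K]}) : V :=
  \sum_(u <- msupp x) x@_u *: f u.

Lemma lin_extEw (D : {fset K}) f x : (msupp x `<=` D)%fset ->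
  lin_ext f x = \sum_(u <- D) x@_u *: f u.
Proof.
move=> xD; apply: (big_fset_incl _ xD) => u _ /mcoeff_outdom ->.
by rewrite scale0r.
Qed.

Lemma lin_ext_linear f : linear (lin_ext f).
Proof.
move=> c x y; pose D := (msupp x `|` msupp y)%fset.
rewrite (@lin_extEw D f x) ?(@lin_extEw D f y) ?fsubsetUl ?fsubsetUr //.
rewrite (@lin_extEw D) ?scaler_sumr -?big_split /=.
  by apply: eq_bigr => u _; rewrite mcoeffD mcoeffZ scalerDl scalerA.
apply: fsubset_trans (msuppD_le _ _) _; apply: fsetSU; exact: msuppZ_le.
Qed.

Lemma lin_extU f u : lin_ext f << u >> = f u.
Proof. by rewrite /lin_ext msuppU oner_eq0 big_seq_fset1 mcoeffUU scale1r. Qed.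

Lemma lin_ext_eq (f g : {malg k[K]} -> V) : linear f -> linear g ->
  (forall u, f << u >> = g << u >>) -> f =1 g.
Proof.
move=> fl gl; have [f0 fD _ _ fZ] := linearB fl; have [g0 gD _ _ gZ] := linearB gl.
move=> fg x; have -> : x = \sum_(u <- msupp x) x@_u *: << u >>.
  rewrite {1}[x]monalgE; apply: eq_bigr => u _.
  by apply/malgP => v; rewrite mcoeffZ !mcoeffU mulr_natr.
rewrite (big_morph _ fD f0) (big_morph _ gD g0).
by apply: eq_bigr => u _; rewrite fZ gZ fg.
Qed.
End LinearExtension.

(* A graded quiver with vertex set {0, ..., n-1}. *)
Record quiver (n : nat) := Quiver {
  arrow :> choiceType;
  src : arrow -> 'I_n;
  tgt : arrow -> 'I_n;
  deg : arrow -> int }.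

Section PathAlgebra.
Variables (k : fieldType) (n : nat) (Q : quiver n).

(* (v, [:: a1; ...; am]) is the path am ... a1 starting at v, which first
   traverses a1. *)
Fixpoint is_walk (v : 'I_n) (s : seq Q) : bool :=
  if s is a :: s' then (src a == v) && is_walk (tgt a) s' else true.

Definition walk_end (v : 'I_n) (s : seq Q) : 'I_n := last v [seq tgt a | a <- s].

Definition qpath : choiceType := {p : 'I_n * seq Q | is_walk p.1 p.2}.
Definition path_src (p : qpath) : 'I_n := (val p).1.
Definition path_arrows (p : qpath) : seq Q := (val p).2.
Definition path_tgt (p : qpath) : 'I_n := walk_end (path_src p) (path_arrows p).
Definition path_deg (p : qpath) : int := \sum_(a <- path_arrows p) deg a.

Definition kpath : lmodType k := {malg k[qpath]}.

Definition pelt (x : 'I_n * seq Q) : kpath :=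
  if insub x is Some p then << (p : qpath) >> else 0.
Definition triv (v : 'I_n) : kpath := pelt (v, [::]).
Definition arr (a : Q) : kpath := pelt (src a, [:: a]).

Definition path_mul (q p : qpath) : kpath :=
  if path_tgt p == path_src q then pelt (path_src p, path_arrows p ++ path_arrows q)
  else 0.
Definition kpath_mul (x y : kpath) : kpath :=
  lin_ext (fun q => lin_ext (path_mul q) y) x.
Definition kpath_one : kpath := \sum_v triv v.
Definition kpath_hom (m : int) (x : kpath) : Prop :=
  forall p, p \in msupp x -> path_deg p = m.

Lemma is_walk_cat v s1 s2 :
  is_walk v (s1 ++ s2) = is_walk v s1 && is_walk (walk_end v s1) s2.
Proof. by elim: s1 v => //= a s IH v; rewrite IH andbA. Qed.

Lemma walk_end_cat v s1 s2 : walk_end v (s1 ++ s2) = walk_end (walk_end v s1) s2.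
Proof. by rewrite /walk_end map_cat last_cat. Qed.

Lemma peltE (p : qpath) : pelt (val p) = << p >>.
Proof. by rewrite /pelt valK. Qed.

Lemma path_mulP (q p : qpath) : path_tgt p == path_src q ->
  exists2 r : qpath, path_mul q p = << r >> &
    val r = (path_src p, path_arrows p ++ path_arrows q).
Proof.
move=> pq; have w : is_walk (path_src p) (path_arrows p ++ path_arrows q).
  by rewrite is_walk_cat (valP p) /= -/(path_tgt p) (eqP pq) (valP q).
exists (Sub (path_src p, path_arrows p ++ path_arrows q) w); last by rewrite SubK.
by rewrite /path_mul pq -peltE SubK.
Qed.

Lemma kpath_linl y : linear (kpath_mul^~ y).
Proof. exact: lin_ext_linear. Qed.

Lemma kpath_linr x : linear (kpath_mul x).
Proof.
move=> c y z; rewrite /kpath_mul /lin_ext scaler_sumr -big_split /=.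
apply: eq_bigr => q _; rewrite -!/(lin_ext _ _) lin_ext_linear scalerDr.
by rewrite !scalerA mulrC.
Qed.

Lemma kpath_mulU q p : kpath_mul << q >> << p >> = path_mul q p.
Proof. by rewrite /kpath_mul !lin_extU. Qed.

Lemma kpath_mul0l x : kpath_mul 0 x = 0.
Proof. by case: (linearB (kpath_linl x)). Qed.
Lemma kpath_mul0r x : kpath_mul x 0 = 0.
Proof. by case: (linearB (kpath_linr x)). Qed.

Lemma linear_comp (U V W : lmodType k) (f : V -> W) (g : U -> V) :
  linear f -> linear g -> linear (fun x => f (g x)).
Proof. by move=> fl gl c x y; rewrite gl fl. Qed.

Lemma kpath_mulA : associative kpath_mul.
Proof.
move=> x y z.
apply: (@lin_ext_eq _ _ _ (fun x => kpath_mul x (kpath_mul y z))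
          (fun x => kpath_mul (kpath_mul x y) z)).
- exact: kpath_linl.
- exact: linear_comp (kpath_linl z) (kpath_linl y).
move=> p {x}; apply: (@lin_ext_eq _ _ _ (fun y => kpath_mul << p >> (kpath_mul y z))
          (fun y => kpath_mul (kpath_mul << p >> y) z)).
- exact: linear_comp (kpath_linr _) (kpath_linl z).
- exact: linear_comp (kpath_linl z) (kpath_linr _).
move=> q {y}; apply: (@lin_ext_eq _ _ _ (fun z => kpath_mul << p >> (kpath_mul << q >> z))
          (fun z => kpath_mul (kpath_mul << p >> << q >>) z)).
- exact: linear_comp (kpath_linr _) (kpath_linr _).
- exact: kpath_linr.
move=> r {z}; rewrite !kpath_mulU.
have [rq|/negbTE rq] := boolP (path_tgt r == path_src q);
  have [qp|/negbTE qp] := boolP (path_tgt q == path_src p).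
- have [s -> sE] := path_mulP rq; have [t -> tE] := path_mulP qp.
  rewrite !kpath_mulU /path_mul /path_tgt /path_src /path_arrows sE tE /=.
  rewrite walk_end_cat -/(path_src r) -/(path_arrows r) -/(path_tgt r).
  rewrite (eqP rq) eqxx -[walk_end _ _]/(path_tgt q) -[(sval p).1]/(path_src p) qp.
  by rewrite catA.
- have [s -> sE] := path_mulP rq; rewrite kpath_mulU [path_mul p q]/path_mul qp kpath_mul0l.
  rewrite /path_mul /path_tgt /path_src /path_arrows sE /= walk_end_cat.
  rewrite -/(path_src r) -/(path_arrows r) -/(path_tgt r) (eqP rq).
  by rewrite -[walk_end _ _]/(path_tgt q) -[(sval p).1]/(path_src p) qp.
- have [t -> tE] := path_mulP qp; rewrite kpath_mulU [path_mul q r]/path_mul rq kpath_mul0r.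
  by rewrite /path_mul /path_src tE /= rq.
- by rewrite /path_mul rq qp kpath_mul0l kpath_mul0r.
Qed.

Definition triv_path v : qpath := exist _ (v, [::]) isT.
Lemma trivE v : triv v = << triv_path v >>.
Proof. by rewrite -peltE. Qed.

Lemma kpath_mul1l : left_id kpath_one kpath_mul.
Proof.
apply: lin_ext_eq => [|//|p]; first exact: kpath_linr.
have [m0 mD _ _ _] := linearB (kpath_linl << p >>).
rewrite /kpath_one (big_morph _ mD m0) (bigD1 (path_tgt p)) //=.
rewrite big1 => [|v vp]; rewrite trivE kpath_mulU /path_mul /path_src /=.
  by rewrite eqxx addr0 cats0 -peltE [val p]surjective_pairing.
by rewrite eq_sym (negbTE vp).
Qed.

Lemma kpath_mul1r : right_id kpath_one kpath_mul.
Proof.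
apply: (@lin_ext_eq _ _ _ (kpath_mul^~ _) id) => [|//|p]; first exact: kpath_linl.
have [m0 mD _ _ _] := linearB (kpath_linr << p >>).
rewrite /kpath_one (big_morph _ mD m0) (bigD1 (path_src p)) //=.
rewrite big1 => [|v vp]; rewrite trivE kpath_mulU /path_mul /path_tgt /walk_end /=.
  by rewrite eqxx addr0 -peltE [val p]surjective_pairing.
by rewrite (negbTE vp).
Qed.

Lemma kpath_homU m p : path_deg p = m -> kpath_hom m << p >>.
Proof. by move=> pm q; rewrite msuppU oner_eq0 inE => /eqP ->. Qed.

Lemma kpath_hom_coeff m x p : kpath_hom m x -> path_deg p != m -> x@_p = 0.
Proof. by move=> hx; case: msuppP => // /hx ->; rewrite eqxx. Qed.

Lemma kpath_hom0 m : kpath_hom m 0.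
Proof. by move=> p; rewrite msupp0. Qed.

Lemma kpath_homP m c x y : kpath_hom m x -> kpath_hom m y -> kpath_hom m (c *: x + y).
Proof.
move=> hx hy p; rewrite -mcoeff_neq0 mcoeffD mcoeffZ; apply: contra_neq_eq => pm.
by rewrite (kpath_hom_coeff hx) ?(kpath_hom_coeff hy) // mulr0 addr0.
Qed.

Lemma kpath_grading : is_grading kpath_hom.
Proof.
split=> [|||s f us hf sf m ms]; [exact: kpath_hom0 | exact: kpath_homP | |].
  move=> x; exists [seq (path_deg p, x@_p *: << p >> : kpath) | p <- msupp x]; split.
    move=> _ /mapP[p _ ->] /=; rewrite -[_ *: _]addr0.
    by apply: kpath_homP (kpath_hom0 _); apply: kpath_homU.
  rewrite big_map /= {1}[x]monalgE; apply: eq_bigr => p _.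
  by apply/malgP => q; rewrite mcoeffZ !mcoeffU mulr_natr.
apply/malgP => p; rewrite mcoeff0.
have [pm|pm] := eqVneq (path_deg p) m; last exact: kpath_hom_coeff (hf m) pm.
move/(congr1 (mcoeff p)): sf; rewrite raddf_sum mcoeff0 (bigD1_seq m) //=.
rewrite big1 ?addr0 // => m' /negbTE mm.
by apply: kpath_hom_coeff (hf m') _; rewrite pm eq_sym mm.
Qed.

Lemma kpath_hom_sum (I : eqType) m (r : seq I) (F : I -> kpath) :
  (forall j, j \in r -> kpath_hom m (F j)) -> kpath_hom m (\sum_(j <- r) F j).
Proof. by move=> h; apply: (grading_big kpath_grading) => j /h. Qed.

Lemma kpath_hom1 : kpath_hom 0 kpath_one.
Proof.
apply: kpath_hom_sum => v _; rewrite trivE; apply: kpath_homU.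
by rewrite /path_deg big_nil.
Qed.

Lemma kpath_homM m p x y :
  kpath_hom m x -> kpath_hom p y -> kpath_hom (m + p) (kpath_mul x y).
Proof.
move=> hx hy; apply: kpath_hom_sum => u /hx um; apply: (gradingZ kpath_grading).
apply: kpath_hom_sum => v /hy vp; apply: (gradingZ kpath_grading).
have [vu|/negbTE vu] := boolP (path_tgt v == path_src u); last first.
  by rewrite /path_mul vu; apply: kpath_hom0.
have [r -> rE] := path_mulP vu; apply: kpath_homU.
by rewrite /path_deg /path_arrows rE big_cat /= addrC -um -vp.
Qed.

Definition path_algebra : grAlgebra k :=
  GrAlgebra kpath_mulA kpath_mul1l kpath_mul1r kpath_linl kpath_linr
    kpath_grading kpath_hom1 kpath_homM.
End PathAlgebra.

Canonical path_algebra.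
Arguments triv {k n Q}.
Arguments arr {k n Q}.
Arguments pelt {k n Q}.

(* Non-negative degrees, and an enumeration of the finitely many arrows of
   each degree. *)
Record lf_quiver (n : nat) := LfQuiver {
  lf_sort :> quiver n;
  arrows_of : int -> seq lf_sort;
  arrows_ofP : forall m a, (a \in arrows_of m) = (deg a == m);
  deg_ge0 : forall a : lf_sort, 0 <= deg a }.

Section Mutation.
Variables (k : fieldType) (n : nat) (Q : lf_quiver n) (i : 'I_n).

Definition mutA : finType := seq_sub [seq a <- arrows_of Q 0 | src a == i].
Definition inA (a : Q) : bool := (deg a == 0) && (src a == i).
Definition toA (a : Q) : option mutA := insub a.

Lemma toA_inA a : toA a = inA a :> bool.
Proof.
rewrite /toA /inA; case: insubP => [u|]; rewrite mem_filter arrows_ofP andbC.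
  by move=> ->.
by move=> /negbTE->.
Qed.

Definition chi (v : 'I_n) : int := (v == i)%:Z.

(* The arrows phi, alpha^*, alpha phi, phi alpha^-1 and alpha phi beta^-1;
   mvalid states when they exist. *)
Inductive mcode :=
| MOld of Q
| MStar of mutA
| MLeft of mutA & Q
| MRight of Q & mutA
| MBoth of mutA & Q & mutA.

Definition mvalid (c : mcode) : bool :=
  match c with
  | MOld phi => ~~ inA phi
  | MStar _ => true
  | MLeft _ phi => tgt phi == i
  | MRight phi _ => ~~ inA phi && (src phi == i)
  | MBoth _ phi _ => (src phi == i) && (tgt phi == i)
  end.

Definition msrc (c : mcode) : 'I_n :=
  match c with
  | MOld phi => src phi
  | MStar al => tgt (val al)
  | MLeft _ phi => src phi
  | MRight _ al => tgt (val al)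
  | MBoth _ _ be => tgt (val be)
  end.

Definition mtgt (c : mcode) : 'I_n :=
  match c with
  | MOld phi => tgt phi
  | MStar _ => i
  | MLeft al _ => tgt (val al)
  | MRight phi _ => tgt phi
  | MBoth al _ _ => tgt (val al)
  end.

Definition mdeg_old (phi : Q) : int := deg phi - chi (src phi) + chi (tgt phi).

Definition mdeg (c : mcode) : int :=
  match c with
  | MOld phi => mdeg_old phi
  | MStar _ => 0
  | MLeft _ phi => mdeg_old phi - 1
  | MRight phi _ => mdeg_old phi + 1
  | MBoth _ phi _ => mdeg_old phi
  end.

Definition mcode_enc (c : mcode) :
    Q + mutA + (mutA * Q) + (Q * mutA) + (mutA * Q * mutA) :=
  match c with
  | MOld phi => inl (inl (inl (inl phi)))
  | MStar al => inl (inl (inl (inr al)))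
  | MLeft al phi => inl (inl (inr (al, phi)))
  | MRight phi al => inl (inr (phi, al))
  | MBoth al phi be => inr (al, phi, be)
  end.
Definition mcode_dec (c : Q + mutA + (mutA * Q) + (Q * mutA) + (mutA * Q * mutA)) :=
  match c with
  | inl (inl (inl (inl phi))) => MOld phi
  | inl (inl (inl (inr al))) => MStar al
  | inl (inl (inr (al, phi))) => MLeft al phi
  | inl (inr (phi, al)) => MRight phi al
  | inr (al, phi, be) => MBoth al phi be
  end.
Lemma mcode_encK : cancel mcode_enc mcode_dec.
Proof. by case. Qed.
HB.instance Definition _ := Choice.copy mcode (can_type mcode_encK).

Definition mutated_quiver : quiver n :=
  @Quiver n {c : mcode | mvalid c}
    (fun a => msrc (val a)) (fun a => mtgt (val a)) (fun a => mdeg (val a)).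

Local Notation kQ := (path_algebra k Q).
Local Notation kM := (path_algebra k mutated_quiver).

Definition marr (c : mcode) : kM :=
  if insub c is Some a then arr (a : mutated_quiver) else 0.

Definition red : kQ -> kQ :=
  lin_ext (fun p : qpath Q =>
    if path_arrows p is a :: _ then if inA a then 0 else << p >> else << p >>).

(* p / alpha *)
Definition quo (x : kQ) (al : mutA) : kQ :=
  lin_ext (fun p : qpath Q =>
    if path_arrows p is a :: s then
      if a == val al then pelt (tgt a, s) else 0
    else 0) x.

(* phi, with alpha put on its left if l = Some alpha, and with beta^-1 put on
   its right if r = Some beta. *)
Definition decorate (l : option mutA) (phi : Q) (r : option mutA) : kM :=
  marr match l, r with
       | None, None => MOld phi
       | Some al, None => MLeft al phi
       | None, Some be => MRight phi be
       | Some al, Some be => MBoth al phi be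
       end.

(* dec on a nontrivial path given by its list of arrows in order of traversal;
   r is the beta (if any) whose inverse the choice made at the preceding Delta
   has put on the right of the first arrow. *)
Fixpoint dec_walk (r : option mutA) (s : seq Q) : kM :=
  if s is phi :: s' then
    if s' is psi :: s'' then
      if toA psi is Some al then dec_walk None s'' ** decorate (Some al) phi r
      else if tgt phi == i then
        dec_walk None s' ** decorate None phi r
        - \sum_(al : mutA) dec_walk (Some al) s' ** decorate (Some al) phi r
      else dec_walk None s' ** decorate None phi r
    else decorate None phi r
  else ga_one kM.

Definition dec : kQ -> kM :=
  lin_ext (fun p : qpath Q =>
    if path_arrows p is [::] then triv (path_src p)
    else dec_walk None (path_arrows p)).

Definition arrow_prod (s : seq mutated_quiver) : kM :=
  foldl (fun (x : kM) a => arr a ** x) (ga_one kM) s.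

(* alpha q *)
Definition lmulA (al : mutA) : kM -> kM :=
  lin_ext (fun p : qpath mutated_quiver =>
    if path_arrows p is a :: s then
      match val (last a s) with
      | MOld phi => marr (MLeft al phi)
      | MRight phi be => marr (MBoth al phi be)
      | _ => 0
      end ** arrow_prod (belast a s)
    else 0).

(* q alpha^-1 *)
Definition rdivA (q : kM) (al : mutA) : kM :=
  lin_ext (fun p : qpath mutated_quiver =>
    if path_arrows p is a :: s then
      arrow_prod s **
      match val a with
      | MOld phi => marr (MRight phi al)
      | MLeft be phi => marr (MBoth be phi al)
      | _ => 0
      end
    else 0) q.

Section Differential.
Variable d : kQ -> kQ.

Definition mdiff_old (phi : Q) : kM :=
  if tgt phi == i then
    \sum_(al : mutA) marr (MStar al) ** marr (MLeft al phi) - dec (red (d (arr phi)))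
  else dec (red (d (arr phi))).

Definition mdiff_left (al : mutA) (phi : Q) : kM :=
  dec (arr (val al) ** red (d (arr phi))).

Definition mdiff_arrow (c : mcode) : kM :=
  match c with
  | MOld phi => mdiff_old phi
  | MStar _ => 0
  | MLeft al phi => mdiff_left al phi
  | MRight phi al =>
      rdivA (mdiff_old phi) al
      + (-1) ^ mdeg (MOld phi) *: (marr (MOld phi) ** marr (MStar al))
      - (-1) ^ chi (tgt phi) *: dec (quo (d (arr phi)) al)
  | MBoth al phi be =>
      rdivA (mdiff_left al phi) be
      + (-1) ^ mdeg (MLeft al phi) *: (marr (MLeft al phi) ** marr (MStar be))
      - lmulA al (dec (quo (d (arr phi)) be))
  end.

(* Graded Leibniz rule along a path, arrows listed in order of traversal. *)
Fixpoint mdiff_walk (s : seq mutated_quiver) : kM :=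
  if s is a :: s' then
    mdiff_walk s' ** arr a
    + (-1) ^ (\sum_(b <- s') deg b) *: (arrow_prod s' ** mdiff_arrow (val a))
  else 0.

Definition mutated_diff : kM -> kM :=
  lin_ext (fun p : qpath mutated_quiver => mdiff_walk (path_arrows p)).

Section SiltingMutation.
Hypothesis hd : is_differential d.
Hypothesis he : forall j, d (triv j) = 0.

Definition dgQ : dgAlgebra k := DgAlgebra hd.

Lemma triv_idempotent j : @dg_idempotent k dgQ (triv j).
Proof.
split; last exact: he.
  by rewrite trivE; apply: kpath_homU; rewrite /path_deg big_nil.
by rewrite !trivE /= kpath_mulU /path_mul /= eqxx -trivE.
Qed.

(* P_j = e_j kQ and \bigoplus_(alpha in A) P_(t alpha). *)
Definition dgP (j : 'I_n) : dgModule dgQ :=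
  projsum (fun _ : unit => triv_idempotent j).
Definition dgP_tgtA : dgModule dgQ :=
  projsum (fun al : mutA => triv_idempotent (tgt (val al))).

Lemma arrP (a : Q) : exists2 p : qpath Q,
  arr a = << p >> :> kpath k Q & val p = (src a, [:: a]).
Proof.
have w : is_walk (src a) [:: a] by rewrite /= eqxx.
exists (Sub (src a, [:: a]) w : qpath Q); last by rewrite SubK.
by rewrite -peltE SubK.
Qed.

Lemma arrA_hom (al : mutA) : kpath_hom 0 (arr (val al) : kpath k Q).
Proof.
have [p -> pE] := arrP (val al); apply: kpath_homU.
rewrite /path_deg /path_arrows pE big_seq1; apply/eqP.
by have := valP al; rewrite mem_filter arrows_ofP => /andP[].
Qed.

Lemma d_arrA (al : mutA) : d (arr (val al)) = 0.
Proof.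
have h := diff_hom hd (@arrA_hom al); apply/malgP => p; rewrite mcoeff0.
apply: (kpath_hom_coeff h); rewrite add0r; apply: contraTneq isT => pE.
have : 0 <= path_deg p by apply: Num.Theory.sumr_ge0 => a _; apply: deg_ge0.
by rewrite pE.
Qed.

Lemma triv_arr (a : Q) : kpath_mul (triv (tgt a)) (arr a) = arr a :> kpath k Q.
Proof.
have [p pE ps] := arrP a; rewrite trivE pE kpath_mulU /path_mul.
rewrite /path_tgt /path_src /path_arrows ps /= /walk_end /= eqxx.
by rewrite -peltE ps.
Qed.

Lemma approx_subproof (x : dgP i) (al : mutA) :
  (triv (tgt (val al)) : dgQ) ** [ffun al : mutA => (arr (val al) : dgQ) ** val x tt] al
  = [ffun al : mutA => (arr (val al) : dgQ) ** val x tt] al.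
Proof. by rewrite !ffunE /= kpath_mulA triv_arr. Qed.

(* P_i -> \bigoplus_(alpha in A) P_(t alpha) with components alpha. *)
Definition approx (x : dgP i) : dgP_tgtA :=
  to_subspace (projsum_subspace _) (approx_subproof x).

Lemma approxE (x : dgP i) (al : mutA) :
  val (approx x) al = (arr (val al) : dgQ) ** val x tt.
Proof. exact: ffunE. Qed.

Lemma approx_morphism : is_dgm_morphism approx.
Proof.
split; first split=> [c x y|x a|p x hx al].
- apply/val_inj/ffunP => al; apply: etrans (approxE _ al) _.
  apply: esym; apply: etrans (projsum_linE c (approx x) (approx y) al) _.
  apply: etrans (congr2 _ (congr1 _ (approxE x al)) (approxE y al)) _.
  apply: etrans (esym (ga_linr (arr (val al) : dgQ) c (val x tt) (val y tt))) _.
  by congr (_ ** _); rewrite (projsum_linE c x y tt).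
- apply/val_inj/ffunP => al; apply: etrans (approxE _ al) _.
  apply: esym; apply: etrans (projsum_actE (approx x) a al) _.
  apply: etrans (congr1 (fun u : dgQ => u ** a) (approxE x al)) _.
  apply: etrans (esym (ga_mulA (arr (val al) : dgQ) (val x tt) a)) _.
  by congr (_ ** _); rewrite (projsum_actE x a tt).
- have := ga_homM (@arrA_hom al : ga_hom 0 (arr (val al) : dgQ)) (hx tt).
  by rewrite -(approxE x al).
move=> x; apply/val_inj/ffunP => al; apply: etrans (approxE _ al) _.
apply: esym; apply: etrans (projsum_dE (approx x) al) _.
apply: etrans (congr1 (@dga_d _ dgQ) (approxE x al)) _.
apply: etrans (diff_leibniz hd (val x tt) (@arrA_hom al)) _.
by rewrite d_arrA expr0z scale1r (@ga_mul0l _ dgQ) add0r (projsum_dE x tt).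
Qed.

(* P_i^* (+) \bigoplus_(j != i) P_j *)
Definition silting_mutation : dgModule dgQ :=
  dgm_sum (dgm_cone approx_morphism)
    (projsum (fun j : {j : 'I_n | j != i} => triv_idempotent (val j))).

End SiltingMutation.
End Differential.
End Mutation.

(* Main.v *)
(* The idea is to let kM act on the left and kQ on the right of a bimodule Y of
   elements u + sum_alpha v_alpha alpha with u, v_alpha in kM, where an arrow phi
   of Q acts on the right as the sum of the arrows of M made from it.  The kM-part
   of 1 . p is dec (red p), and the formulas for the differential of kM say that
   one and the same D on Y is a derivation for both actions; hence D, and with it
   the differential of kM, squares to zero.

   The silting complex T has an inclusion iota into Y.  Since the differential of
   q gamma^-1 contains q gamma^*, the kQ-linear map replacing q gamma^* by
   +-q gamma^-1 contracts Y onto iota T up to a locally nilpotent error, and a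
   Neumann series makes iota a homotopy equivalence.  Maps out of T into an
   acyclic module are null-homotopic, T being semifree, so Y is K-projective and
   resolves T.

   Left multiplication kM -> End(Y) is retracted by F |-> (kM-part of F(1)), and the
   homotopy on Y shows that it is a quasi-isomorphism. *)

From mathcomp Require Import all_boot all_order all_algebra.
From mathcomp Require Import boolp functions finmap.
From mathcomp.multinomials Require Import monalg.
From mathcomp Require Import ring.
Require Import Defs.

Set Implicit Arguments.
Unset Strict Implicit.
Unset Printing Implicit Defensive.

Import GRing.Theory.
Local Open Scope ring_scope.

(** Y is used in place of T because left multiplication makes kM act on it strictly. Its shape
    mirrors T: the generator of the shifted P_i has degree 1 and its boundary is the sum over alpha
    of the generators of P_(t alpha) times alpha; in Y the element e_i has degree 1 and D e_i =
    sum_alpha alpha^* alpha. This shift at i is the origin of [chi] in the degrees of M and of the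
    signs in its differential.

    The square of the differential of kM is never computed through nested decorations. Since d
    squares to zero, D D commutes with the action of kQ; it kills 1 and every alpha; and the arrows
    of M other than alpha^* are, up to sign, the components of 1 . phi and alpha . phi. So it is
    enough to compare each formula for an arrow of M with D at a single arrow of Q.

    All this is done for algebras known only through recursion along paths, arrows being added on
    the right ([path_alg], [mut_data]). Lists of arrows return only where the given operations are
    shown to obey these recursions. *)

Section LinearMaps.
Variables (k : fieldType) (V W : lmodType k) (f : V -> W).
Hypothesis fl : linear f.

Lemma lin0 : f 0 = 0. Proof. by case: (Defs.linearB fl). Qed.
Lemma linD x y : f (x + y) = f x + f y. Proof. by case: (Defs.linearB fl). Qed.
Lemma linN x : f (- x) = - f x. Proof. by case: (Defs.linearB fl). Qed.
Lemma linZ c x : f (c *: x) = c *: f x. Proof. by case: (Defs.linearB fl) => _ _ _ _ ->. Qed.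
Lemma linB x y : f (x - y) = f x - f y. Proof. by rewrite linD linN. Qed.
Lemma lin_sum (I : Type) (r : seq I) (P : pred I) (F : I -> V) :
  f (\sum_(j <- r | P j) F j) = \sum_(j <- r | P j) f (F j).
Proof. exact: (big_morph f linD lin0). Qed.
End LinearMaps.

Section LinearClosure.
Variables (k : fieldType) (U V W : lmodType k).

Lemma linear_id : linear (@id V). Proof. by []. Qed.
Lemma linear_const0 : linear (fun _ : V => 0 : W).
Proof. by move=> c x y; rewrite scaler0 addr0. Qed.
Lemma linear_add (f g : V -> W) : linear f -> linear g -> linear (fun x => f x + g x).
Proof. by move=> fl gl c x y; rewrite fl gl scalerDr addrACA. Qed.
Lemma linear_opp (f : V -> W) : linear f -> linear (fun x => - f x).
Proof. by move=> fl c x y; rewrite fl opprD scalerN. Qed.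
Lemma linear_sub (f g : V -> W) : linear f -> linear g -> linear (fun x => f x - g x).
Proof. by move=> fl gl; apply: linear_add fl (linear_opp gl). Qed.
Lemma linear_scale a (f : V -> W) : linear f -> linear (fun x => a *: f x).
Proof. by move=> fl c x y; rewrite fl scalerDr !scalerA mulrC. Qed.
Lemma linear_bigsum (I : Type) (r : seq I) (P : pred I) (F : I -> V -> W) :
  (forall j, linear (F j)) -> linear (fun x => \sum_(j <- r | P j) F j x).
Proof.
move=> Fl c x y; rewrite scaler_sumr -big_split; apply: eq_bigr => j _; exact: Fl.
Qed.
Lemma linear_if b (f g : V -> W) : linear f -> linear g ->
  linear (fun x => if b then f x else g x).
Proof. by case: b. Qed.
Lemma linear_pair (f : V -> U) (g : V -> W) :
  linear f -> linear g -> linear (fun x => (f x, g x)).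
Proof. by move=> fl gl c x y; rewrite fl gl. Qed.
Lemma linear_fst : linear (@fst U W). Proof. by []. Qed.
Lemma linear_snd : linear (@snd U W). Proof. by []. Qed.
Lemma linear_compose (f : V -> W) (g : U -> V) :
  linear f -> linear g -> linear (fun x => f (g x)).
Proof. by move=> fl gl c x y; rewrite gl fl. Qed.
Lemma linear_scalel (f : V -> k) (w : W) :
  linear (f : V -> k^o) -> linear (fun x => f x *: w).
Proof. by move=> fl c x y; rewrite fl scalerDl scalerA. Qed.
End LinearClosure.

Section FinfunLinear.
Variables (k : fieldType) (I : finType) (V W : lmodType k).
Lemma linear_ffun (F : I -> V -> W) :
  (forall j, linear (F j)) -> linear (fun x => [ffun j => F j x]).
Proof. by move=> Fl c x y; apply/ffunP => j; rewrite !ffunE Fl. Qed.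
End FinfunLinear.

(** * Homogeneous components in graded vector spaces *)

Section GradedMaps.
Variables (k : fieldType) (V : lmodType k) (H : int -> V -> Prop).
Hypothesis hH : is_grading H.

(* If x lies in degree m then its decomposition into homogeneous pieces can be
   regrouped by degree, and only the pieces of degree m survive. *)
Lemma grading_refine (H' : int -> V -> Prop) :
  (forall m x, H' m x -> H m x) -> (forall m, H' m 0) ->
  (forall m c x y, H' m x -> H' m y -> H' m (c *: x + y)) ->
  (forall x, homogeneous_sum H' x) -> forall m x, H m x -> H' m x.
Proof.
move=> sub H'0 H'P H's m x hx; have [l [hl xE]] := H's x.
pose s := undup (m :: [seq p.1 | p <- l]).
pose f q := \sum_(p <- l | p.1 == q) p.2.
have hf q : H' q (f q).
  rewrite /f big_seq_cond; apply: big_ind => // [u v hu hv|p /andP[/hl hp /eqP <-] //].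
  by rewrite -[u]scale1r; apply: H'P.
have us : uniq s by apply: undup_uniq.
have ms : m \in s by rewrite mem_undup mem_head.
have xs : x = \sum_(q <- s) f q.
  rewrite xE /f (exchange_big_dep xpredT) //= big_seq [RHS]big_seq.
  apply: eq_bigr => p pl; under eq_bigl do rewrite eq_sym.
  rewrite (big_rem p.1) /= ?mem_undup; last by rewrite inE map_f ?orbT.
  rewrite eqxx big_seq_cond big1 ?addr0 // => q.
  by rewrite mem_rem_uniq // !inE => /andP[/andP[/negbTE->]].
suff -> : x = f m by [].
pose g q := if q == m then f m - x else f q.
suff : g m = 0 by rewrite /g eqxx => /eqP; rewrite subr_eq0 => /eqP.
apply: (@grading_direct _ _ _ hH s g us _ _ m ms) => [q|].
  rewrite /g; case: eqP => [->|_]; last exact/sub.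
  by rewrite addrC -scaleN1r; apply: (gradingP hH) => //; apply: sub.
rewrite /g; rewrite (bigD1_seq m) //= eqxx (eq_bigr f); last by move=> q /negbTE ->.
rewrite [X in _ + X](_ : _ = x - f m); first by rewrite addrA subrK subrr.
by rewrite xs [in RHS](bigD1_seq m) //= addrAC subrr add0r.
Qed.

(** The decomposition supplied by [choice] is arbitrary and not linear in x. By [zero] the part of
    degree m of a list depends only on the sum of the list, and this makes the projection linear. *)
Lemma homogeneous_part (m : int) : exists pr : V -> V,
  [/\ linear pr, forall x, H m (pr x), forall x, H m x -> pr x = x &
      forall q x, q != m -> H q x -> pr x = 0].
Proof.
have [L hL] := choice (grading_sum hH).
pose pr x := \sum_(p <- L x | p.1 == m) p.2.
have zero (l : seq (int * V)) : (forall p, p \in l -> H p.1 p.2) ->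
    \sum_(p <- l) p.2 = 0 -> \sum_(p <- l | p.1 == m) p.2 = 0.
  move=> hl l0; pose s := undup (m :: [seq p.1 | p <- l]).
  pose f q := \sum_(p <- l | p.1 == q) p.2.
  apply: (@grading_direct _ _ _ hH s f).
  - exact: undup_uniq.
  - by move=> q; apply: grading_big => // p /hl hp /eqP <-.
  - rewrite /f (exchange_big_dep xpredT) //= -[RHS]l0 big_seq [RHS]big_seq.
    apply: eq_bigr => p pl; under eq_bigl do rewrite eq_sym.
    rewrite (big_rem p.1) /= ?mem_undup; last by rewrite inE map_f ?orbT.
    rewrite eqxx big_seq_cond big1 ?addr0 // => q.
    by rewrite mem_rem_uniq ?undup_uniq // !inE => /andP[/andP[/negbTE->]].
  - by rewrite mem_undup mem_head.
have prE l x : (forall p, p \in l -> H p.1 p.2) -> x = \sum_(p <- l) p.2 ->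
    pr x = \sum_(p <- l | p.1 == m) p.2.
  move=> hl xE; apply/eqP; rewrite -subr_eq0 -sumrN; apply/eqP.
  have := zero (L x ++ [seq (p.1, - p.2) | p <- l]); rewrite !big_cat !big_map /=.
  apply; last by rewrite sumrN -xE -(hL x).2 subrr.
  move=> p; rewrite mem_cat => /orP[/(hL x).1 //|/mapP[q /hl hq ->]] /=.
  by rewrite -scaleN1r; apply: gradingZ.
exists pr; split=> [c x y|x|x hx|q x qm hx].
- rewrite (prE ([seq (p.1, c *: p.2) | p <- L x] ++ L y)).
  + by rewrite big_cat big_map /= -scaler_sumr.
  + move=> p; rewrite mem_cat => /orP[/mapP[q /(hL x).1 hq ->]|/(hL y).1 //].
    exact: gradingZ.
  + by rewrite big_cat big_map /= -scaler_sumr -(hL x).2 -(hL y).2.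
- by apply: grading_big => // p /(hL x).1 hp /eqP <-.
- rewrite (prE [:: (m, x)]) ?big_cons ?big_nil /= ?eqxx ?addr0 // => p.
  by rewrite inE => /eqP ->.
- rewrite (prE [:: (q, x)]) ?big_cons ?big_nil /= ?(negbTE qm) ?addr0 // => p.
  by rewrite inE => /eqP ->.
Qed.

Lemma homogeneous_seq (x : V) : exists (s : seq int) (f : int -> V),
  [/\ uniq s, forall m, H m (f m) & x = \sum_(m <- s) f m].
Proof.
have [l [hl ->]] := grading_sum hH x.
exists (undup [seq p.1 | p <- l]), (fun q => \sum_(p <- l | p.1 == q) p.2); split.
- exact: undup_uniq.
- by move=> q; apply: grading_big => // p /hl hp /eqP <-.
rewrite (exchange_big_dep xpredT) //= big_seq [RHS]big_seq.
apply: eq_bigr => p pl; under eq_bigl do rewrite eq_sym.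
rewrite (big_rem p.1) /= ?mem_undup ?map_f //.
rewrite eqxx big_seq_cond big1 ?addr0 // => q.
by rewrite mem_rem_uniq ?undup_uniq // !inE => /andP[/andP[/negbTE->]].
Qed.

End GradedMaps.

(** * Computation rules in graded algebras and the sign automorphism *)

Section AlgebraLaws.
Variables (k : fieldType) (R : grAlgebra k).
Implicit Types x y z : R.

Lemma gmul0l x : 0 ** x = 0. Proof. exact: lin0 (@ga_linl _ R x). Qed.
Lemma gmul0r x : x ** 0 = 0. Proof. exact: lin0 (@ga_linr _ R x). Qed.
Lemma gmulDl x y z : (x + y) ** z = x ** z + y ** z. Proof. exact: linD (@ga_linl _ R z) x y. Qed.
Lemma gmulDr x y z : z ** (x + y) = z ** x + z ** y. Proof. exact: linD (@ga_linr _ R z) x y. Qed.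
Lemma gmulNl x z : (- x) ** z = - (x ** z). Proof. exact: linN (@ga_linl _ R z) x. Qed.
Lemma gmulNr x z : z ** (- x) = - (z ** x). Proof. exact: linN (@ga_linr _ R z) x. Qed.
Lemma gmulBl x y z : (x - y) ** z = x ** z - y ** z. Proof. exact: linB (@ga_linl _ R z) x y. Qed.
Lemma gmulBr x y z : z ** (x - y) = z ** x - z ** y. Proof. exact: linB (@ga_linr _ R z) x y. Qed.
Lemma gmulZl c x z : (c *: x) ** z = c *: (x ** z). Proof. exact: linZ (@ga_linl _ R z) c x. Qed.
Lemma gmulZr c x z : z ** (c *: x) = c *: (z ** x). Proof. exact: linZ (@ga_linr _ R z) c x. Qed.
Lemma gmul_suml (I : Type) (r : seq I) (P : pred I) (F : I -> R) z :
  (\sum_(j <- r | P j) F j) ** z = \sum_(j <- r | P j) F j ** z.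
Proof. exact: lin_sum (@ga_linl _ R z) _ _ _ _. Qed.
Lemma gmul_sumr (I : Type) (r : seq I) (P : pred I) (F : I -> R) z :
  z ** (\sum_(j <- r | P j) F j) = \sum_(j <- r | P j) z ** F j.
Proof. exact: lin_sum (@ga_linr _ R z) _ _ _ _. Qed.

(** With the linear map [sgn] in place of (-1)^m, the graded rules become identities without
    homogeneity hypotheses, so they can be proved by linear induction on paths. *)
Definition sgn : R -> R := sign_op (ga_grading R).
Lemma sgn_lin : linear sgn. Proof. exact: sign_op_linear. Qed.
Lemma sgn_hom m x : ga_hom m x -> sgn x = (-1) ^ m *: x. Proof. exact: sign_opE. Qed.
Lemma sgnM x y : sgn (x ** y) = sgn x ** sgn y.
Proof.
move: x (grading_sum (ga_grading R) x); apply: homogeneous_sum_ind => [|u v hu hv|m u hu].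
- by rewrite (lin0 sgn_lin) !gmul0l (lin0 sgn_lin).
- by rewrite gmulDl !(linD sgn_lin) hu hv gmulDl.
move: y (grading_sum (ga_grading R) y); apply: homogeneous_sum_ind => [|x y hx hy|p y hy].
- by rewrite (lin0 sgn_lin) !gmul0r (lin0 sgn_lin).
- by rewrite gmulDr !(linD sgn_lin) hx hy gmulDr.
by rewrite (sgn_hom (ga_homM hu hy)) (sgn_hom hu) (sgn_hom hy) gmulZl gmulZr scalerA signzD.
Qed.
Lemma sgnK : involutive sgn.
Proof.
move=> x; move: x (grading_sum (ga_grading R) x).
apply: homogeneous_sum_ind => [|u v hu hv|m u hu].
- by rewrite !(lin0 sgn_lin).
- by rewrite !(linD sgn_lin) hu hv.
by rewrite (sgn_hom hu) (linZ sgn_lin) (sgn_hom hu) scalerA signzz scale1r.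
Qed.
Lemma hom_sgn m x : ga_hom m x -> ga_hom m (sgn x).
Proof. by move=> hx; rewrite (sgn_hom hx); apply: gradingZ hx; apply: ga_grading. Qed.

Lemma homD m x y : ga_hom m x -> ga_hom m y -> ga_hom m (x + y).
Proof. by move=> hx hy; rewrite -[x]scale1r; apply: (gradingP (ga_grading R)). Qed.
Lemma homZ m c x : ga_hom m x -> ga_hom m (c *: x).
Proof. exact: gradingZ (ga_grading R) _ _ _. Qed.
Lemma homN m x : ga_hom m x -> ga_hom m (- x).
Proof. by rewrite -scaleN1r; apply: homZ. Qed.
Lemma hom0 m : ga_hom m (0 : R). Proof. exact: grading0 (ga_grading R) m. Qed.
Lemma hom_sum m (I : Type) (r : seq I) (P : pred I) (F : I -> R) :
  (forall j, P j -> ga_hom m (F j)) -> ga_hom m (\sum_(j <- r | P j) F j).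
Proof. by move=> hF; apply: big_ind => //; [apply: hom0 | apply: homD]. Qed.

End AlgebraLaws.

Lemma diff_leibniz_sgn (k : fieldType) (L : dgAlgebra k) (x y : L) :
  dga_d (x ** y) = dga_d x ** y + sgn x ** dga_d y.
Proof.
have dl := diff_linear (dga_diff L).
move: x (grading_sum (ga_grading L) x); apply: homogeneous_sum_ind => [|u v hu hv|m u hu].
- by rewrite (lin0 (@sgn_lin _ L)) !gmul0l (lin0 dl) gmul0l addr0.
- by rewrite gmulDl !(linD dl) (linD (@sgn_lin _ L)) hu hv !gmulDl addrACA.
by rewrite (diff_leibniz (dga_diff L) _ hu) (sgn_hom hu) gmulZl.
Qed.

(* Freeness enters twice: pa_ind is induction on paths, adding arrows on the
   right, and pa_ext is definition by recursion along paths, with values in any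
   vector space. *)
Record path_alg (k : fieldType) (n : nat) (Q : quiver n) := PathAlg {
  pa_alg :> grAlgebra k;
  pa_e : 'I_n -> pa_alg;
  pa_x : Q -> pa_alg;
  pa_one : ga_one pa_alg = \sum_v pa_e v;
  pa_ee : forall v w, pa_e v ** pa_e w = if v == w then pa_e v else 0;
  pa_xe : forall a, pa_x a ** pa_e (src a) = pa_x a;
  pa_ex : forall a, pa_e (tgt a) ** pa_x a = pa_x a;
  pa_hom_e : forall v, ga_hom 0 (pa_e v);
  pa_hom_x : forall a, ga_hom (deg a) (pa_x a);
  pa_ind : forall P : int -> pa_alg -> Prop,
    (forall m, P m 0) ->
    (forall m c x y, P m x -> P m y -> P m (c *: x + y)) ->
    (forall v, P 0 (pa_e v)) ->
    (forall m a q, ga_hom m q -> q ** pa_e (tgt a) = q -> P m q ->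
       P (m + deg a) (q ** pa_x a)) ->
    forall x, homogeneous_sum (fun m x => ga_hom m x /\ P m x) x;
  pa_ext : forall (V : lmodType k) (f0 : 'I_n -> V) (G : Q -> pa_alg -> V -> V),
    (forall a, linear (fun p : (pa_alg * V)%type => G a p.1 p.2)) ->
    exists f : pa_alg -> V, [/\ linear f, forall v, f (pa_e v) = f0 v &
      forall a q, q ** pa_e (tgt a) = q -> f (q ** pa_x a) = G a q (f q)] }.

(** * Induction principles and trivial coefficients in path algebras *)

Section PathAlgTheory.
Variables (k : fieldType) (n : nat) (Q : quiver n) (R : path_alg k Q).
Local Notation e := (@pa_e _ _ _ R).
Local Notation x := (@pa_x _ _ _ R).

(** [pa_ind] only yields a sum of good elements of various degrees; [grading_refine] discards the
    pieces outside degree m. *)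
Lemma pa_hom_ind (P : int -> R -> Prop) :
  (forall m, P m 0) -> (forall m c x y, P m x -> P m y -> P m (c *: x + y)) ->
  (forall v, P 0 (e v)) ->
  (forall m a q, ga_hom m q -> q ** e (tgt a) = q -> P m q -> P (m + deg a) (q ** x a)) ->
  forall m u, ga_hom m u -> P m u.
Proof.
move=> P0 PP Pe Px m u /(@grading_refine _ _ _ (ga_grading R) (fun m x => ga_hom m x /\ P m x)).
case=> // [_ _ [] // | q | q c y z [hy Py] [hz Pz] |].
- by split=> //; apply: hom0.
- by split; [apply: (gradingP (ga_grading R)) | apply: PP].
exact: pa_ind.
Qed.

Lemma pa_lin_ind (P : R -> Prop) :
  P 0 -> (forall c x y, P x -> P y -> P (c *: x + y)) ->
  (forall v, P (e v)) -> (forall a q, q ** e (tgt a) = q -> P q -> P (q ** x a)) ->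
  forall u, P u.
Proof.
move=> P0 PP Pe Px u; have [] := @pa_ind _ _ _ R (fun _ => P) _ _ _ _ u => //.
  by move=> _ a q _; apply: Px.
move=> l [hl ->]; rewrite big_seq; apply: big_ind => // [y z hy hz|p /hl [] //].
by rewrite -[y]scale1r; apply: PP.
Qed.

Lemma pa_lin_eq (V : lmodType k) (f g : R -> V) : linear f -> linear g ->
  (forall v, f (e v) = g (e v)) ->
  (forall a q, q ** e (tgt a) = q -> f q = g q -> f (q ** x a) = g (q ** x a)) -> f =1 g.
Proof.
move=> fl gl h0 hx; apply: pa_lin_ind => // [|c y z hy hz].
- by rewrite (lin0 fl) (lin0 gl).
- by rewrite fl gl hy hz.
Qed.

Lemma pa_eev v : e v ** e v = e v. Proof. by rewrite pa_ee eqxx. Qed.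
Lemma pa_mul_e u : u = \sum_v u ** e v.
Proof. by rewrite -gmul_sumr -pa_one ga_mul1r. Qed.
Lemma pa_xe_if a v : x a ** e v = if src a == v then x a else 0.
Proof. by rewrite -pa_xe -ga_mulA pa_ee; case: eqP; rewrite ?pa_xe ?gmul0r. Qed.
Lemma pa_ex_if a v : e v ** x a = if v == tgt a then x a else 0.
Proof. by rewrite -pa_ex ga_mulA pa_ee; case: eqP => [->|]; rewrite ?pa_ex ?gmul0l. Qed.
Lemma sgn_e v : sgn (e v) = e v. Proof. by rewrite (sgn_hom (pa_hom_e _ v)) expr0z scale1r. Qed.
(** Recursion along paths with the zero step sends every nontrivial path to 0. *)
Lemma triv_coeff_exists : exists c : R -> {ffun 'I_n -> k^o}, [/\ linear c,
  forall v, c (e v) = [ffun w => (w == v)%:R] & forall a q, c (q ** x a) = 0].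
Proof.
have [|c [cl c0 cx]] := @pa_ext _ _ _ R {ffun 'I_n -> k^o}
  (fun v => [ffun w => (w == v)%:R]) (fun _ _ _ => 0).
  by move=> a; apply: linear_const0.
exists c; split=> // a q; rewrite -pa_ex ga_mulA; apply: cx.
by rewrite -ga_mulA pa_eev.
Qed.

Definition triv_coeff (v : 'I_n) (u : R) : k := sval (cid triv_coeff_exists) u v.
Lemma triv_coeff_lin v : linear (triv_coeff v : R -> k^o).
Proof.
rewrite /triv_coeff; case: cid => /= c [cl _ _] a y z.
by rewrite cl !ffunE.
Qed.
Lemma triv_coeff_e v w : triv_coeff v (e w) = (v == w)%:R.
Proof. by rewrite /triv_coeff; case: cid => /= c [_ -> _]; rewrite ffunE. Qed.
Lemma triv_coeff_x v q a : triv_coeff v (q ** x a) = 0.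
Proof. by rewrite /triv_coeff; case: cid => /= c [_ _ ->]; rewrite ffunE. Qed.

Lemma triv_coeff_el v w u : triv_coeff v (e w ** u) = if v == w then triv_coeff v u else 0.
Proof.
have tl := triv_coeff_lin v.
move: u; apply: (@pa_lin_eq k^o) => [||z|a q _ _].
- exact: linear_compose tl (@ga_linr _ R _).
- by apply: linear_if => //; apply: linear_const0.
- rewrite pa_ee; case: (w =P z) => [<-|wz]; first by rewrite triv_coeff_e; case: eqP.
  rewrite (lin0 tl) triv_coeff_e.
  by case: (v =P w) => // ->; case: eqP.
by rewrite ga_mulA !triv_coeff_x if_same.
Qed.

End PathAlgTheory.

(** * Arrows of the mutated quiver *)

Section MutatedArrows.
Variables (k : fieldType) (n : nat) (Q : lf_quiver n) (i : 'I_n).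
Variable B : path_alg k (mutated_quiver Q i).
Local Notation mcode := (mcode Q i).
Local Notation mutA := (mutA Q i).
Local Notation e := (@pa_e _ _ _ B).
Implicit Types (al be : mutA) (c : mcode) (q : B).

Lemma inA_val al : inA i (val al).
Proof. by have := valP al; rewrite mem_filter arrows_ofP /inA andbC. Qed.
Lemma src_val al : src (val al) = i.
Proof. by case/andP: (inA_val al) => _ /eqP. Qed.
Lemma deg_val al : deg (val al) = 0.
Proof. by case/andP: (inA_val al) => /eqP. Qed.
Lemma toAP (phi : Q) al : toA i phi = Some al -> phi = val al.
Proof. by rewrite /toA; case: (@insubP _ _ mutA phi) => // u _ <- [<-]. Qed.
Lemma toA_val al : toA i (val al) = Some al.
Proof. exact: valK. Qed.
Lemma inAP (phi : Q) : inA i phi -> exists al : mutA, phi = val al.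
Proof.
rewrite -toA_inA; case E: (toA i phi) => [al|] // _.
by exists al; apply: toAP.
Qed.

(** Invalid codes give 0. Sums may then run over all of [mutA] and over all decorations, and alpha
    itself, which is not an arrow of M, contributes nothing. *)
Definition mar c : B :=
  if insub c is Some a then pa_x B (a : mutated_quiver Q i) else 0.

Lemma mar_invalid c : ~~ mvalid c -> mar c = 0.
Proof. by move=> h; rewrite /mar insubN. Qed.
Lemma marE (a : mutated_quiver Q i) : pa_x B a = mar (val a).
Proof. by rewrite /mar valK. Qed.
Lemma mar_valid c : mvalid c -> exists2 a : mutated_quiver Q i, val a = c & mar c = pa_x B a.
Proof. by move=> h; exists (Sub c h); rewrite ?SubK // marE SubK. Qed.
Lemma mar_e c v : mar c ** e v = if msrc c == v then mar c else 0.
Proof.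
have [/mar_valid[a <- ->]|/mar_invalid->] := boolP (mvalid c).
  exact: pa_xe_if.
by rewrite gmul0l if_same.
Qed.
Lemma e_mar c v : e v ** mar c = if v == mtgt c then mar c else 0.
Proof.
have [/mar_valid[a <- ->]|/mar_invalid->] := boolP (mvalid c).
  exact: pa_ex_if.
by rewrite gmul0r if_same.
Qed.
Lemma mar_tgt c : e (mtgt c) ** mar c = mar c. Proof. by rewrite e_mar eqxx. Qed.
Lemma mar_hom c : ga_hom (mdeg c) (mar c).
Proof.
have [/mar_valid[a <- ->]|/mar_invalid->] := boolP (mvalid c); last exact: hom0.
exact: (pa_hom_x B a).
Qed.
Lemma sgn_mar c : sgn (mar c) = (-1) ^ mdeg c *: mar c.
Proof. exact: sgn_hom (mar_hom c). Qed.

Lemma left_invalid al phi : tgt phi != i -> mar (MLeft al phi) = 0.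
Proof. by move=> h; apply: mar_invalid. Qed.
Lemma old_A al : mar (MOld i (val al)) = 0.
Proof. by apply: mar_invalid; rewrite /= negbK inA_val. Qed.
Lemma right_A al be : mar (MRight (val al) be) = 0.
Proof. by apply: mar_invalid; rewrite /= inA_val. Qed.
Lemma right_invalid phi be : src phi != i -> mar (MRight phi be) = 0.
Proof. by move=> h; apply: mar_invalid; rewrite /= (negbTE h) andbF. Qed.
Lemma both_invalid al phi be : src phi != i -> mar (MBoth al phi be) = 0.
Proof. by move=> h; apply: mar_invalid; rewrite /= (negbTE h). Qed.
Lemma both_invalid_tgt al phi be : tgt phi != i -> mar (MBoth al phi be) = 0.
Proof. by move=> h; apply: mar_invalid; rewrite /= (negbTE h) andbF. Qed.

Lemma mut_lin_ind (P : B -> Prop) :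
  P 0 -> (forall b x y, P x -> P y -> P (b *: x + y)) ->
  (forall v, P (e v)) ->
  (forall c q, mvalid c -> q ** e (mtgt c) = q -> P q -> P (q ** mar c)) ->
  forall u, P u.
Proof.
move=> P0 PP Pe Pm; apply: pa_lin_ind => // a q qa Pq; rewrite marE.
by apply: Pm => //; apply: (valP a).
Qed.

Lemma mut_lin_eq (V : lmodType k) (f g : B -> V) : linear f -> linear g ->
  (forall v, f (e v) = g (e v)) ->
  (forall c q, mvalid c -> q ** e (mtgt c) = q -> f q = g q -> f (q ** mar c) = g (q ** mar c)) ->
  f =1 g.
Proof.
move=> fl gl h0 hx; apply: mut_lin_ind => // [|b y z hy hz].
- by rewrite (lin0 fl) (lin0 gl).
- by rewrite fl gl hy hz.
Qed.

Lemma mut_hom_ind (P : int -> B -> Prop) :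
  (forall m, P m 0) -> (forall m b x y, P m x -> P m y -> P m (b *: x + y)) ->
  (forall v, P 0 (e v)) ->
  (forall m c q, mvalid c -> ga_hom m q -> q ** e (mtgt c) = q -> P m q ->
     P (m + mdeg c) (q ** mar c)) ->
  forall m u, ga_hom m u -> P m u.
Proof.
move=> P0 PP Pe Px m u; move: m u.
apply: (pa_hom_ind P0 PP Pe) => m a q hq qa Pq.
rewrite marE; exact: Px (valP a) hq qa Pq.
Qed.

Lemma mut_ext (V : lmodType k) (f0 : 'I_n -> V) (G : mcode -> B -> V -> V) :
  (forall c, linear (fun p : (B * V)%type => G c p.1 p.2)) ->
  exists f : B -> V, [/\ linear f, forall v, f (e v) = f0 v &
    forall c q, mvalid c -> q ** e (mtgt c) = q -> f (q ** mar c) = G c q (f q)].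
Proof.
move=> Gl; have [f [fl fe fx]] := @pa_ext _ _ _ B V f0 (fun a => G (val a)) (fun a => Gl (val a)).
exists f; split=> // c q /mar_valid[a <- ->]; exact: fx.
Qed.

Lemma triv_coeff_mar v q c : triv_coeff v (q ** mar c) = 0.
Proof.
have [/mar_valid[a _ ->]|/mar_invalid->] := boolP (mvalid c); first exact: triv_coeff_x.
by rewrite gmul0r (lin0 (@triv_coeff_lin _ _ _ B v)).
Qed.

End MutatedArrows.

(* The bimodule Y consists of the pairs (u, v) with v_alpha in kM e_(t alpha), cut
   out later; (u, v) stands for u + sum_alpha v_alpha alpha, and e_i in the first
   component sits in degree 1. *)
Section RawBimodule.
Variables (k : fieldType) (n : nat) (Q : lf_quiver n) (i : 'I_n).
Variables (A : path_alg k Q) (B : path_alg k (mutated_quiver Q i)).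
Local Notation mutA := (mutA Q i).
Local Notation e := (@pa_e _ _ _ B).
Local Notation eA := (@pa_e _ _ _ A).
Local Notation xA := (@pa_x _ _ _ A).
Local Notation m := (mar B).

Definition rawY : lmodType k := (B * {ffun mutA -> B})%type.
Local Notation raw := rawY.
Implicit Types (y z : raw).

(** The minus sign is that of Delta: u . phi is u phi - sum_beta (u phi beta^-1) beta, so that
    iterating the action inserts Delta at each passage through i. For phi = beta in A the codes
    [MOld] and [MRight] are invalid, and the first summand of the second component records u . beta
    = u beta. *)
Definition act_arrow (phi : Q) y : raw :=
  (y.1 ** m (MOld i phi) + \sum_al y.2 al ** m (MLeft al phi),
   [ffun be => (if phi == val be then y.1 ** e (tgt (val be)) else 0)
      - (y.1 ** m (MRight phi be) + \sum_al y.2 al ** m (MBoth al phi be))]).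
(** v_alpha alpha starts in i, so only e_i preserves it. The factor e_(t alpha) changes nothing on Y
    and forces the result into Y for arbitrary pairs; hence [isY_act] needs no hypothesis on y. *)
Definition act_triv (v : 'I_n) y : raw :=
  (y.1 ** e v, [ffun al => if v == i then y.2 al ** e (tgt (val al)) else 0]).

Lemma raw_ext y z : y.1 = z.1 -> (forall al, y.2 al = z.2 al) -> y = z.
Proof. by move: y z => [a b] [c d] /= -> h; congr pair; apply/ffunP. Qed.

Lemma mulr_linear (V : lmodType k) (f : V -> B) (b : B) : linear f -> linear (fun x => f x ** b).
Proof. by move=> fl; apply: (linear_compose (@ga_linl _ B b) fl). Qed.

Lemma raw_fst_linear : linear (fun y : raw => y.1).
Proof. by []. Qed.
Lemma raw_snd_linear al : linear (fun y : raw => y.2 al).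
Proof. by move=> c x y; rewrite !ffunE. Qed.

Lemma act_arrow_linear phi : linear (act_arrow phi).
Proof.
apply: linear_pair.
  apply: linear_add; first exact/mulr_linear/raw_fst_linear.
  by apply: linear_bigsum => al; apply/mulr_linear/raw_snd_linear.
apply: linear_ffun => be; apply: linear_sub; last apply: linear_add.
- by apply: linear_if; [apply/mulr_linear/raw_fst_linear | apply: linear_const0].
- exact/mulr_linear/raw_fst_linear.
- by apply: linear_bigsum => al; apply/mulr_linear/raw_snd_linear.
Qed.

Lemma act_triv_linear v : linear (act_triv v).
Proof.
apply: linear_pair; first exact/mulr_linear/raw_fst_linear.
apply: linear_ffun => be; apply: linear_if; last exact: linear_const0.
exact/mulr_linear/raw_snd_linear.
Qed.

Lemma act_exists : exists f : raw -> A -> raw, forall y,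
  [/\ linear (f y), forall v, f y (eA v) = act_triv v y &
    forall a q, q ** eA (tgt a) = q -> f y (q ** xA a) = act_arrow a (f y q)].
Proof.
have H y : exists f : A -> raw, [/\ linear f, forall v, f (eA v) = act_triv v y &
    forall a q, q ** eA (tgt a) = q -> f (q ** xA a) = act_arrow a (f q)].
  apply: (@pa_ext _ _ _ A raw (fun v => act_triv v y) (fun a _ => act_arrow a)) => a.
  exact: (linear_compose (@act_arrow_linear a) (@linear_snd _ _ _)).
by have [f hf] := choice H; exists f.
Qed.

Definition ract y (x : A) : raw := sval (cid act_exists) y x.
Local Notation act := ract.

Lemma ract_lin y : linear (act y).
Proof. by rewrite /act; case: cid => f /= /(_ y)[]. Qed.
Local Notation act_lin := ract_lin.
Lemma act_e y v : act y (eA v) = act_triv v y.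
Proof. by rewrite /act; case: cid => f /= /(_ y)[]. Qed.
Lemma act_x_ y a q : q ** eA (tgt a) = q -> act y (q ** xA a) = act_arrow a (act y q).
Proof. by rewrite /act; case: cid => f /= /(_ y)[_ _]; apply. Qed.

Lemma act_triv_arrow v a y : act_triv v (act_arrow a y) =
  if src a == v then act_arrow a y else 0.
Proof.
have e1 : e v = e v ** e v by rewrite pa_eev.
apply: raw_ext => [|be]; rewrite /= ?ffunE.
  rewrite gmulDl gmul_suml -ga_mulA mar_e /=.
  rewrite (eq_bigr (fun al => if src a == v then y.2 al ** m (MLeft al a) else 0)); last first.
    by move=> al _; rewrite -ga_mulA mar_e /=; case: eqP; rewrite ?gmul0r.
  case: (src a == v) => //=; by rewrite gmul0r big1_eq addr0.
have [av|av] := eqVneq (src a) v; rewrite ?ffunE.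
  rewrite -av; have [ai|ai] := eqVneq (src a) i; last first.
    case: (a =P val be) => [ab|_]; first by rewrite ab src_val eqxx in ai.
    rewrite right_invalid // gmul0r big1 ?addr0 ?subr0 // => al _.
    by rewrite both_invalid // gmul0r.
  rewrite gmulBl gmulDl gmul_suml -ga_mulA mar_e /= eqxx; congr (_ - (_ + _)).
    by case: eqP => _; rewrite ?gmul0l // -ga_mulA pa_eev.
  by apply: eq_bigr => al _; rewrite -ga_mulA mar_e eqxx.
have [vi|//] := eqVneq v i.
have ai : src a != i by rewrite -vi.
case: (a =P val be) => [ab|_]; first by rewrite ab src_val eqxx in ai.
rewrite right_invalid // gmul0r big1 ?addr0 ?subr0 ?gmul0l // => al _.
by rewrite both_invalid // gmul0r.
Qed.

Lemma act_triv_triv v w y :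
  act_triv w (act_triv v y) = if v == w then act_triv v y else 0.
Proof.
apply: raw_ext => [|be]; rewrite /= ?ffunE.
  by rewrite -ga_mulA pa_ee; case: ifP => //; rewrite gmul0r.
have [<-|vw] := eqVneq v w; rewrite ?ffunE.
  by case: eqP => // _; rewrite -ga_mulA pa_eev.
have [wi|//] := eqVneq w i; case: (v =P i) => [h|_]; last by rewrite gmul0l.
by rewrite h wi eqxx in vw.
Qed.

Lemma act_mul_e y x v : act y (x ** eA v) = act_triv v (act y x).
Proof.
move: x; apply: pa_lin_eq.
- exact: linear_compose (act_lin y) (@ga_linl _ A _).
- exact: linear_compose (act_triv_linear v) (act_lin y).
- move=> w; rewrite pa_ee !act_e act_triv_triv.
  by case: eqP => _; rewrite ?act_e // (lin0 (act_lin y)).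
move=> a q qa _; rewrite -ga_mulA pa_xe_if act_x_ // act_triv_arrow.
by case: eqP => _; rewrite ?act_x_ // gmul0r (lin0 (act_lin y)).
Qed.

Lemma act_arrow_triv a y : act_arrow a (act_triv (tgt a) y) = act_arrow a y.
Proof.
have h al : ([ffun al => if tgt a == i then y.2 al ** e (tgt (val al)) else 0] : {ffun mutA -> B}) al
    = if tgt a == i then y.2 al ** e (tgt (val al)) else 0 by rewrite ffunE.
apply: raw_ext => [|be]; rewrite /= ?ffunE -!ga_mulA ?(@e_mar _ _ _ _ _ _ (tgt a)) /= ?eqxx.
  congr (_ + _); apply: eq_bigr => al _; rewrite h.
  have [ai|ai] := eqVneq (tgt a) i; last by rewrite left_invalid // !gmul0r.
  by rewrite -ga_mulA e_mar /= eqxx.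
congr (_ - (_ + _)).
  by case: eqP => // ->; rewrite pa_eev.
apply: eq_bigr => al _; rewrite h.
have [ai|ai] := eqVneq (tgt a) i; last by rewrite both_invalid_tgt // !gmul0r.
by rewrite -ga_mulA e_mar /= eqxx.
Qed.

(** The step for an arrow absorbs the trivial path at its end, which removes the condition on q in
    [act_x_]. *)
Lemma act_x y a q : act y (q ** xA a) = act_arrow a (act y q).
Proof.
rewrite -(pa_ex A a) ga_mulA act_x_; first by rewrite act_mul_e act_arrow_triv.
by rewrite -ga_mulA pa_eev.
Qed.

Lemma act_arr y a : act y (xA a) = act_arrow a y.
Proof. by rewrite -(pa_ex A a) act_x act_e act_arrow_triv. Qed.

Lemma act_linl x : linear (act^~ x).
Proof.
move=> c y z; move: x; apply: pa_lin_eq.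
- exact: act_lin.
- by apply: linear_add (act_lin z); apply: linear_scale (act_lin y).
- by move=> v; rewrite !act_e act_triv_linear.
- by move=> a q _ h; rewrite !act_x h act_arrow_linear.
Qed.

Lemma actM y x x' : act y (x ** x') = act (act y x) x'.
Proof.
move: x'; apply: pa_lin_eq.
- exact: linear_compose (act_lin y) (@ga_linr _ A _).
- exact: act_lin.
- by move=> v; rewrite act_mul_e act_e.
- by move=> a q _ h; rewrite ga_mulA !act_x h.
Qed.

Definition lmul (b : B) y : raw := (b ** y.1, [ffun al => b ** y.2 al]).

Lemma lmul_linear b : linear (lmul b).
Proof.
apply: linear_pair => [c x y|]; first exact: (ga_linr b).
by apply: linear_ffun => al c x y; rewrite !ffunE (ga_linr b).
Qed.
Lemma lmul_linearl y : linear (lmul^~ y).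
Proof.
apply: linear_pair; first exact: ga_linl.
by apply: linear_ffun => al; apply: ga_linl.
Qed.

Lemma act_lmul b y x : act (lmul b y) x = lmul b (act y x).
Proof.
move: x; apply: pa_lin_eq.
- exact: act_lin.
- exact: linear_compose (lmul_linear b) (act_lin y).
- move=> v; rewrite !act_e; apply: raw_ext => [|al]; rewrite /= ?ga_mulA //.
  by rewrite !ffunE; case: eqP => _; rewrite ?ga_mulA ?gmul0r.
move=> a q _ h; rewrite !act_x h; apply: raw_ext => [|be]; rewrite /= ?ffunE /= ?gmulDr ?gmulNr ?gmulDr.
  rewrite gmul_sumr ga_mulA; congr (_ + _); apply: eq_bigr => al _.
  by rewrite ffunE ga_mulA.
rewrite gmul_sumr ga_mulA; congr (_ - (_ + _)).
  by case: eqP => _; rewrite ?ga_mulA ?gmul0r.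
by apply: eq_bigr => al _; rewrite ffunE ga_mulA.
Qed.

Lemma lmulM b b' y : lmul (b ** b') y = lmul b (lmul b' y).
Proof. by apply: raw_ext => [|al]; rewrite /= ?ffunE ga_mulA. Qed.
Lemma lmul1 y : lmul (ga_one B) y = y.
Proof. by apply: raw_ext => [|al]; rewrite /= ?ffunE ga_mul1l. Qed.

Definition isY y : Prop := forall al, y.2 al ** e (tgt (val al)) = y.2 al.

Lemma isY0 : isY 0.
Proof. by move=> al; rewrite ffunE gmul0l. Qed.
Lemma isYP c y z : isY y -> isY z -> isY (c *: y + z).
Proof. by move=> hy hz al; rewrite !ffunE gmulDl gmulZl hy hz. Qed.
Lemma isY_sum (I : Type) (r : seq I) (P : pred I) (F : I -> raw) :
  (forall j, P j -> isY (F j)) -> isY (\sum_(j <- r | P j) F j).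
Proof.
move=> h; apply: big_ind => //; first exact: isY0.
by move=> y z hy hz; rewrite -[y]scale1r; apply: isYP.
Qed.
Lemma isY_arrow a y : isY (act_arrow a y).
Proof.
move=> be; rewrite /= !ffunE gmulBl gmulDl gmul_suml -ga_mulA mar_e /= eqxx.
congr (_ - (_ + _)); first by case: eqP => _; rewrite ?gmul0l // -ga_mulA pa_eev.
by apply: eq_bigr => al _; rewrite -ga_mulA mar_e /= eqxx.
Qed.
Lemma isY_triv v y : isY (act_triv v y).
Proof. by move=> be; rewrite /= !ffunE; case: eqP => _; rewrite ?gmul0l // -ga_mulA pa_eev. Qed.
Lemma isY_act y x : isY (act y x).
Proof.
move: x; apply: pa_lin_ind => [|c u v hu hv|v|a q _ _].
- by rewrite (lin0 (act_lin y)); apply: isY0.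
- by rewrite act_lin; apply: isYP.
- by rewrite act_e; apply: isY_triv.
- by rewrite act_x; apply: isY_arrow.
Qed.
Lemma isY_lmul b y : isY y -> isY (lmul b y).
Proof. by move=> h al; rewrite /= ffunE -ga_mulA h. Qed.

Lemma act1 y : isY y -> act y (ga_one A) = y.
Proof.
move=> hy; rewrite pa_one (lin_sum (act_lin y)) (eq_bigr (fun v => act_triv v y)); last first.
  by move=> v _; rewrite act_e.
apply: raw_ext => [|al].
  by rewrite (lin_sum raw_fst_linear) /= -pa_mul_e.
rewrite (lin_sum (raw_snd_linear al)) (bigD1 i) //= ffunE eqxx hy big1 ?addr0 // => v vi.
by rewrite ffunE (negbTE vi).
Qed.

(** The degree of u e_i is raised by one so that the map from T that sends the generator of the
    shifted P_i to e_i has degree 0. *)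
Definition homY (p : int) y : Prop :=
  (forall v, ga_hom (p - chi i v) (y.1 ** e v)) /\ forall al, ga_hom p (y.2 al).

Lemma homY0 p : homY p 0.
Proof. by split=> [v|al] /=; rewrite ?gmul0l ?ffunE; apply: hom0. Qed.
Lemma homYP p c y z : homY p y -> homY p z -> homY p (c *: y + z).
Proof.
move=> [h1 h2] [h3 h4]; split=> [v|al] /=; rewrite ?ffunE ?gmulDl ?gmulZl.
  by apply: homD => //; apply: homZ.
by apply: homD => //; apply: homZ; rewrite ?ffunE.
Qed.
Lemma homY_triv p v y : homY p y -> homY p (act_triv v y).
Proof.
move=> [h1 h2]; split=> [w|al] /=; rewrite ?ffunE.
  by rewrite -ga_mulA pa_ee; case: eqP => [<-|_]; rewrite ?gmul0r //; apply: hom0.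
case: eqP => _; last exact: hom0.
by rewrite -[p]addr0; apply: ga_homM => //; apply: pa_hom_e.
Qed.

End RawBimodule.

(** * Grading and sign involution of the bimodule *)

Section BimoduleGrading.
Variables (k : fieldType) (n : nat) (Q : lf_quiver n) (i : 'I_n).
Variables (A : path_alg k Q) (B : path_alg k (mutated_quiver Q i)).
Hypothesis noloop : forall al : mutA Q i, tgt (val al) != i.
Local Notation mutA := (mutA Q i).
Local Notation e := (@pa_e _ _ _ B).
Local Notation raw := (rawY B).
Local Notation act := (@ract _ _ _ _ A B).
Local Notation act_lin := (@ract_lin _ _ _ _ A B).
Implicit Types (y z : raw).

Lemma chi_i : chi i i = 1. Proof. by rewrite /chi eqxx. Qed.
Lemma chi_ni v : v != i -> chi i v = 0. Proof. by rewrite /chi => /negbTE->. Qed.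

(** The terms [chi] in [mdeg_old] are exactly the discrepancy between degrees in kM and in Y at the
    two ends of a. For a = beta in A the new coefficient u e_(t beta) carries no shift, because beta
    does not end in i. *)
Lemma homY_arrow p a y : homY p y -> homY (p + deg a) (act_arrow a y).
Proof.
move=> [h1 h2]; split=> [w|be] /=; rewrite ?ffunE.
  rewrite gmulDl gmul_suml; apply: homD; last apply: hom_sum => al _.
    rewrite -ga_mulA mar_e /=; case: eqP => [<-|_]; last by rewrite gmul0r; apply: hom0.
    rewrite -mar_tgt ga_mulA.
    have := ga_homM (h1 (tgt a)) (mar_hom B (MOld i a)).
    by rewrite /= /mdeg_old (_ : _ + _ = p + deg a - chi i (src a)) //; ring.
  rewrite -ga_mulA mar_e /=; case: eqP => [<-|_]; last by rewrite gmul0r; apply: hom0.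
  have [ai|ai] := eqVneq (tgt a) i; last by rewrite left_invalid // gmul0r; apply: hom0.
  have := ga_homM (h2 al) (mar_hom B (MLeft al a)).
  by rewrite /= /mdeg_old ai chi_i (_ : _ + _ = p + deg a - chi i (src a)) //; ring.
apply: homD; last apply: homN.
  case: eqP => [->|_]; last exact: hom0.
  by rewrite deg_val addr0; have := h1 (tgt (val be)); rewrite (chi_ni (noloop be)) subr0.
have [ai|ai] := eqVneq (src a) i; last first.
  rewrite right_invalid // gmul0r add0r; apply: hom_sum => al _.
  by rewrite both_invalid // gmul0r; apply: hom0.
apply: homD; last apply: hom_sum => al _.
  rewrite -mar_tgt ga_mulA.
  have := ga_homM (h1 (tgt a)) (mar_hom B (MRight a be)).
  by rewrite /= /mdeg_old ai chi_i (_ : _ + _ = p + deg a) //; ring.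
have [ti|ti] := eqVneq (tgt a) i; last by rewrite both_invalid_tgt // gmul0r; apply: hom0.
have := ga_homM (h2 al) (mar_hom B (MBoth al a be)).
by rewrite /= /mdeg_old ti ai chi_i (_ : _ + _ = p + deg a) //; ring.
Qed.

Lemma homY_act p q y (x : A) : homY p y -> ga_hom q x -> homY (p + q) (act y x).
Proof.
move=> hy; move: q x; apply: pa_hom_ind => [q|q c x z hx hz|v|q a x hx _ h].
- by rewrite (lin0 (act_lin y)); apply: homY0.
- by rewrite act_lin; apply: homYP.
- by rewrite act_e addr0; apply: homY_triv.
- by rewrite act_x addrA; apply: homY_arrow.
Qed.

Lemma homY_lmul p q y (b : B) : ga_hom q b -> homY p y -> homY (q + p) (lmul b y).
Proof.
move=> hb [h1 h2]; split=> [v|al] /=; last by rewrite ffunE; apply: ga_homM.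
by rewrite -ga_mulA -addrA; apply: ga_homM.
Qed.

Definition Ycar : lmodType k := subspace (conj (isY0 B) (@isYP _ _ _ _ B)).

Lemma homogeneous_sum_big (V : lmodType k) (H : int -> V -> Prop)
    (I : Type) (r : seq I) (P : pred I) (F : I -> V) :
  (forall j, P j -> homogeneous_sum H (F j)) -> homogeneous_sum H (\sum_(j <- r | P j) F j).
Proof.
move=> h; apply: big_ind => //; first exact: homogeneous_sum0.
exact: homogeneous_sumD.
Qed.

Lemma Y_homogeneous_sum y : isY y -> homogeneous_sum (fun p y => homY p y /\ isY y) y.
Proof.
move=> hy; pose g v (b : B) : raw := (b ** e v, 0).
pose g' al (b : B) : raw := (0, [ffun be => if be == al then b ** e (tgt (val al)) else 0]).
have gl v : linear (g v) by move=> c x z; rewrite /g (ga_linl (e v)); apply: raw_ext => //= al; rewrite !ffunE scaler0 addr0.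
have gl' al : linear (g' al).
  move=> c x z; apply: raw_ext => [|be]; rewrite /= ?scaler0 ?addr0 // !ffunE.
  by case: eqP => _; rewrite ?(ga_linl (e _)) // scaler0 addr0.
have -> : y = \sum_v g v y.1 + \sum_al g' al (y.2 al).
  apply: raw_ext => [|be] /=.
    rewrite !(lin_sum (@raw_fst_linear _ _ _ _ B)) /= -pa_mul_e big1 ?addr0 //.
  rewrite ffunE !(lin_sum (raw_snd_linear be)) big1 ?add0r => [|v _]; last by rewrite ffunE.
  rewrite (bigD1 be) //= ffunE eqxx hy big1 ?addr0 // => al.
  by rewrite ffunE eq_sym => /negbTE->.
apply: homogeneous_sumD.
  apply: homogeneous_sum_big => v _.
  move: y.1 (grading_sum (ga_grading B) y.1); apply: homogeneous_sum_ind => [|b c hb hc|p b hb].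
  - by rewrite (lin0 (gl v)); apply: homogeneous_sum0.
  - by rewrite (linD (gl v)); apply: homogeneous_sumD.
  apply: (@homogeneous_sum1 _ _ _ (p + chi i v)); split; last by move=> al; rewrite ffunE gmul0l.
  split=> [w|al] /=; last by rewrite ffunE; apply: hom0.
  rewrite -ga_mulA pa_ee; case: eqP => [<-|_]; last by rewrite gmul0r; apply: hom0.
  by rewrite addrK -[p]addr0; apply: ga_homM => //; apply: pa_hom_e.
apply: homogeneous_sum_big => al _.
move: (y.2 al) (grading_sum (ga_grading B) (y.2 al)).
apply: homogeneous_sum_ind => [|b c hb hc|p b hb].
- by rewrite (lin0 (gl' al)); apply: homogeneous_sum0.
- by rewrite (linD (gl' al)); apply: homogeneous_sumD.
apply: (@homogeneous_sum1 _ _ _ p); split.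
  split=> [w|be] /=; first by rewrite gmul0l; apply: hom0.
  rewrite ffunE; case: eqP => _; last exact: hom0.
  by rewrite -[p]addr0; apply: ga_homM => //; apply: pa_hom_e.
by move=> be; rewrite /= !ffunE; case: eqP => [->|_]; rewrite ?gmul0l // -ga_mulA pa_eev.
Qed.

Lemma Y_grading : is_grading (fun p (y : Ycar) => homY p (val y)).
Proof.
split=> [p|p c y z hy hz|y|s f us hf sf p ps].
- exact: homY0.
- exact: homYP.
- have [l [hl yE]] := Y_homogeneous_sum (subspaceP y).
  exists [seq (p.1, insubd (0 : Ycar) p.2) | p <- l]; split.
    move=> _ /mapP[p /hl [h1 h2] ->] /=; rewrite val_insubd.
    by rewrite (asboolT h2).
  apply: val_inj; rewrite yE big_map raddf_sum big_seq [RHS]big_seq.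
  apply: eq_bigr => p /hl [_ h2] /=.
  by rewrite val_insubd (asboolT h2).
have sf' : \sum_(q <- s) val (f q) = 0 by rewrite -raddf_sum sf.
apply: val_inj; apply: raw_ext => [|al].
  rewrite [LHS]pa_mul_e [RHS]pa_mul_e; apply: eq_bigr => v _ /=; rewrite gmul0l.
  apply: (@grading_direct _ _ _ (grading_shift (chi i v) (ga_grading B)) s
    (fun q => (val (f q)).1 ** e v) us) => // [q|]; first by case: (hf q).
  rewrite -gmul_suml -(lin_sum (@raw_fst_linear _ _ _ _ B)).
  by rewrite sf' /= gmul0l.
rewrite [RHS]ffunE; apply: (@grading_direct _ _ _ (ga_grading B) s
  (fun q => (val (f q)).2 al) us) => // [q|]; first by case: (hf q).
by rewrite -(lin_sum (raw_snd_linear al)) sf' ffunE.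
Qed.

(** This is 1 - 2 e_i. It accounts for the extra degree of e_i, so that [tau] is multiplication by
    (-1)^p in degree p of Y. *)
Definition kap : B := \sum_v (-1) ^ chi i v *: e v.
Definition tau y : raw := (sgn y.1 ** kap, [ffun al => sgn (y.2 al)]).

Lemma e_kap v : e v ** kap = (-1) ^ chi i v *: e v.
Proof.
rewrite gmul_sumr (bigD1 v) //= big1 ?addr0 ?gmulZr ?pa_eev // => w wv.
by rewrite gmulZr pa_ee eq_sym (negbTE wv) scaler0.
Qed.
Lemma kap_e v : kap ** e v = (-1) ^ chi i v *: e v.
Proof.
rewrite gmul_suml (bigD1 v) //= big1 ?addr0 ?gmulZl ?pa_eev // => w wv.
by rewrite gmulZl pa_ee (negbTE wv) scaler0.
Qed.
Lemma tau_linear : linear tau.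
Proof.
apply: linear_pair.
  exact/mulr_linear/(linear_compose (@sgn_lin _ B))/raw_fst_linear.
by apply: linear_ffun => al; apply: (linear_compose (@sgn_lin _ B) (raw_snd_linear al)).
Qed.
Lemma tau_hom p y : homY p y -> tau y = (-1) ^ p *: y.
Proof.
move=> [h1 h2]; apply: raw_ext => [|al] /=; last by rewrite !ffunE (sgn_hom (h2 al)).
rewrite [LHS]pa_mul_e [y.1 in RHS]pa_mul_e scaler_sumr; apply: eq_bigr => v _.
rewrite -ga_mulA kap_e gmulZr -(sgn_e B v) -sgnM (sgn_hom (h1 v)) scalerA -signzD.
by rewrite [chi i v + _]addrC subrK sgn_e.
Qed.
Lemma tau_act y (x : A) : isY y -> tau (act y x) = act (tau y) (sgn x).
Proof.
move=> /Y_homogeneous_sum; move: y; apply: homogeneous_sum_ind => [|y z hy hz|p y [hy _]].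
- by rewrite (lin0 tau_linear) !(lin0 (act_linl _)) (lin0 tau_linear).
- by rewrite (linD (act_linl _)) !(linD tau_linear) hy hz (linD (act_linl _)).
move: x (grading_sum (ga_grading A) x); apply: homogeneous_sum_ind => [|x z hx hz|q x hx].
- by rewrite (lin0 (@sgn_lin _ A)) !(lin0 (act_lin _)) (lin0 tau_linear).
- by rewrite (linD (act_lin _)) (linD tau_linear) (linD (@sgn_lin _ A)) hx hz (linD (act_lin _)).
rewrite (tau_hom (homY_act hy hx)) (tau_hom hy) (sgn_hom hx).
by rewrite (linZ (act_linl _)) (linZ (act_lin _)) scalerA signzD.
Qed.
Lemma tau_lmul b y : tau (lmul b y) = lmul (sgn b) (tau y).
Proof. by apply: raw_ext => [|al]; rewrite /= ?ffunE sgnM ?ga_mulA ?ffunE. Qed.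

End BimoduleGrading.

(** * The differential on arrows, over abstract path algebras *)

Section DividedArrows.
Variables (k : fieldType) (n : nat) (Q : lf_quiver n) (i : 'I_n).
Variable B : path_alg k (mutated_quiver Q i).

Definition rdiv_arrow (c : mcode Q i) (al : mutA Q i) : B :=
  match c with
  | MOld phi => mar B (MRight phi al)
  | MLeft be phi => mar B (MBoth be phi al)
  | _ => 0
  end.

Definition lmul_arrow (al : mutA Q i) (c : mcode Q i) : B :=
  match c with
  | MOld phi => mar B (MLeft al phi)
  | MRight phi be => mar B (MBoth al phi be)
  | _ => 0
  end.
End DividedArrows.

Section ArrowDifferential.
Variables (k : fieldType) (n : nat) (Q : lf_quiver n) (i : 'I_n).
Variables (A : path_alg k Q) (B : path_alg k (mutated_quiver Q i)).
Variables (d : A -> A) (quo : A -> mutA Q i -> A) (lm : mutA Q i -> B -> B)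
  (rd : B -> mutA Q i -> B).
Local Notation m := (mar B).
Local Notation xA := (@pa_x _ _ _ A).

(* Acting on 1 = (1, 0) and dropping the summands v_alpha alpha gives dec (red x). *)
Definition dec_act (x : A) : B := (ract (ga_one B, 0) x).1.

(** One formula for both cases: if phi does not end in i, all [MLeft al phi] are invalid and the
    sign is 1. No reduction occurs, since paths starting in A contribute nothing to the kM-part of
    the action on 1. *)
Definition diff_old (phi : Q) : B :=
  \sum_(al : mutA Q i) m (MStar al) ** m (MLeft al phi)
  + (-1) ^ chi i (tgt phi) *: dec_act (d (xA phi)).
Definition diff_left (al : mutA Q i) (phi : Q) : B :=
  dec_act (xA (val al) ** d (xA phi)).
Definition diff_arrow (c : mcode Q i) : B :=
  match c with
  | MOld phi => diff_old phi
  | MStar _ => 0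
  | MLeft al phi => diff_left al phi
  | MRight phi al =>
      rd (diff_old phi) al
      + (-1) ^ mdeg (MOld i phi) *: (m (MOld i phi) ** m (MStar al))
      - (-1) ^ chi i (tgt phi) *: dec_act (quo (d (xA phi)) al)
  | MBoth al phi be =>
      rd (diff_left al phi) be
      + (-1) ^ mdeg (MLeft al phi) *: (m (MLeft al phi) ** m (MStar be))
      - lm al (dec_act (quo (d (xA phi)) be))
  end.
End ArrowDifferential.

(* mt_quo is p / alpha, mt_lm is alpha q, mt_rd is q alpha^-1 and mt_dM is the
   differential of kM, each given by its recursion equations along paths. *)
Record mut_data (k : fieldType) (n : nat) (Q : lf_quiver n) (i : 'I_n) := MutData {
  mt_A : path_alg k Q;
  mt_B : path_alg k (mutated_quiver Q i);
  mt_d : mt_A -> mt_A;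
  mt_diff : is_differential mt_d;
  mt_d_e : forall v, mt_d (pa_e mt_A v) = 0;
  mt_d_A : forall al : mutA Q i, mt_d (pa_x mt_A (val al)) = 0;
  mt_noloop : forall al : mutA Q i, tgt (val al) != i;
  mt_notriv : forall (al : mutA Q i) (phi : Q), src phi = i -> tgt phi = i ->
    triv_coeff i (mt_d (pa_x mt_A phi)) = 0;
  mt_quo : mt_A -> mutA Q i -> mt_A;
  mt_quo_lin : forall al, linear (mt_quo^~ al);
  mt_quo_e : forall v al, mt_quo (pa_e mt_A v) al = 0;
  mt_quo_x : forall a q al, q ** pa_e mt_A (tgt a) = q ->
    mt_quo (q ** pa_x mt_A a) al = if a == val al then q else 0;
  mt_lm : mutA Q i -> mt_B -> mt_B;
  mt_lm_lin : forall al, linear (mt_lm al);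
  mt_lm_e : forall v al, mt_lm al (pa_e mt_B v) = 0;
  mt_lm_x : forall al c q, mvalid c -> q ** pa_e mt_B (mtgt c) = q ->
    mt_lm al (q ** mar mt_B c) = mt_lm al q ** mar mt_B c + triv_coeff i q *: lmul_arrow mt_B al c;
  mt_rd : mt_B -> mutA Q i -> mt_B;
  mt_rd_lin : forall al, linear (mt_rd^~ al);
  mt_rd_e : forall v al, mt_rd (pa_e mt_B v) al = 0;
  mt_rd_x : forall al c q, mvalid c -> q ** pa_e mt_B (mtgt c) = q ->
    mt_rd (q ** mar mt_B c) al = q ** rdiv_arrow mt_B c al;
  mt_dM : mt_B -> mt_B;
  mt_dM_lin : linear mt_dM;
  mt_dM_e : forall v, mt_dM (pa_e mt_B v) = 0;
  mt_dM_x : forall c, mvalid c ->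
    mt_dM (mar mt_B c) = diff_arrow mt_d mt_quo mt_lm mt_rd c;
  mt_dM_xx : forall b c q, mvalid b -> mvalid c -> msrc b = mtgt c ->
    q ** pa_e mt_B (mtgt b) = q ->
    mt_dM (q ** mar mt_B b ** mar mt_B c)
    = mt_dM (q ** mar mt_B b) ** mar mt_B c
      + sgn (q ** mar mt_B b) ** diff_arrow mt_d mt_quo mt_lm mt_rd c }.

(** * The components of 1 . x *)

Section MutatedDifferential.
Variables (k : fieldType) (n : nat) (Q : lf_quiver n) (i : 'I_n) (S : mut_data k Q i).
Local Notation mutA := (mutA Q i).
Local Notation A := (mt_A S).
Local Notation B := (mt_B S).
Local Notation d := (@mt_d _ _ _ _ S).
Local Notation quo := (@mt_quo _ _ _ _ S).
Local Notation rd := (@mt_rd _ _ _ _ S).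
Local Notation e := (@pa_e _ _ _ B).
Local Notation eA := (@pa_e _ _ _ A).
Local Notation xA := (@pa_x _ _ _ A).
Local Notation m := (mar B).
Local Notation raw := (rawY B).
Local Notation act := (@ract _ _ _ _ A B).
Local Notation act_lin := (@ract_lin _ _ _ _ A B).
Local Notation dec := (@dec_act _ _ _ _ A B).
Implicit Types (y z : raw) (al be : mutA).

Definition mt_dga : dgAlgebra k := DgAlgebra (mt_diff S).

Definition one_Y : raw := (ga_one B, 0).
Definition gen_Y al : raw := (0, [ffun be => if be == al then e (tgt (val al)) else 0]).
Local Notation y1 := one_Y.
Local Notation yA := gen_Y.

Lemma mt_d_lin : linear d. Proof. exact: diff_linear (mt_diff S). Qed.
Lemma d_leib (x z : A) : d (x ** z) = d x ** z + sgn x ** d z.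
Proof. exact: (@diff_leibniz_sgn _ mt_dga). Qed.
Lemma d_sq x : d (d x) = 0. Proof. exact: diff_sq (mt_diff S) x. Qed.
Lemma d_x_tgt a : eA (tgt a) ** d (xA a) = d (xA a).
Proof. by rewrite -[in RHS](pa_ex A a) d_leib mt_d_e gmul0l add0r sgn_e. Qed.
Lemma d_x_src a : d (xA a) ** eA (src a) = d (xA a).
Proof. by rewrite -[in RHS](pa_xe A a) d_leib mt_d_e gmul0r addr0. Qed.
Lemma d_hom p x : ga_hom p x -> ga_hom (p - 1) (d x).
Proof. exact: (diff_hom (mt_diff S)). Qed.

Lemma quo_xx a q al : quo (q ** xA a) al = if a == val al then q ** eA (tgt a) else 0.
Proof.
by rewrite -(pa_ex A a) ga_mulA mt_quo_x // -ga_mulA pa_eev.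
Qed.

Lemma rdc_tgt c al : e (mtgt c) ** rdiv_arrow B c al = rdiv_arrow B c al.
Proof. by case: c => [phi|be|be phi|phi be|be phi ga]; rewrite /rdiv_arrow ?gmul0r // e_mar eqxx. Qed.
Lemma rdc_src c al : rdiv_arrow B c al ** e (tgt (val al)) = rdiv_arrow B c al.
Proof. by case: c => [phi|be|be phi|phi be|be phi ga]; rewrite /rdiv_arrow ?gmul0l // mar_e eqxx. Qed.
Lemma rdc_invalid c al : ~~ mvalid c -> rdiv_arrow B c al = 0.
Proof.
case: c => [phi|be|be phi|phi be|be phi ga] //= h.
  by apply: mar_invalid; rewrite /= (negbTE h).
exact: both_invalid_tgt.
Qed.
Lemma rd_xx al c q : rd (q ** m c) al = q ** rdiv_arrow B c al.
Proof.
have [cv|cv] := boolP (mvalid c); last first.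
  by rewrite rdc_invalid // mar_invalid // !gmul0r (lin0 (@mt_rd_lin _ _ _ _ S al)).
rewrite -mar_tgt ga_mulA mt_rd_x //; last by rewrite -ga_mulA pa_eev.
by rewrite -ga_mulA rdc_tgt.
Qed.
Lemma rd_mulr (u : B) al : rd u al ** e (tgt (val al)) = rd u al.
Proof.
move: u; apply: mut_lin_eq => [|||c u _ _ _].
- exact/mulr_linear/mt_rd_lin.
- exact: mt_rd_lin.
- by move=> v; rewrite mt_rd_e gmul0l.
- by rewrite !rd_xx -ga_mulA rdc_src.
Qed.
Lemma act_y1_A al : act y1 (xA (val al)) = yA al.
Proof.
rewrite act_arr; apply: raw_ext => [|be] /=.
  by rewrite old_A gmul0r add0r big1 // => be _; rewrite ffunE gmul0l.
rewrite !ffunE ga_mul1l right_A gmul0r add0r big1 ?subr0 => [|ga _]; last by rewrite ffunE gmul0l.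
by rewrite (inj_eq val_inj) eq_sym; case: eqP => // ->.
Qed.

(** Appending an arrow a to q feeds the beta-component from two sources: minus each arrow of M just
    appended, with beta^-1 put on its right, and, when a = beta, the decoration of q. These are the
    terms of the differential of phi beta^-1 other than the one with beta^*. *)
Lemma snd_act_y1 x be : (act y1 x).2 be = dec (quo x be) - rd (dec x) be.
Proof.
move: x; apply: pa_lin_eq.
- exact: (linear_compose (raw_snd_linear be) (act_lin y1)).
- apply: linear_sub.
    apply: (linear_compose _ (@mt_quo_lin _ _ _ _ S be)).
    exact: (linear_compose (@raw_fst_linear _ _ _ _ _) (act_lin y1)).
  apply: (linear_compose (@mt_rd_lin _ _ _ _ S be)).
  exact: (linear_compose (@raw_fst_linear _ _ _ _ _) (act_lin y1)).
- move=> v; rewrite act_e /dec_act mt_quo_e (lin0 (act_lin _)) act_e /= ffunE ga_mul1l mt_rd_e subrr.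
  by case: eqP; rewrite // ffunE gmul0l.
move=> a q qa _; rewrite /dec_act act_x -/(y1) mt_quo_x // /= ffunE.
rewrite (linD (@mt_rd_lin _ _ _ _ S be)) (lin_sum (@mt_rd_lin _ _ _ _ S be)) rd_xx.
rewrite (eq_bigr _ (fun al _ => rd_xx be (MLeft al a) _)) /=; congr (_ - _).
case: (a =P val be) => [ab|_]; last by rewrite (lin0 (act_lin _)).
by rewrite -ab -[in RHS]qa act_mul_e.
Qed.

End MutatedDifferential.

(** * Attaching alpha on the left, expressed through the right action *)

Section Leibniz.
Variables (k : fieldType) (n : nat) (Q : lf_quiver n) (i : 'I_n) (S : mut_data k Q i).
Local Notation mutA := (mutA Q i).
Local Notation A := (mt_A S).
Local Notation B := (mt_B S).
Local Notation lm := (@mt_lm _ _ _ _ S).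
Local Notation e := (@pa_e _ _ _ B).
Local Notation eA := (@pa_e _ _ _ A).
Local Notation xA := (@pa_x _ _ _ A).
Local Notation m := (mar B).
Local Notation raw := (rawY B).
Local Notation act := (@ract _ _ _ _ A B).
Local Notation dec := (@dec_act _ _ _ _ A B).
Implicit Types (y z : raw) (al be : mutA).

Local Notation y1 := (one_Y S).
Local Notation yA := (@gen_Y _ _ _ _ S).
Local Notation act_lin := (@ract_lin _ _ _ _ A B).

Lemma act_yA al x : act (yA al) x = act y1 (xA (val al) ** x).
Proof. by rewrite actM act_y1_A. Qed.

Lemma triv_coeff_er v w (q : B) : triv_coeff v (q ** e w) = if v == w then triv_coeff v q else 0.
Proof.
have l : linear (fun q : B => if v == w then triv_coeff v q : k^o else 0).
  by apply: linear_if; [apply: triv_coeff_lin | apply: linear_const0].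
move: q; apply: (@mut_lin_eq _ _ _ _ B k^o) => [||u|c q _ _ _] //.
- exact: linear_compose (@triv_coeff_lin _ _ _ B v) (@ga_linl _ B _).
- rewrite pa_ee; case: (u =P w) => [->|uw]; first by rewrite triv_coeff_e; case: eqP.
  rewrite (lin0 (@triv_coeff_lin _ _ _ B v)) triv_coeff_e.
  by case: (v =P w) => // vw; case: (v =P u) => // vu; case: uw; rewrite -vu vw.
rewrite triv_coeff_mar if_same -ga_mulA mar_e.
by case: eqP => _; rewrite ?triv_coeff_mar // gmul0r (lin0 (@triv_coeff_lin _ _ _ B v)).
Qed.

Lemma lmc_src al c v : lmul_arrow B al c ** e v = if msrc c == v then lmul_arrow B al c else 0.
Proof. by case: c => [phi|be|be phi|phi be|be phi ga]; rewrite /lmul_arrow ?gmul0l ?if_same // mar_e. Qed.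
Lemma lmc_tgt al c : e (tgt (val al)) ** lmul_arrow B al c = lmul_arrow B al c.
Proof. by case: c => [phi|be|be phi|phi be|be phi ga]; rewrite /lmul_arrow ?gmul0r // e_mar eqxx. Qed.
Lemma lmc_notgt al c : mtgt c != i -> lmul_arrow B al c = 0.
Proof.
case: c => [phi|be|be phi|phi be|be phi ga] //= h; first exact: left_invalid.
exact: both_invalid_tgt.
Qed.
Lemma lmc_invalid al c : ~~ mvalid c -> lmul_arrow B al c = 0.
Proof.
case: c => [phi|be|be phi|phi be|be phi ga] //=.
- rewrite negbK => /inAP[ga ->]; apply: left_invalid; exact: (mt_noloop S).
- rewrite negb_and negbK => /orP[/inAP[ga ->]|h]; last exact: both_invalid.
  by apply: both_invalid_tgt; apply: (mt_noloop S).
Qed.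
Lemma lm_mulr al (q : B) v : lm al (q ** e v) = lm al q ** e v.
Proof.
have ll := @mt_lm_lin _ _ _ _ S al.
move: q; apply: mut_lin_eq => [||u|c q cv qc _].
- exact: linear_compose ll (@ga_linl _ B _).
- exact: mulr_linear ll.
- by rewrite pa_ee; case: eqP; rewrite ?mt_lm_e ?(lin0 ll) ?gmul0l.
rewrite -ga_mulA mar_e mt_lm_x // gmulDl gmulZl lmc_src -ga_mulA mar_e.
by case: eqP => _; rewrite ?mt_lm_x // !gmul0r (lin0 ll) scaler0 addr0.
Qed.
Lemma lm_mull al (q : B) : e (tgt (val al)) ** lm al q = lm al q.
Proof.
have ll := @mt_lm_lin _ _ _ _ S al.
move: q; apply: mut_lin_eq => [||u|c q cv qc h] //.
- exact: linear_compose (@ga_linr _ B _) ll.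
- by rewrite mt_lm_e gmul0r.
by rewrite mt_lm_x // gmulDr gmulZr lmc_tgt ga_mulA h.
Qed.
(** alpha is attached to the leftmost arrow, which is c itself only on the part of q that is trivial
    at i. If c does not end in i then [lmul_arrow] vanishes, so no condition on q remains. *)
Lemma lm_xx al c (q : B) : lm al (q ** m c) = lm al q ** m c + triv_coeff i q *: lmul_arrow B al c.
Proof.
have ll := @mt_lm_lin _ _ _ _ S al.
have [cv|cv] := boolP (mvalid c); last first.
  by rewrite lmc_invalid // mar_invalid // !gmul0r (lin0 ll) scaler0 addr0.
rewrite -[in LHS]mar_tgt ga_mulA mt_lm_x //; last by rewrite -ga_mulA pa_eev.
rewrite lm_mulr -ga_mulA mar_tgt triv_coeff_er eq_sym.
by have [//|h] := eqVneq (mtgt c) i; rewrite lmc_notgt // !scaler0.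
Qed.

Lemma dec_act_linear : linear dec.
Proof. exact: (linear_compose (@raw_fst_linear _ _ _ _ _) (act_lin y1)). Qed.
Local Notation dec_lin := dec_act_linear.
Lemma act_triv_y1 v : act_triv v y1 = lmul (e v) y1.
Proof.
apply: raw_ext => [|al] /=; first by rewrite ga_mul1l ga_mul1r.
by rewrite !ffunE gmul0r gmul0l if_same.
Qed.
Lemma act_y1_el v x : act y1 (eA v ** x) = lmul (e v) (act y1 x).
Proof. by rewrite actM act_e act_triv_y1 act_lmul. Qed.
Lemma dec_el v x : dec (eA v ** x) = e v ** dec x.
Proof. by rewrite /dec_act -/y1 act_y1_el. Qed.
Lemma dec_er v x : dec (x ** eA v) = dec x ** e v.
Proof. by rewrite /dec_act -/y1 act_mul_e. Qed.
Lemma dec_e v : dec (eA v) = e v.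
Proof. by rewrite /dec_act -/y1 act_e /= ga_mul1l. Qed.
Lemma dec_x q a : dec (q ** xA a) = dec q ** m (MOld i a)
  + \sum_al (act y1 q).2 al ** m (MLeft al a).
Proof. by rewrite /dec_act act_x. Qed.

Lemma triv_coeff_dec v x : triv_coeff v (dec x) = triv_coeff v x.
Proof.
have tl := @triv_coeff_lin _ _ _ B v.
move: x; apply: (@pa_lin_eq _ _ _ A k^o) => [||w|a q _ _].
- exact: linear_compose tl dec_lin.
- exact: triv_coeff_lin.
- by rewrite dec_e !triv_coeff_e.
rewrite dec_x triv_coeff_x (linD tl) (lin_sum tl) triv_coeff_mar add0r big1 // => al _.
by rewrite triv_coeff_mar.
Qed.

Lemma lm_dec_pair al x :
  lm al (e i ** dec x) = (act (yA al) x).1 /\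
  forall be, lm al (e i ** (act y1 x).2 be)
    = (act (yA al) x).2 be - triv_coeff i x *: (if al == be then e (tgt (val al)) else 0).
Proof.
have ll := @mt_lm_lin _ _ _ _ S al.
have tl := @triv_coeff_lin _ _ _ A i.
move: x; apply: pa_lin_ind => [|c x z [hx hx'] [hz hz']|v|a q _ [h h']].
- rewrite (lin0 dec_lin) !(lin0 (act_lin _)) !(gmul0r, lin0 ll); split=> // be.
  by rewrite !ffunE gmul0r (lin0 ll) (lin0 tl) scale0r subr0.
- rewrite dec_lin !act_lin; split=> [|be].
    by rewrite (linD (@ga_linr _ B _)) gmulZr ll hx hz.
  rewrite raw_snd_linear gmulDr gmulZr ll hx' hz' [in RHS]raw_snd_linear tl scalerBr.
  by rewrite [in RHS]scalerDl opprD -[in RHS]scalerA addrACA.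
- rewrite dec_e pa_ee !act_e /= triv_coeff_e; split=> [|be].
    by rewrite gmul0l; case: eqP => _; rewrite ?mt_lm_e ?(lin0 ll).
  rewrite !ffunE gmul0l if_same gmul0r (lin0 ll) [i == v]eq_sym.
  case: (v =P i) => _; last by rewrite scale0r subr0.
  rewrite scale1r [be == al]eq_sym; case: (al =P be) => [->|_]; last by rewrite gmul0l subrr.
  by rewrite pa_eev subrr.
rewrite dec_x !act_x triv_coeff_x; split=> [|be].
  rewrite gmulDr gmul_sumr (linD ll) (lin_sum ll) ga_mulA lm_xx h /=.
  rewrite -addrA; congr (_ + _).
  rewrite -dec_el triv_coeff_dec.
  under eq_bigr => be _ do rewrite ga_mulA lm_xx h' /= scaler0 addr0 gmulBl gmulZl.
  rewrite sumrB addrCA -[RHS]addr0; congr (_ + _).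
  rewrite (bigD1 al) //= eqxx big1 => [|be]; last first.
    by rewrite eq_sym => /negbTE->; rewrite gmul0l scaler0.
  rewrite triv_coeff_el eqxx.
  by rewrite addr0 e_mar eqxx subrr.
rewrite scale0r subr0 /= !ffunE gmulBr (linB ll) gmulDr gmul_sumr (linD ll) (lin_sum ll).
rewrite ga_mulA lm_xx h -dec_el triv_coeff_dec.
rewrite triv_coeff_el eqxx.
rewrite [X in _ - (_ + X) = _](eq_bigr (fun ga => (act (yA al) q).2 ga ** m (MBoth ga a be)
  - triv_coeff i q *: ((if al == ga then e (tgt (val al)) else 0) ** m (MBoth ga a be)))); last first.
  by move=> ga _; rewrite ga_mulA lm_xx h' /= scaler0 addr0 gmulBl gmulZl.
rewrite sumrB; congr (_ - _).
  case: eqP => _; last by rewrite gmul0r (lin0 ll).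
  by rewrite -h ga_mulA lm_mulr.
rewrite -addrA; congr (_ + _).
rewrite addrCA -[RHS]addr0; congr (_ + _).
rewrite (bigD1 al) //= eqxx big1 => [|ga]; last first.
  by rewrite eq_sym => /negbTE->; rewrite gmul0l scaler0.
by rewrite addr0 e_mar eqxx subrr.
Qed.

(** The right-hand side is the decoration of alpha x; this brings the last term in the differential
    of alpha phi beta^-1 into the form produced by the action. *)
Lemma lm_dec al x : eA i ** x = x -> lm al (dec x) = (act (yA al) x).1.
Proof. by move=> {1}<-; rewrite dec_el (lm_dec_pair al x).1. Qed.

End Leibniz.

(** * The derivation D on the bimodule *)

Section MutatedSquareZero.
Variables (k : fieldType) (n : nat) (Q : lf_quiver n) (i : 'I_n) (S : mut_data k Q i).
Local Notation mutA := (mutA Q i).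
Local Notation A := (mt_A S).
Local Notation B := (mt_B S).
Local Notation d := (@mt_d _ _ _ _ S).
Local Notation quo := (@mt_quo _ _ _ _ S).
Local Notation lm := (@mt_lm _ _ _ _ S).
Local Notation rd := (@mt_rd _ _ _ _ S).
Local Notation dM := (@mt_dM _ _ _ _ S).
Local Notation e := (@pa_e _ _ _ B).
Local Notation eA := (@pa_e _ _ _ A).
Local Notation xA := (@pa_x _ _ _ A).
Local Notation m := (mar B).
Local Notation raw := (rawY B).
Local Notation act := (@ract _ _ _ _ A B).
Local Notation dec := (@dec_act _ _ _ _ A B).
Local Notation md := (diff_arrow d quo lm rd).
Implicit Types (y z : raw) (al be : mutA).

Local Notation y1 := (one_Y S).
Local Notation yA := (@gen_Y _ _ _ _ S).
Local Notation act_lin := (@ract_lin _ _ _ _ A B).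

Lemma rd_el v (u : B) al : rd (e v ** u) al = e v ** rd u al.
Proof.
have rl := @mt_rd_lin _ _ _ _ S al.
move: u; apply: mut_lin_eq => [||w|c q _ _ _].
- exact: linear_compose rl (@ga_linr _ B _).
- exact: linear_compose (@ga_linr _ B _) rl.
- by rewrite pa_ee mt_rd_e gmul0r; case: eqP; rewrite ?mt_rd_e ?(lin0 rl).
- by rewrite ga_mulA !rd_xx ga_mulA.
Qed.
Lemma quo_el v (u : A) al : quo (eA v ** u) al = eA v ** quo u al.
Proof.
have rl := @mt_quo_lin _ _ _ _ S al.
move: u; apply: pa_lin_eq => [||w|a q _ _].
- exact: linear_compose rl (@ga_linr _ A _).
- exact: linear_compose (@ga_linr _ A _) rl.
- by rewrite pa_ee mt_quo_e gmul0r; case: eqP; rewrite ?mt_quo_e ?(lin0 rl).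
- by rewrite ga_mulA !quo_xx; case: eqP; rewrite ?gmul0r ?ga_mulA.
Qed.
Lemma quo_er (u : A) al : quo u al ** eA (tgt (val al)) = quo u al.
Proof.
have rl := @mt_quo_lin _ _ _ _ S al.
move: u; apply: pa_lin_eq => [||w|a q _ _] //.
- exact: linear_compose (@ga_linl _ A _) rl.
- by rewrite mt_quo_e gmul0l.
- by rewrite quo_xx; case: eqP => [->|]; rewrite ?gmul0l // -ga_mulA pa_eev.
Qed.
Lemma quo_src (u : A) al v : v != i -> quo (u ** eA v) al = 0.
Proof.
move=> vi; have rl := @mt_quo_lin _ _ _ _ S al.
move: u; apply: (pa_lin_eq (g := fun=> 0)) => [||w|a q _ _] //.
- exact: linear_compose rl (@ga_linl _ A _).
- exact: linear_const0.
- by rewrite pa_ee; case: eqP; rewrite ?mt_quo_e ?(lin0 rl).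
rewrite -ga_mulA pa_xe_if; case: eqP => [av|_]; last by rewrite gmul0r (lin0 rl).
by rewrite quo_xx; case: eqP => // h; rewrite h src_val in av; rewrite av eqxx in vi.
Qed.
Lemma rd_src (u : B) al v : v != i -> rd (u ** e v) al = 0.
Proof.
move=> vi; have rl := @mt_rd_lin _ _ _ _ S al.
move: u; apply: (mut_lin_eq (g := fun=> 0)) => [||w|c q _ _ _] //.
- exact: linear_compose rl (@ga_linl _ B _).
- exact: linear_const0.
- by rewrite pa_ee; case: eqP; rewrite ?mt_rd_e ?(lin0 rl).
rewrite -ga_mulA mar_e; case: eqP => [av|_]; last by rewrite gmul0r (lin0 rl).
rewrite rd_xx; case: c av => [phi|be|be phi|phi be|be phi ga] /= av; rewrite ?gmul0r //.
  by rewrite right_invalid ?gmul0r ?av.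
by rewrite both_invalid ?gmul0r ?av.
Qed.

Lemma diff_old_tgt phi : e (tgt phi) ** diff_old B d phi = diff_old B d phi.
Proof.
rewrite gmulDr gmulZr -dec_el d_x_tgt; congr (_ + _).
have [ti|ti] := eqVneq (tgt phi) i; last first.
  by rewrite big1 ?gmul0r // => al _; rewrite left_invalid // gmul0r.
by rewrite gmul_sumr; apply: eq_bigr => al _; rewrite ga_mulA e_mar ti eqxx.
Qed.
Lemma diff_old_src phi : diff_old B d phi ** e (src phi) = diff_old B d phi.
Proof.
rewrite gmulDl gmulZl -dec_er d_x_src gmul_suml; congr (_ + _).
by apply: eq_bigr => al _; rewrite -ga_mulA mar_e eqxx.
Qed.
Lemma diff_left_tgt al phi : e (tgt (val al)) ** diff_left B d al phi = diff_left B d al phi.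
Proof. by rewrite /diff_left -dec_el ga_mulA pa_ex. Qed.
Lemma diff_left_src al phi : diff_left B d al phi ** e (src phi) = diff_left B d al phi.
Proof. by rewrite /diff_left -dec_er -ga_mulA d_x_src. Qed.

Lemma md_tgt c : e (mtgt c) ** md c = md c.
Proof.
case: c => [phi|be|be phi|phi be|be phi ga] /=.
- exact: diff_old_tgt.
- exact: gmul0r.
- exact: diff_left_tgt.
- rewrite gmulBr gmulDr !gmulZr -rd_el diff_old_tgt ga_mulA e_mar eqxx.
  by rewrite -dec_el -quo_el d_x_tgt.
- rewrite gmulBr gmulDr !gmulZr -rd_el diff_left_tgt ga_mulA e_mar eqxx.
  by rewrite lm_mull.
Qed.
Lemma md_src c : md c ** e (msrc c) = md c.
Proof.
case: c => [phi|be|be phi|phi be|be phi ga] /=.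
- exact: diff_old_src.
- exact: gmul0l.
- exact: diff_left_src.
- rewrite gmulBl gmulDl !gmulZl rd_mulr -ga_mulA mar_e eqxx.
  by rewrite -dec_er quo_er.
- rewrite gmulBl gmulDl !gmulZl rd_mulr -ga_mulA mar_e eqxx.
  by rewrite -lm_mulr -dec_er quo_er.
Qed.

Local Notation dM_lin := (@mt_dM_lin _ _ _ _ S).

(** [mt_dM_xx] assumes a nontrivial path before c, because the empty product of arrows is 1 and not
    a trivial path. The trivial case comes from [mt_dM_x], where [md_tgt] allows e_(t c) to be
    inserted. *)
Lemma dM_mul_valid c (q : B) : mvalid c ->
  dM (q ** e (mtgt c) ** m c) = dM (q ** e (mtgt c)) ** m c + sgn (q ** e (mtgt c)) ** md c.
Proof.
move=> cv; move: q; apply: mut_lin_eq => [||v|b q bv qb _].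
- apply: linear_compose dM_lin _; apply: linear_compose (@ga_linl _ B _) (@ga_linl _ B _).
- apply: linear_add.
    apply: linear_compose (@ga_linl _ B _) _; exact: linear_compose dM_lin (@ga_linl _ B _).
  apply: linear_compose (@ga_linl _ B _) _; exact: linear_compose (@sgn_lin _ B) (@ga_linl _ B _).
- rewrite pa_ee; case: eqP => [->|_].
    by rewrite mar_tgt mt_dM_e gmul0l add0r sgn_e mt_dM_x // md_tgt.
  by rewrite !(gmul0l, lin0 dM_lin, lin0 (@sgn_lin _ B)) addr0.
rewrite -(ga_mulA q) mar_e; case: eqP => [bc|_].
  exact: mt_dM_xx.
by rewrite gmul0r !(gmul0l, lin0 dM_lin, lin0 (@sgn_lin _ B)) addr0.
Qed.
Lemma dM_er (q : B) v : dM (q ** e v) = dM q ** e v.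
Proof.
move: q; apply: mut_lin_eq => [||w|c q cv qc h].
- exact: linear_compose dM_lin (@ga_linl _ B _).
- exact: linear_compose (@ga_linl _ B _) dM_lin.
- by rewrite pa_ee mt_dM_e gmul0l; case: eqP => _; rewrite ?mt_dM_e // (lin0 dM_lin).
rewrite -ga_mulA mar_e -[in RHS]qc dM_mul_valid // qc gmulDl -!ga_mulA mar_e.
case: (msrc c =P v) => [<-|ncv]; first by rewrite md_src -{1}qc dM_mul_valid // qc.
rewrite -(md_src c) -ga_mulA pa_ee; case: eqP => // _.
by rewrite !gmul0r (lin0 dM_lin) addr0.
Qed.
Lemma dM_x c (q : B) : mvalid c -> dM (q ** m c) = dM q ** m c + sgn q ** md c.
Proof.
move=> cv; rewrite -{1}mar_tgt ga_mulA dM_mul_valid // dM_er -ga_mulA mar_tgt.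
by rewrite sgnM sgn_e -ga_mulA md_tgt.
Qed.
Lemma dM_mul (u v : B) : dM (u ** v) = dM u ** v + sgn u ** dM v.
Proof.
move: v; apply: mut_lin_eq => [||w|c q cv qc h].
- exact: linear_compose dM_lin (@ga_linr _ B _).
- apply: linear_add; first exact: (@ga_linr _ B _).
  exact: linear_compose (@ga_linr _ B _) dM_lin.
- by rewrite dM_er mt_dM_e gmul0r addr0.
rewrite ga_mulA !dM_x // h gmulDl gmulDr sgnM !ga_mulA.
by rewrite addrA.
Qed.
Lemma dM_one : dM (ga_one B) = 0.
Proof. by rewrite pa_one (lin_sum dM_lin) big1 // => v _; rewrite mt_dM_e. Qed.
Lemma dM_star al : dM (m (MStar al)) = 0.
Proof. by rewrite mt_dM_x. Qed.

(** The extension by the Leibniz rule for kM of D(1) = sum_alpha alpha^* alpha and D(alpha) = 0. In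
    particular D(e_j) = 0 for j other than i, as for the generators of T. *)
Definition Draw y : raw :=
  (dM y.1, [ffun be => dM (y.2 be) + sgn y.1 ** m (MStar be)]).

Lemma Draw_linear : linear Draw.
Proof.
apply: linear_pair; first exact: linear_compose dM_lin (@raw_fst_linear _ _ _ _ B).
apply: linear_ffun => al; apply: linear_add.
  exact: linear_compose dM_lin (raw_snd_linear al).
exact/mulr_linear/(linear_compose (@sgn_lin _ B))/raw_fst_linear.
Qed.
Local Notation Draw_lin := Draw_linear.
Lemma Draw_lmul b y : Draw (lmul b y) = lmul (dM b) y + lmul (sgn b) (Draw y).
Proof.
apply: raw_ext => [|al] /=; first exact: dM_mul.
by rewrite !ffunE dM_mul sgnM gmulDr addrA ga_mulA.
Qed.
Lemma Draw_isY y : isY y -> isY (Draw y).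
Proof.
by move=> hy al; rewrite /= ffunE gmulDl -dM_er hy -ga_mulA mar_e eqxx.
Qed.

Lemma raw_decomp y : isY y -> y = lmul y.1 y1 + \sum_al lmul (y.2 al) (yA al).
Proof.
move=> hy; apply: raw_ext => [|be] /=.
  rewrite ga_mul1r (lin_sum (@raw_fst_linear _ _ _ _ B)) big1 ?addr0 // => al _.
  by rewrite /= gmul0r.
rewrite !ffunE gmul0r add0r (lin_sum (raw_snd_linear be)) (bigD1 be) //= !ffunE eqxx hy.
rewrite big1 ?addr0 // => al; rewrite !ffunE eq_sym => /negbTE->; exact: gmul0r.
Qed.
Lemma isY1 : isY y1. Proof. by move=> al; rewrite /= ffunE gmul0l. Qed.
Lemma isYA al : isY (yA al).
Proof. by move=> be; rewrite /= ffunE; case: eqP => [->|_]; rewrite ?pa_eev ?gmul0l. Qed.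

Lemma tau_y1 : tau y1 = lmul (kap B) y1.
Proof.
apply: raw_ext => [|al] /=; rewrite ?ffunE ?gmul0r ?(lin0 (@sgn_lin _ B)) //.
have s1 : sgn (ga_one B) = ga_one B by rewrite (sgn_hom (ga_hom1 B)) scale1r.
by rewrite ga_mul1r s1 ga_mul1l.
Qed.
Lemma tau_yA al : tau (yA al) = yA al.
Proof.
apply: raw_ext => [|be] /=; first by rewrite (lin0 (@sgn_lin _ B)) gmul0l.
by rewrite !ffunE; case: eqP => _; rewrite ?sgn_e // (lin0 (@sgn_lin _ B)).
Qed.
Lemma Draw_yA al : Draw (yA al) = 0.
Proof.
apply: raw_ext => [|be] /=; first exact: (lin0 dM_lin).
rewrite !ffunE (lin0 (@sgn_lin _ B)) gmul0l addr0.
by case: eqP => _; rewrite ?mt_dM_e // (lin0 dM_lin).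
Qed.

(** Division removes the rightmost arrow, and this is b only where u is trivial. *)
Lemma quo_xl b (u : A) al : quo (xA b ** u) al
  = xA b ** quo u al + triv_coeff (src b) u *: (if b == val al then eA (tgt b) else 0).
Proof.
have ql := @mt_quo_lin _ _ _ _ S al; have tl := @triv_coeff_lin _ _ _ A (src b).
move: u; apply: pa_lin_eq => [||w|a q qa _].
- exact: linear_compose ql (@ga_linr _ A _).
- apply: linear_add; first exact: linear_compose (@ga_linr _ A _) ql.
  exact: linear_scalel.
- rewrite pa_xe_if mt_quo_e gmul0r add0r triv_coeff_e; case: eqP => _.
    by rewrite -[in LHS](pa_ex A b) quo_xx scale1r pa_eev.
  by rewrite scale0r (lin0 ql).
rewrite triv_coeff_x scale0r addr0 ga_mulA !quo_xx.
by case: eqP => _; rewrite ?ga_mulA ?gmul0r.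
Qed.

Lemma Draw_y1 : Draw y1 = (0, [ffun al => m (MStar al)]).
Proof.
have s1 : sgn (ga_one B) = ga_one B by rewrite (sgn_hom (ga_hom1 B)) scale1r.
apply: raw_ext => [|al] /=; first exact: dM_one.
by rewrite !ffunE s1 ga_mul1l (lin0 dM_lin) add0r.
Qed.

Lemma kap_d a : lmul (kap B) (act y1 (d (xA a))) = (-1) ^ chi i (tgt a) *: act y1 (d (xA a)).
Proof.
rewrite -d_x_tgt act_y1_el -lmulM kap_e.
by apply: raw_ext => [|al] /=; rewrite ?ffunE ?gmulZl.
Qed.

(** For a = phi outside A the kM-part is the formula for the differential of phi, and the
    beta-component is minus the formula for phi beta^-1. *)
Lemma Draw_arrow_y1 a : Draw (act_arrow a y1) = act_arrow a (Draw y1) + act (tau y1) (d (xA a)).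
Proof.
rewrite tau_y1 act_lmul kap_d.
have [/inAP[al ->]|aA] := boolP (inA i a).
  (* For a in A everything vanishes: d a = 0, D(a) = 0, and D(1) . a consists of arrows of M made
     from beta a, which do not exist because a does not end in i. *)
  rewrite -[act_arrow _ y1](@act_arr _ _ _ _ A B) act_y1_A Draw_yA mt_d_A (lin0 (act_lin _)) scaler0 addr0.
  rewrite Draw_y1; apply: raw_ext => [|be] /=.
    rewrite gmul0l add0r big1 // => be _; rewrite left_invalid ?gmul0r //; exact: (mt_noloop S).
  rewrite !ffunE /= !gmul0l if_same !add0r big1 ?oppr0 // => ga _.
  rewrite both_invalid_tgt ?gmul0r //; exact: (mt_noloop S).
have E : act_arrow a y1 = (m (MOld i a), [ffun be => - m (MRight a be)]).
  apply: raw_ext => [|be] /=.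
    by rewrite ga_mul1l big1 ?addr0 // => al _; rewrite ffunE gmul0l.
  rewrite !ffunE !ga_mul1l big1 ?addr0 => [|al _]; last by rewrite ffunE gmul0l.
  by case: eqP => [ab|_]; [rewrite ab inA_val in aA | rewrite sub0r].
rewrite E Draw_y1; apply: raw_ext => [|be].
  rewrite /= mt_dM_x // gmul0l add0r; congr (_ + _).
  by apply: eq_bigr => al _; rewrite ffunE.
have -> (u v : raw) : (u + v).2 be = u.2 be + v.2 be by rewrite /= ffunE.
have -> c (u : raw) : (c *: u).2 be = c *: u.2 be by rewrite /= ffunE.
rewrite snd_act_y1 /= !ffunE /= !gmul0l if_same !add0r (linN dM_lin).
have [ai|ai] := eqVneq (src a) i; last first.
  rewrite right_invalid // (lin0 dM_lin) oppr0 add0r sgn_mar gmulZl.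
  rewrite -(mar_tgt B (MStar be)) ga_mulA mar_e /= (negbTE ai) gmul0l scaler0.
  rewrite -d_x_src quo_src // dec_er rd_src // (lin0 (@dec_act_linear _ _ _ _ S)) subr0 scaler0 addr0.
  by rewrite big1 ?oppr0 // => al _; rewrite both_invalid // gmul0r.
rewrite mt_dM_x /= ?aA ?ai ?eqxx // sgn_mar gmulZl.
rewrite (linD (@mt_rd_lin _ _ _ _ S be)) (lin_sum (@mt_rd_lin _ _ _ _ S be)) (linZ (@mt_rd_lin _ _ _ _ S be)).
rewrite (eq_bigr _ (fun al _ => rd_xx be (MLeft al a) _)) /=.
rewrite [in RHS](eq_bigr (fun al => m (MStar al) ** m (MBoth al a be))); last by move=> al _; rewrite ffunE.
by rewrite scalerBr opprB opprD !addrA addrNK opprD addrA [X in X - _ = _]addrC.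
Qed.

Lemma act_yA_el al v x : act (yA al) (eA v ** x) = if v == i then act (yA al) x else 0.
Proof.
rewrite !act_yA ga_mulA pa_xe_if src_val eq_sym; case: eqP => // _.
by rewrite gmul0l (lin0 (act_lin _)).
Qed.

(** The kM-part is the formula for alpha phi, the beta-component minus the formula for alpha phi
    beta^-1. *)
Lemma Draw_arrow_yA al a : Draw (act_arrow a (yA al))
  = act_arrow a (Draw (yA al)) + act (tau (yA al)) (d (xA a)).
Proof.
rewrite Draw_yA (lin0 (act_arrow_linear _)) add0r tau_yA.
have E : act_arrow a (yA al) = (m (MLeft al a), [ffun be => - m (MBoth al a be)]).
  have h (F : mutA -> B) : \sum_ga (yA al).2 ga ** F ga = e (tgt (val al)) ** F al.
    rewrite (bigD1 al) //= ffunE eqxx big1 ?addr0 // => ga /negbTE gal.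
    by rewrite ffunE gal gmul0l.
  apply: raw_ext => [|be]; rewrite /act_arrow /= ?h ?ffunE ?h.
    by rewrite gmul0l add0r e_mar eqxx.
  by rewrite !gmul0l if_same !add0r e_mar eqxx.
rewrite E.
have [ti|ti] := eqVneq (tgt a) i; last first.
  rewrite -d_x_tgt act_yA_el (negbTE ti) left_invalid //.
  apply: raw_ext => [|be] /=; first exact: lin0 dM_lin.
  by rewrite !ffunE both_invalid_tgt // oppr0 (lin0 dM_lin) (lin0 (@sgn_lin _ B)) gmul0l addr0.
apply: raw_ext => [|be].
  by rewrite /= mt_dM_x /= ?ti // act_yA.
rewrite act_yA snd_act_y1 /= !ffunE (linN dM_lin) sgn_mar gmulZl.
have [ai|ai] := eqVneq (src a) i; last first.
  rewrite both_invalid // (lin0 dM_lin) oppr0 add0r.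
  rewrite -(mar_tgt B (MStar be)) ga_mulA mar_e /= (negbTE ai) gmul0l scaler0.
  rewrite -d_x_src ga_mulA quo_src // dec_er rd_src // (lin0 (@dec_act_linear _ _ _ _ S)).
  by rewrite subrr.
rewrite mt_dM_x /= ?ti ?ai ?eqxx // -/(diff_left B d al a).
(* Division by beta must commute with multiplication by alpha on the left. A summand e_i of d phi
   would break this when alpha = beta. *)
rewrite quo_xl src_val (mt_notriv S al) // scale0r addr0.
rewrite lm_dec; last by rewrite -quo_el -{2}d_x_tgt ti.
rewrite act_yA -/(dec _) -/(dec (xA (val al) ** d (xA a))).
by rewrite opprB opprD !addrA addrNK.
Qed.

(** Both sides obey the same Leibniz rule for left multiplication by kM, so the generators 1 and
    alpha decide. *)
Lemma Draw_arrow a y : isY y ->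
  Draw (act_arrow a y) = act_arrow a (Draw y) + act (tau y) (d (xA a)).
Proof.
have E b z : Draw (act_arrow a z) = act_arrow a (Draw z) + act (tau z) (d (xA a)) ->
    Draw (act_arrow a (lmul b z))
    = act_arrow a (Draw (lmul b z)) + act (tau (lmul b z)) (d (xA a)).
  move=> h; rewrite -!(@act_arr _ _ _ _ A B) act_lmul !(Draw_lmul, tau_lmul, act_lmul).
  rewrite (linD (act_linl _)) !act_lmul !act_arr h.
  by rewrite (linD (lmul_linear _)) addrA.
move=> /raw_decomp ->; rewrite !(linD (act_arrow_linear _)) !(linD Draw_lin) !(linD (@tau_linear _ _ _ _ B)).
rewrite !(linD (act_linl _)) !(linD (act_arrow_linear _)) [RHS]addrACA; congr (_ + _).
  exact/E/Draw_arrow_y1.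
rewrite !(lin_sum (act_arrow_linear _)) !(lin_sum Draw_lin) !(lin_sum (@tau_linear _ _ _ _ B)).
rewrite (lin_sum (act_arrow_linear _)) (lin_sum (act_linl _)) -big_split.
by apply: eq_bigr => al _; apply/E/Draw_arrow_yA.
Qed.

Lemma Draw_triv v y : isY y -> Draw (act_triv v y) = act_triv v (Draw y).
Proof.
move=> hy; apply: raw_ext => [|al] /=; first exact: dM_er.
rewrite !ffunE; case: (v =P i) => [->|/eqP vi].
  by rewrite dM_er sgnM sgn_e gmulDl -!ga_mulA e_mar mar_e !eqxx.
by rewrite (lin0 dM_lin) sgnM sgn_e -ga_mulA e_mar /= (negbTE vi) gmul0r addr0.
Qed.

Lemma Draw_act y x : isY y -> Draw (act y x) = act (Draw y) x + act (tau y) (d x).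
Proof.
move=> hy; have dl : linear d by exact: mt_d_lin.
 move: x; apply: pa_lin_eq => [||v|a q _ h].
- exact: linear_compose Draw_lin (act_lin y).
- apply: linear_add (act_lin _) _; exact: linear_compose (act_lin _) dl.
- by rewrite !act_e mt_d_e (lin0 (act_lin _)) addr0 Draw_triv.
rewrite d_leib (linD (act_lin _)) !act_x Draw_arrow; last exact: isY_act.
rewrite h (linD (act_arrow_linear _)) -addrA; congr (_ + (_ + _)).
by rewrite (tau_act (mt_noloop S)) // actM.
Qed.

Lemma sgn_dM (u : B) : (forall p v, ga_hom p v -> ga_hom (p - 1) (dM v)) ->
  sgn (dM u) = - dM (sgn u).
Proof.
move=> hd; move: u (grading_sum (ga_grading B) u).
apply: homogeneous_sum_ind => [|u v hu hv|p u hu].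
- by rewrite !(lin0 dM_lin, lin0 (@sgn_lin _ B)) oppr0.
- by rewrite !(linD dM_lin, linD (@sgn_lin _ B)) hu hv opprD.
rewrite (sgn_hom hu) (sgn_hom (hd _ _ hu)) (linZ dM_lin) signzD exprN1 invrN1.
by rewrite mulrN1 scaleNr.
Qed.

End MutatedSquareZero.

(** * Degree and square of the mutated differential *)

Section MutatedIsDifferential.
Variables (k : fieldType) (n : nat) (Q : lf_quiver n) (i : 'I_n) (S : mut_data k Q i).
Local Notation mutA := (mutA Q i).
Local Notation A := (mt_A S).
Local Notation B := (mt_B S).
Local Notation d := (@mt_d _ _ _ _ S).
Local Notation quo := (@mt_quo _ _ _ _ S).
Local Notation lm := (@mt_lm _ _ _ _ S).
Local Notation rd := (@mt_rd _ _ _ _ S).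
Local Notation dM := (@mt_dM _ _ _ _ S).
Local Notation e := (@pa_e _ _ _ B).
Local Notation eA := (@pa_e _ _ _ A).
Local Notation xA := (@pa_x _ _ _ A).
Local Notation m := (mar B).
Local Notation raw := (rawY B).
Local Notation act := (@ract _ _ _ _ A B).
Local Notation dec := (@dec_act _ _ _ _ A B).
Local Notation md := (diff_arrow d quo lm rd).
Implicit Types (y z : raw) (al be : mutA).

Local Notation y1 := (one_Y S).
Local Notation yA := (@gen_Y _ _ _ _ S).
Local Notation act_lin := (@ract_lin _ _ _ _ A B).
Local Notation dM_lin := (@mt_dM_lin _ _ _ _ S).
Local Notation Draw_lin := (@Draw_linear _ _ _ _ S).

Lemma triv_coeff_hom v p (u : B) : ga_hom p u -> p != 0 -> triv_coeff v u = 0.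
Proof.
have tl := @triv_coeff_lin _ _ _ B v.
move: p u; apply: mut_hom_ind => [p _|p c x y hx hy p0|w|p c q _ _ _ _ _].
- by rewrite (lin0 tl).
- by rewrite tl hx // hy // scaler0 addr0.
- by [].
- by rewrite triv_coeff_mar.
Qed.

Lemma rd_hom p (u : B) al : ga_hom p u -> ga_hom (p + 1) (rd u al).
Proof.
have rl := @mt_rd_lin _ _ _ _ S al.
move: p u; apply: mut_hom_ind => [p|p c x y hx hy|w|p c q _ hq _ _].
- by rewrite (lin0 rl); apply: hom0.
- by rewrite rl; apply: (gradingP (ga_grading B)).
- by rewrite mt_rd_e; apply: hom0.
rewrite rd_xx -addrA; apply: ga_homM => //.
case: c => [phi|be|be phi|phi be|be phi ga] /=; try exact: hom0.
  exact: (mar_hom B (MRight phi al)).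
by rewrite subrK; apply: (mar_hom B (MBoth be phi al)).
Qed.

Lemma lm_hom p (u : B) al : ga_hom p u -> ga_hom (p - 1) (lm al u).
Proof.
have ll := @mt_lm_lin _ _ _ _ S al.
move: p u; apply: mut_hom_ind => [p|p c x y hx hy|w|p c q _ hq _ h].
- by rewrite (lin0 ll); apply: hom0.
- by rewrite ll; apply: (gradingP (ga_grading B)).
- by rewrite mt_lm_e; apply: hom0.
rewrite lm_xx; apply: homD.
  by rewrite addrAC; apply: ga_homM => //; apply: mar_hom.
have [->|p0] := eqVneq p 0; last by rewrite (triv_coeff_hom i hq p0) scale0r; apply: hom0.
apply: homZ; rewrite add0r.
case: c => [phi|be|be phi|phi be|be phi ga] /=; try exact: hom0.
  exact: (mar_hom B (MLeft al phi)).
by rewrite addrK; apply: (mar_hom B (MBoth al phi be)).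
Qed.

Lemma quo_hom p (u : A) al : ga_hom p u -> ga_hom p (quo u al).
Proof.
have ql := @mt_quo_lin _ _ _ _ S al.
move: p u; apply: pa_hom_ind => [p|p c x y hx hy|w|p a q hq qa h].
- by rewrite (lin0 ql); apply: hom0.
- by rewrite ql; apply: (gradingP (ga_grading A)).
- by rewrite mt_quo_e; apply: hom0.
rewrite quo_xx qa; case: eqP => [->|_]; last exact: hom0.
by rewrite deg_val addr0.
Qed.

Lemma homY_y1 v : homY (chi i v) (lmul (e v) y1).
Proof.
split=> [w|al] /=; last by rewrite !ffunE gmul0r; apply: hom0.
rewrite ga_mul1r pa_ee; case: eqP => [<-|_]; last exact: hom0.
by rewrite subrr; apply: pa_hom_e.
Qed.
(** The degree is read off from the action of x on e_v in Y, without counting the insertions of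
    Delta. *)
Lemma dec_hom v w p x : ga_hom p x -> ga_hom (chi i v + p - chi i w) (e v ** dec x ** e w).
Proof.
move=> hx; have [h _] := homY_act (mt_noloop S) (homY_y1 v) hx.
by have := h w; rewrite act_lmul.
Qed.
Lemma dec_hom_e v w p x : ga_hom p x -> eA v ** x = x -> x ** eA w = x ->
  ga_hom (chi i v + p - chi i w) (dec x).
Proof. by move=> hx vx xw; have := dec_hom v w hx; rewrite -dec_el -dec_er vx xw. Qed.

Lemma d_x_hom a : ga_hom (deg a - 1) (d (xA a)).
Proof. by apply: d_hom; apply: pa_hom_x. Qed.

Lemma diff_old_hom phi : ga_hom (mdeg_old i phi - 1) (diff_old B d phi).
Proof.
apply: homD; first apply: hom_sum => al _.
  by rewrite -[_ - 1]add0r; apply: ga_homM (mar_hom B (MStar al)) (mar_hom B (MLeft al phi)).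
apply: homZ; have := dec_hom_e (d_x_hom phi) (d_x_tgt S phi) (d_x_src S phi).
by rewrite (_ : _ - _ = mdeg_old i phi - 1) // /mdeg_old; ring.
Qed.
Lemma diff_left_hom al phi : tgt phi = i -> ga_hom (mdeg_old i phi - 1 - 1) (diff_left B d al phi).
Proof.
move=> ti; have h := ga_homM (pa_hom_x A (val al)) (d_x_hom phi).
have := dec_hom_e (v := tgt (val al)) (w := src phi) h.
rewrite ga_mulA pa_ex -ga_mulA d_x_src => /(_ erefl erefl).
rewrite chi_ni ?(mt_noloop S) // deg_val /mdeg_old ti chi_i.
by rewrite (_ : _ - _ = deg phi - chi i (src phi) + 1 - 1 - 1) //; ring.
Qed.

Lemma md_hom c : mvalid c -> ga_hom (mdeg c - 1) (md c).
Proof.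
case: c => [phi|be|be phi|phi be|be phi ga] /= cv.
- exact: diff_old_hom.
- exact: hom0.
- exact: (diff_left_hom be (eqP cv)).
- case/andP: cv => _ /eqP si.
  apply: homD; first apply: homD; last (apply/homN/homZ).
  + by have := rd_hom be (diff_old_hom phi); rewrite subrK addrK.
  + by rewrite addrK; apply: homZ; rewrite -[mdeg_old i phi]addr0;
      apply: ga_homM (mar_hom B (MOld i phi)) (mar_hom B (MStar be)).
  have := dec_hom_e (v := tgt phi) (w := tgt (val be)) (quo_hom be (d_x_hom phi)).
  rewrite -quo_el d_x_tgt quo_er [chi i (tgt (val be))]chi_ni ?(mt_noloop S) // => /(_ erefl erefl).
  by rewrite /mdeg_old si chi_i (_ : _ - 0 = deg phi - 1 + chi i (tgt phi) + 1 - 1) //; ring.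
case/andP: cv => /eqP si /eqP ti.
apply: homD; first apply: homD; last apply/homN.
- by have := rd_hom ga (diff_left_hom be ti); rewrite subrK.
- apply: homZ; rewrite -[_ - 1]addr0.
  exact: ga_homM (mar_hom B (MLeft be phi)) (mar_hom B (MStar ga)).
apply: lm_hom.
have := dec_hom_e (v := tgt phi) (w := tgt (val ga)) (quo_hom ga (d_x_hom phi)).
rewrite -quo_el d_x_tgt quo_er [chi i (tgt (val ga))]chi_ni ?(mt_noloop S) // => /(_ erefl erefl).
by rewrite /mdeg_old si ti chi_i (_ : _ - 0 = deg phi - 1 + 1) //; ring.
Qed.

Lemma dM_hom p (u : B) : ga_hom p u -> ga_hom (p - 1) (dM u).
Proof.
move: p u; apply: mut_hom_ind => [p|p c x y hx hy|w|p c q cv hq _ h].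
- by rewrite (lin0 dM_lin); apply: hom0.
- by rewrite dM_lin; apply: (gradingP (ga_grading B)).
- by rewrite mt_dM_e; apply: hom0.
rewrite dM_x //; apply: homD.
  by rewrite addrAC; apply: ga_homM => //; apply: mar_hom.
by rewrite -addrA; apply: ga_homM; [apply: hom_sgn | apply: md_hom].
Qed.

Lemma sgn_dM' (u : B) : sgn (dM u) = - dM (sgn u).
Proof. exact: sgn_dM dM_hom. Qed.

Lemma dM_kap : dM (kap B) = 0.
Proof.
rewrite (lin_sum dM_lin) big1 // => v _.
by rewrite (linZ dM_lin) mt_dM_e scaler0.
Qed.
Lemma sgn_kap : sgn (kap B) = kap B.
Proof.
rewrite (lin_sum (@sgn_lin _ B)); apply: eq_bigr => v _.
by rewrite (linZ (@sgn_lin _ B)) sgn_e.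
Qed.
Lemma kap_star al : kap B ** m (MStar al) = - m (MStar al).
Proof. by rewrite -[m _]mar_tgt ga_mulA kap_e gmulZl /= chi_i scaleN1r. Qed.

Lemma tau_Draw y : isY y -> tau (Draw y) = - Draw (tau y).
Proof.
move=> hy; apply: raw_ext => [|al] /=.
  by rewrite dM_mul dM_kap gmul0r addr0 sgn_dM' gmulNl.
rewrite !ffunE (linD (@sgn_lin _ B)) sgn_dM' opprD sgnM sgnK; congr (_ + _).
rewrite sgnM sgnK sgn_kap -ga_mulA kap_star gmulNr opprK.
by rewrite sgn_mar scale1r.
Qed.

Lemma tauK y : tau (tau y) = y.
Proof.
have kk : kap B ** kap B = ga_one B.
  rewrite {1}/kap gmul_suml pa_one; apply: eq_bigr => v _.
  by rewrite gmulZl e_kap scalerA signzz scale1r.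
apply: raw_ext => [|al] /=; last by rewrite !ffunE sgnK.
by rewrite sgnM sgnK sgn_kap -ga_mulA kk ga_mul1r.
Qed.
Lemma isY_tau y : isY y -> isY (tau y).
Proof. by move=> hy al; rewrite /= ffunE -[in RHS](hy al) sgnM sgn_e. Qed.

Lemma Draw_sq_fst y : (Draw (Draw y)).1 = dM (dM y.1). Proof. by []. Qed.
(** The two cross terms with alpha^* cancel, since alpha^* has differential 0 and [sgn] anticommutes
    with [dM]. *)
Lemma Draw_sq_snd y al : (Draw (Draw y)).2 al = dM (dM (y.2 al)).
Proof.
rewrite /= !ffunE (linD dM_lin) dM_mul dM_star gmul0r addr0 sgn_dM'.
by rewrite gmulNl addrK.
Qed.

(** The mixed terms tau(D y) d x and D(tau y) d x cancel because [tau] anticommutes with D; what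
    remains is (D D y) x + y (d d x). *)
Lemma Draw_sq_act y x : isY y -> Draw (Draw y) = 0 -> Draw (Draw (act y x)) = 0.
Proof.
move=> hy h; rewrite Draw_act // (linD Draw_lin) Draw_act; last exact: Draw_isY.
rewrite Draw_act; last exact: isY_tau.
rewrite h (lin0 (act_linl _)) add0r tau_Draw // tauK d_sq (lin0 (act_lin _)) addr0.
by rewrite -(linD (act_linl _)) addNr (lin0 (act_linl _)).
Qed.

(** Except for alpha^*, whose differential is 0, every arrow is up to sign a component of 1 . phi or
    of alpha . phi. D D vanishes on these and acts componentwise as the square of [dM]. *)
Lemma dM_sq_mar c : mvalid c -> dM (dM (m c)) = 0.
Proof.
have h1 phi : Draw (Draw (act y1 (xA phi))) = 0.
  apply: Draw_sq_act; first exact: isY1.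
  apply: raw_ext => [|al]; first by rewrite Draw_sq_fst dM_one (lin0 dM_lin).
  by rewrite Draw_sq_snd ffunE !(lin0 dM_lin).
have hA al phi : Draw (Draw (act (yA al) (xA phi))) = 0.
  by apply: Draw_sq_act; [exact: isYA | rewrite Draw_yA (lin0 Draw_lin)].
have hs al (F : mutA -> B) : \sum_ga (yA al).2 ga ** F ga = e (tgt (val al)) ** F al.
  rewrite (bigD1 al) //= ffunE eqxx big1 ?addr0 // => ga /negbTE gal.
  by rewrite ffunE gal gmul0l.
case: c => [phi|be|be phi|phi be|be phi ga] /= cv.
- have := congr1 fst (h1 phi); rewrite Draw_sq_fst act_arr /= ga_mul1l.
  by rewrite big1 ?addr0 // => al _; rewrite ffunE gmul0l.
- by rewrite dM_star (lin0 dM_lin).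
- have := congr1 fst (hA be phi); rewrite Draw_sq_fst act_arr /= hs.
  by rewrite gmul0l add0r e_mar eqxx.
- case/andP: cv => pA _.
  have := congr1 (fun y : raw => y.2 be) (h1 phi); rewrite Draw_sq_snd act_arr /= !ffunE !ga_mul1l.
  rewrite big1 ?addr0 => [|al _]; last by rewrite ffunE gmul0l.
  case: eqP => [pb|_]; first by rewrite pb inA_val in pA.
  by rewrite sub0r !(linN dM_lin) => /eqP; rewrite oppr_eq0 => /eqP.
have := congr1 (fun y : raw => y.2 ga) (hA be phi); rewrite Draw_sq_snd act_arr /= !ffunE hs.
rewrite !gmul0l if_same !add0r e_mar eqxx.
by rewrite !(linN dM_lin) => /eqP; rewrite oppr_eq0 => /eqP.
Qed.

Lemma dM_sq (u : B) : dM (dM u) = 0.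
Proof.
move: u; apply: (mut_lin_eq (g := fun=> 0)) => [||v|c q cv _ h].
- exact: linear_compose dM_lin dM_lin.
- exact: linear_const0.
- by rewrite mt_dM_e (lin0 dM_lin).
rewrite dM_mul (linD dM_lin) !dM_mul h gmul0l add0r sgnK dM_sq_mar // gmul0r addr0.
by rewrite sgn_dM' gmulNl addNr.
Qed.

Lemma dM_is_differential : is_differential dM.
Proof.
split; [exact: dM_lin | exact: dM_hom | exact: dM_sq |].
by move=> p u v hu; rewrite dM_mul (sgn_hom hu) gmulZl.
Qed.

Definition mt_mutated : dgAlgebra k := DgAlgebra dM_is_differential.

End MutatedIsDifferential.

(** * Y as a dg module, and left multiplication by kM on it *)

Section BimoduleAsDgModule.
Variables (k : fieldType) (n : nat) (Q : lf_quiver n) (i : 'I_n) (S : mut_data k Q i).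
Local Notation mutA := (mutA Q i).
Local Notation A := (mt_A S).
Local Notation B := (mt_B S).
Local Notation dM := (@mt_dM _ _ _ _ S).
Local Notation raw := (rawY B).
Local Notation act := (@ract _ _ _ _ A B).
Implicit Types (y z : raw) (al be : mutA).

Local Notation act_lin := (@ract_lin _ _ _ _ A B).
Local Notation dM_lin := (@mt_dM_lin _ _ _ _ S).
Local Notation Draw_lin := (@Draw_linear _ _ _ _ S).

Lemma Draw_hom p y : homY p y -> homY (p - 1) (Draw y).
Proof.
move=> [h1 h2]; split=> [v|al] /=.
  by rewrite -dM_er addrAC; apply: dM_hom.
rewrite ffunE; apply: homD; first exact: dM_hom.
rewrite -mar_tgt ga_mulA -(sgn_e B (mtgt _)) -sgnM -[p - 1]addr0.
apply: ga_homM (mar_hom B (MStar al)); apply: hom_sgn.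
by have := h1 i; rewrite chi_i.
Qed.

Definition Yact (y : Ycar B) (a : mt_dga S) : Ycar B :=
  to_subspace _ (isY_act (val y) (a : A)).
Definition Yd (y : Ycar B) : Ycar B := to_subspace _ (Draw_isY (subspaceP y)).

Definition Ydg : dgModule (mt_dga S).
Proof.
refine (@DgModule k (mt_dga S) (Ycar B) Yact (fun p (w : Ycar B) => homY p (val w)) Yd
  _ _ _ _ (Y_grading B) _ _ _ _ _).
- abstract (by move=> a c x y; apply: val_inj; apply: act_linl).
- abstract (by move=> x c a b; apply: val_inj; apply: act_lin).
- abstract (by move=> x; apply: val_inj; apply: act1 (subspaceP x)).
- abstract (by move=> x a b; apply: val_inj; apply: actM).
- abstract (by move=> p q x a hx ha; exact: (@homY_act _ _ _ _ A B (mt_noloop S) p q (val x) a hx ha)).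
- abstract (by move=> c x y; apply: val_inj; apply: Draw_lin).
- abstract (by move=> p x; apply: Draw_hom).
- abstract (by move=> x; apply: val_inj; apply: raw_ext => [|al];
    [rewrite Draw_sq_fst dM_sq | rewrite Draw_sq_snd dM_sq ffunE]).
- abstract (by move=> p x a hx; apply: val_inj; apply: etrans (Draw_act _ (subspaceP x)) _;
    rewrite (tau_hom hx) (linZ (act_linl _))).
Defined.

Lemma Yact_val (y : Ydg) (a : mt_dga S) : val (dgm_act y a) = act (val y) a.
Proof. by []. Qed.
Lemma Yd_val (y : Ydg) : val (dgm_d y) = Draw (val y).
Proof. by []. Qed.

Definition Ylmul (b : B) (y : Ydg) : Ydg := to_subspace _ (isY_lmul b (subspaceP y)).

Lemma Ylmul_hom p b : ga_hom p b -> dgend_hom p (Ylmul b).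
Proof.
move=> hb; split=> [c x y|x a|q x hx].
- by apply: val_inj; apply: lmul_linear.
- by apply: val_inj; apply/esym/act_lmul.
- exact: homY_lmul hb hx.
Qed.

Lemma Ylmul_car b : homogeneous_sum (@dgend_hom _ _ Ydg) (Ylmul b).
Proof.
move: b (grading_sum (ga_grading B) b); apply: homogeneous_sum_ind => [|b c hb hc|p b hb].
- have -> : Ylmul 0 = 0; last exact: homogeneous_sum0.
  apply/funext => y; apply: val_inj; apply: raw_ext => [|al]; first exact: gmul0l.
  by rewrite !ffunE gmul0l.
- have -> : Ylmul (b + c) = Ylmul b + Ylmul c; last exact: homogeneous_sumD.
  apply/funext => y; apply: val_inj; apply: raw_ext => [|al]; first exact: gmulDl.
  by rewrite !ffunE gmulDl.
exact: homogeneous_sum1 (Ylmul_hom hb).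
Qed.

Definition Ylmul_end (b : mt_mutated S) : dgEnd Ydg :=
  to_subspace (dgend_subspace Ydg) (Ylmul_car b).

Lemma Ylmul_morphism : is_dga_morphism Ylmul_end.
Proof.
split.
- move=> c x y; apply: val_inj; apply/funext => z; apply: val_inj.
  exact: lmul_linearl.
- apply: val_inj; apply/funext => z; apply: val_inj; exact: lmul1.
- move=> x y; apply: val_inj; apply/funext => z; apply: val_inj; exact: lmulM.
- move=> p x hx; exact: Ylmul_hom.
move=> x; apply: val_inj.
have dl : linear (fun b : B => dgend_diff (Ylmul b)).
  have E c u v : Ylmul (c *: u + v) = c *: Ylmul u + Ylmul v.
    by apply/funext => y; apply: val_inj; apply: lmul_linearl.
  by move=> c u v; rewrite E (@dgend_diff_linear _ _ Ydg).
have dl' : linear (fun b : B => Ylmul (dM b)).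
  have E c u v : Ylmul (c *: u + v) = c *: Ylmul u + Ylmul v.
    by apply/funext => y; apply: val_inj; apply: lmul_linearl.
  by move=> c u v; rewrite dM_lin E.
change (Ylmul (dM x) = dgend_diff (Ylmul x)).
move: (x : B) (grading_sum (ga_grading B) x); apply: homogeneous_sum_ind => [|b c hb hc|p b hb].
- by rewrite (lin0 dl) (lin0 dl').
- by rewrite (linD dl) (linD dl') hb hc.
apply/funext => y; rewrite (dgend_diffE _ (Ylmul_hom hb)).
apply: val_inj; rewrite raddfB /= Draw_lmul (sgn_hom hb).
by rewrite (linZ (lmul_linearl (Draw (val y)))) addrK.
Qed.

End BimoduleAsDgModule.

Lemma addr_cancel (V : zmodType) (a b c f g r s : V) :
  a + b + (c - r) + (f + g) - (b + s - r + g) = a + (c - s) + f.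
Proof.
apply/eqP; rewrite subr_eq; apply/eqP.
rewrite [RHS]addrACA; congr (_ + _).
by rewrite -[b + s - r]addrA [RHS]addrACA [c - s + _]addrA subrK.
Qed.

(** * Maps out of the silting complex in terms of generators *)

Section SiltingGenerators.
Variables (k : fieldType) (n : nat) (Q : lf_quiver n) (i : 'I_n) (S : mut_data k Q i).
Local Notation mutA := (mutA Q i).
Local Notation A := (mt_A S).
Local Notation B := (mt_B S).
Local Notation d := (@mt_d _ _ _ _ S).
Local Notation eA := (@pa_e _ _ _ A).
Local Notation xA := (@pa_x _ _ _ A).
Local Notation raw := (rawY B).
Implicit Types (y z : raw) (al be : mutA).

Local Notation d_lin := (@mt_d_lin _ _ _ _ S).
Local Notation L := (mt_dga S).
Local Notation J := {j : 'I_n | j != i}.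

(* The silting complex through coordinates: sb_gA al generates P_(t al), sb_gI
   generates the shifted P_i, sb_gJ j generates P_j, and the differential maps
   sb_gI to sum_alpha sb_gA alpha alpha. *)
Record silting_basis (T : dgModule L) := SiltingBasis {
  sb_cA : T -> mutA -> A;
  sb_cI : T -> A;
  sb_cJ : T -> J -> A;
  sb_gA : mutA -> T;
  sb_gI : T;
  sb_gJ : J -> T;
  cA_lin : forall al, linear (sb_cA^~ al);
  cI_lin : linear sb_cI;
  cJ_lin : forall j, linear (sb_cJ^~ j);
  cA_act : forall t a al, sb_cA (dgm_act t a) al = sb_cA t al ** a;
  cI_act : forall t a, sb_cI (dgm_act t a) = sb_cI t ** a;
  cJ_act : forall t a j, sb_cJ (dgm_act t a) j = sb_cJ t j ** a;
  cA_hom : forall p t al, dgm_hom p t -> ga_hom p (sb_cA t al);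
  cI_hom : forall p t, dgm_hom p t -> ga_hom (p - 1) (sb_cI t);
  cJ_hom : forall p t j, dgm_hom p t -> ga_hom p (sb_cJ t j);
  cA_d : forall t al, sb_cA (dgm_d t) al = d (sb_cA t al) + xA (val al) ** sb_cI t;
  cI_d : forall t, sb_cI (dgm_d t) = - d (sb_cI t);
  cJ_d : forall t j, sb_cJ (dgm_d t) j = d (sb_cJ t j);
  cA_gA : forall al be, sb_cA (sb_gA al) be = if be == al then eA (tgt (val al)) else 0;
  cI_gA : forall al, sb_cI (sb_gA al) = 0;
  cJ_gA : forall al j, sb_cJ (sb_gA al) j = 0;
  cA_gI : forall al, sb_cA sb_gI al = 0;
  cI_gI : sb_cI sb_gI = eA i;
  cJ_gI : forall j, sb_cJ sb_gI j = 0;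
  cA_gJ : forall j al, sb_cA (sb_gJ j) al = 0;
  cI_gJ : forall j, sb_cI (sb_gJ j) = 0;
  cJ_gJ : forall j l, sb_cJ (sb_gJ j) l = if l == j then eA (val j) else 0;
  gA_hom : forall al, dgm_hom 0 (sb_gA al);
  gI_hom : dgm_hom 1 sb_gI;
  gJ_hom : forall j, dgm_hom 0 (sb_gJ j);
  basis_decomp : forall t, t = \sum_al dgm_act (sb_gA al) (sb_cA t al) + dgm_act sb_gI (sb_cI t)
    + \sum_j dgm_act (sb_gJ j) (sb_cJ t j) }.

Variables (T : dgModule L) (G : silting_basis T).
Local Notation cA := (sb_cA G).
Local Notation cI := (sb_cI G).
Local Notation cJ := (sb_cJ G).
Local Notation gA := (sb_gA G).
Local Notation gI := (sb_gI G).
Local Notation gJ := (sb_gJ G).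

Lemma act0 (X : dgModule L) (u : X) : dgm_act u 0 = 0.
Proof. exact: lin0 (dgm_linr u). Qed.
Lemma dgm_homD (Z : dgModule L) p (u v : Z) : dgm_hom p u -> dgm_hom p v -> dgm_hom p (u + v).
Proof. by move=> hu hv; rewrite -[u]scale1r; apply: (gradingP (dgm_grading Z)). Qed.
Lemma dgm_homZ (Z : dgModule L) p c (u : Z) : dgm_hom p u -> dgm_hom p (c *: u).
Proof. by move=> hu; apply: (gradingZ (dgm_grading Z)). Qed.
Lemma dgm_homB (Z : dgModule L) p (u v : Z) : dgm_hom p u -> dgm_hom p v -> dgm_hom p (u - v).
Proof. by move=> hu hv; rewrite -scaleN1r; apply: dgm_homD hu (dgm_homZ _ hv). Qed.
Lemma dgm_hom_sum (Z : dgModule L) p (I : finType) (F : I -> Z) :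
  (forall j, dgm_hom p (F j)) -> dgm_hom p (\sum_j F j).
Proof.
move=> h; apply: big_ind => //; [exact: grading0 (dgm_grading Z) _ | exact: dgm_homD].
Qed.

Section GeneratorMap.
Variables (X : dgModule L) (w : mutA -> X) (wi : X) (wj : J -> X).

(** No condition on the images is imposed: a generator of T goes to its prescribed image times the
    trivial path at its vertex. *)
Definition gmap (t : T) : X :=
  \sum_al dgm_act (w al) (cA t al) + dgm_act wi (cI t) + \sum_j dgm_act (wj j) (cJ t j).

Lemma gmap_linear : linear gmap.
Proof.
apply: linear_add; first apply: linear_add.
- by apply: linear_bigsum => al; apply: linear_compose (dgm_linr (w al)) (cA_lin G al).
- exact: linear_compose (dgm_linr wi) (cI_lin G).
by apply: linear_bigsum => j; apply: linear_compose (dgm_linr (wj j)) (cJ_lin G j).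
Qed.

Lemma gmap_act t a : gmap (dgm_act t a) = dgm_act (gmap t) a.
Proof.
rewrite /gmap !(linD (dgm_linl a)) !(lin_sum (dgm_linl a)) cI_act -(@dgm_actM _ _ X wi).
congr (_ + _ + _); apply: eq_bigr => j _; rewrite ?cA_act ?cJ_act.
  by rewrite -(@dgm_actM _ _ X).
by rewrite -(@dgm_actM _ _ X).
Qed.

Lemma gmap_hom p : (forall al, dgm_hom p (w al)) -> dgm_hom (p + 1) wi ->
  (forall j, dgm_hom p (wj j)) -> dgm_hom_of_degree p gmap.
Proof.
move=> h1 h2 h3; split; [exact: gmap_linear | exact: gmap_act |].
move=> q t ht; apply: dgm_homD; first apply: dgm_homD.
- by apply: dgm_hom_sum => al; apply: dgm_homM => //; apply: cA_hom.
- rewrite (_ : p + q = (p + 1) + (q - 1)); last by ring.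
  by apply: dgm_homM => //; apply: cI_hom.
by apply: dgm_hom_sum => al; apply: dgm_homM => //; apply: cJ_hom.
Qed.

Lemma gmap_d t : gmap (dgm_d t) =
  \sum_al dgm_act (w al) (d (cA t al)) + \sum_al dgm_act (w al) (xA (val al) ** cI t)
  - dgm_act wi (d (cI t)) + \sum_j dgm_act (wj j) (d (cJ t j)).
Proof.
rewrite /gmap cI_d (linN (dgm_linr wi)) -big_split /=; congr (_ + _ + _).
- by apply: eq_bigr => al _; rewrite cA_d (linD (dgm_linr (w al))).
- by apply: eq_bigr => j _; rewrite cJ_d.
Qed.

Lemma gmap_gA al : gmap (gA al) = dgm_act (w al) (eA (tgt (val al))).
Proof.
rewrite /gmap (bigD1 al) //= big1 => [|be bal]; last by rewrite cA_gA (negbTE bal) act0.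
by rewrite cA_gA eqxx cI_gA act0 big1 ?addr0 // => j _; rewrite cJ_gA act0.
Qed.
Lemma gmap_gI : gmap gI = dgm_act wi (eA i).
Proof.
rewrite /gmap big1 => [|al _]; last by rewrite cA_gI act0.
by rewrite cI_gI big1 ?addr0 ?add0r // => j _; rewrite cJ_gI act0.
Qed.
Lemma gmap_gJ j : gmap (gJ j) = dgm_act (wj j) (eA (val j)).
Proof.
rewrite /gmap big1 => [|al _]; last by rewrite cA_gJ act0.
rewrite cI_gJ act0 !add0r (bigD1 j) //= big1 => [|l lj]; last by rewrite cJ_gJ (negbTE lj) act0.
by rewrite cJ_gJ eqxx addr0.
Qed.
End GeneratorMap.

Lemma gmap_eq (X : dgModule L) (F : T -> X) : linear F ->
  (forall t a, F (dgm_act t a) = dgm_act (F t) a) ->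
  forall t, F t = gmap (fun al => F (gA al)) (F gI) (fun j => F (gJ j)) t.
Proof.
move=> Fl Fa t; rewrite {1}[t](basis_decomp G) /gmap !(linD Fl) !(lin_sum Fl) Fa.
by congr (_ + _ + _); apply: eq_bigr => al _; rewrite Fa.
Qed.

Lemma gA_d al : dgm_d (gA al) = 0.
Proof.
rewrite [LHS](basis_decomp G) cI_d cI_gA (lin0 d_lin) oppr0 act0 addr0.
rewrite !big1 ?addr0 // => [j _|be _]; first by rewrite cJ_d cJ_gA (lin0 d_lin) act0.
rewrite cA_d cA_gA cI_gA gmul0r addr0.
by case: eqP => _; rewrite ?mt_d_e ?(lin0 d_lin) act0.
Qed.
Lemma gJ_d j : dgm_d (gJ j) = 0.
Proof.
rewrite [LHS](basis_decomp G) cI_d cI_gJ (lin0 d_lin) oppr0 act0 addr0.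
rewrite !big1 ?addr0 // => [l _|be _].
  by rewrite cJ_d cJ_gJ; case: eqP => _; rewrite ?mt_d_e ?(lin0 d_lin) act0.
by rewrite cA_d cA_gJ cI_gJ gmul0r addr0 (lin0 d_lin) act0.
Qed.
Lemma gI_d : dgm_d gI = \sum_al dgm_act (gA al) (xA (val al)).
Proof.
rewrite [LHS](basis_decomp G) cI_d cI_gI mt_d_e oppr0 act0 addr0.
rewrite [X in _ + X]big1 ?addr0 // => [|j _]; last by rewrite cJ_d cJ_gI (lin0 d_lin) act0.
apply: eq_bigr => al _; rewrite cA_d cA_gI cI_gI (lin0 d_lin) add0r.
by have := pa_xe A (val al); rewrite src_val => ->.
Qed.
Lemma gA_e al : dgm_act (gA al) (eA (tgt (val al))) = gA al.
Proof. by have := gmap_eq (F := id) (@linear_id _ T) (fun _ _ => erefl) (gA al); rewrite gmap_gA. Qed.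
Lemma gI_e : dgm_act gI (eA i) = gI.
Proof. by have := gmap_eq (F := id) (@linear_id _ T) (fun _ _ => erefl) gI; rewrite gmap_gI. Qed.
Lemma gJ_e j : dgm_act (gJ j) (eA (val j)) = gJ j.
Proof. by have := gmap_eq (F := id) (@linear_id _ T) (fun _ _ => erefl) (gJ j); rewrite gmap_gJ. Qed.

(** In these coordinates the differential of Hom(T, X) is triangular: only the entry at [gI]
    involves other generators, through the boundary of [gI]. *)
Lemma gmap_diff (X : dgModule L) p (w : mutA -> X) (wi : X) (wj : J -> X) t :
  (forall al, dgm_hom p (w al)) -> dgm_hom (p + 1) wi -> (forall j, dgm_hom p (wj j)) ->
  dgm_d (gmap w wi wj t) - (-1) ^ p *: gmap w wi wj (dgm_d t)
  = gmap (fun al => dgm_d (w al)) (dgm_d wi - (-1) ^ p *: \sum_al dgm_act (w al) (xA (val al)))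
      (fun j => dgm_d (wj j)) t.
Proof.
move=> h1 h2 h3; rewrite gmap_d /gmap.
have dl := @dgm_d_linear _ _ X.
rewrite !(linD dl) !(lin_sum dl) (dgm_leibniz _ h2) (linB (dgm_linl _)) (linZ (dgm_linl _)).
rewrite (lin_sum (dgm_linl _)) signzD expr1z mulrN1 scaleNr.
under eq_bigr do rewrite (dgm_leibniz _ (h1 _)).
under [X in _ + _ + X - _]eq_bigr do rewrite (dgm_leibniz _ (h3 _)).
rewrite !big_split /= !scalerDr scalerN !scaler_sumr.
under [X in _ = _ + (_ - X) + _]eq_bigr do rewrite -(@dgm_actM _ _ X).
exact: addr_cancel.
Qed.

End SiltingGenerators.

(** * The contracting homotopy and the projection to the silting complex *)

Section ContractingHomotopy.
Variables (k : fieldType) (n : nat) (Q : lf_quiver n) (i : 'I_n) (S : mut_data k Q i).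
Local Notation mutA := (mutA Q i).
Local Notation A := (mt_A S).
Local Notation B := (mt_B S).
Local Notation rd := (@mt_rd _ _ _ _ S).
Local Notation e := (@pa_e _ _ _ B).
Local Notation eA := (@pa_e _ _ _ A).
Local Notation xA := (@pa_x _ _ _ A).
Local Notation m := (mar B).
Local Notation raw := (rawY B).
Local Notation act := (@ract _ _ _ _ A B).
Implicit Types (y z : raw) (al be : mutA).

Local Notation act_lin := (@ract_lin _ _ _ _ A B).
Local Notation L := (mt_dga S).
Local Notation J := {j : 'I_n | j != i}.
Variables (T : dgModule L) (G : silting_basis T).
Local Notation gA := (sb_gA G).
Local Notation gI := (sb_gI G).
Local Notation gJ := (sb_gJ G).

(** A mere pair, without differential: the first entry is the value of the homotopy in Y, the second
    that of the projection to T. Both maps are kQ-linear and branch at the same arrows, so one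
    recursion defines them. *)
Definition cone : lmodType k := (raw * T)%type.
Implicit Types (t : cone).
Definition cone_act t (x : A) : cone := (act t.1 x, dgm_act t.2 (x : L)).

Lemma cone_act_linl x : linear (cone_act^~ x).
Proof.
apply: linear_pair.
  exact: linear_compose (act_linl x) (@linear_fst _ _ _).
exact: linear_compose (dgm_linl (x : L)) (@linear_snd _ _ _).
Qed.
Lemma cone_act_linr t : linear (cone_act t).
Proof. by apply: linear_pair; [apply: act_lin | exact: (@dgm_linr _ _ T t.2)]. Qed.
Lemma cone_actM t x x' : cone_act t (x ** x') = cone_act (cone_act t x) x'.
Proof. by rewrite /cone_act actM (@dgm_actM _ _ T t.2). Qed.
Lemma cone_act0 x : cone_act 0 x = 0.
Proof. exact: lin0 (cone_act_linl x). Qed.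

Definition gen (v : 'I_n) : T := if insub v is Some j then gJ j else gI.
Lemma gen_i : gen i = gI.
Proof. by rewrite /gen insubF // eqxx. Qed.
Lemma gen_j (j : J) : gen (val j) = gJ j.
Proof. by rewrite /gen valK. Qed.
Lemma gen_cases (P : 'I_n -> Prop) : P i -> (forall j : J, P (val j)) -> forall v, P v.
Proof.
move=> Pi Pj v; have [->//|vi] := eqVneq v i.
exact: (Pj (exist _ v vi)).
Qed.
Lemma gen_e v : dgm_act (gen v) (eA v : L) = gen v.
Proof. by move: v; apply: gen_cases => [|j]; rewrite ?gen_i ?gI_e // gen_j gJ_e. Qed.
Lemma gen_hom v : dgm_hom (chi i v) (gen v).
Proof.
move: v; apply: gen_cases => [|j]; first by rewrite gen_i chi_i; apply: gI_hom.
by rewrite gen_j chi_ni ?(valP j) //; apply: gJ_hom.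
Qed.
Lemma gen_e_if v w : cone_act (0, gen v) (eA w) = if v == w then (0, gen v) else 0.
Proof.
rewrite /cone_act /= (lin0 (act_linl _)).
have := @dgm_actM _ _ T (gen v) (eA v) (eA w); rewrite (pa_ee A) gen_e => <-.
by case: eqP => _; rewrite ?gen_e // act0.
Qed.
Lemma gA_e_if al w : cone_act (0, gA al) (eA w) = if tgt (val al) == w then (0, gA al) else 0.
Proof.
rewrite /cone_act /= (lin0 (act_linl _)).
have := @dgm_actM _ _ T (gA al) (eA (tgt (val al))) (eA w); rewrite (pa_ee A) gA_e => <-.
by case: eqP => _; rewrite ?gA_e // act0.
Qed.

(** Only gamma^* triggers the homotopy. Where q is trivial at i there is no arrow to divide by
    gamma; there gamma^* is the image of [gA ga] under the inclusion of T, whence the second entry.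
    The value 0 on arrows carrying beta^-1 on their right yields kQ-linearity, as q . phi and q phi
    differ by terms (q phi beta^-1) beta. *)
Definition hstep (c : mcode Q i) (q : B) (t : cone) : cone :=
  match c with
  | MOld phi => cone_act t (xA phi)
  | MStar ga => ((rd (sgn q) ga, 0), triv_coeff i q *: gA ga)
  | MLeft al phi => cone_act t (xA (val al) ** xA phi)
  | _ => 0
  end.

Lemma hstep_linear c : linear (fun p : (B * cone)%type => hstep c p.1 p.2).
Proof.
case: c => [phi|ga|al phi|phi be|al phi be] /=; try exact: linear_const0.
- exact: linear_compose (cone_act_linl _) (@linear_snd _ _ _).
- apply: linear_pair; first apply: linear_pair.
  + apply: linear_compose (@mt_rd_lin _ _ _ _ S ga) _.
    exact: linear_compose (@sgn_lin _ B) (@linear_fst _ _ _).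
  + exact: linear_const0.
  apply: linear_scalel; exact: linear_compose (@triv_coeff_lin _ _ _ B i) (@linear_fst _ _ _).
exact: linear_compose (cone_act_linl _) (@linear_snd _ _ _).
Qed.

Lemma h1_exists : exists f : B -> cone, [/\ linear f, forall v, f (e v) = (0, gen v) &
  forall c q, mvalid c -> q ** e (mtgt c) = q -> f (q ** m c) = hstep c q (f q)].
Proof. exact: mut_ext hstep_linear. Qed.

Definition hcone1 : B -> cone := sval (cid h1_exists).
Local Notation h1 := hcone1.
Lemma hcone1_lin : linear h1. Proof. by rewrite /hcone1; case: cid => f /= []. Qed.
Local Notation h1_lin := hcone1_lin.
Lemma h1_e v : h1 (e v) = (0, gen v). Proof. by rewrite /hcone1; case: cid => f /= []. Qed.
Lemma h1_x_ c q : mvalid c -> q ** e (mtgt c) = q -> h1 (q ** m c) = hstep c q (h1 q).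
Proof. by rewrite /hcone1; case: cid => f /= [_ _]; apply. Qed.

Lemma xA_e_if a w : xA a ** eA w = if src a == w then xA a else 0.
Proof. exact: pa_xe_if. Qed.

Lemma hstep_e c q t w : cone_act (hstep c q t) (eA w) = if msrc c == w then hstep c q t else 0.
Proof.
case: c => [phi|ga|al phi|phi be|al phi be]; rewrite /hstep ?cone_act0 ?if_same //=.
- by rewrite -cone_actM xA_e_if; case: eqP => _ //; apply: lin0 (cone_act_linr t).
- rewrite -[(_, _)]/(((rd (sgn q) ga, 0), triv_coeff i q *: gA ga) : cone).
  have -> : ((rd (sgn q) ga, 0), triv_coeff i q *: gA ga) =
     ((rd (sgn q) ga, 0) : raw, 0) + triv_coeff i q *: (0, gA ga) :> cone.
    by congr (_, _); rewrite /= ?scaler0 ?addr0 ?add0r.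
  rewrite (linD (cone_act_linl _)) (linZ (cone_act_linl _)) gA_e_if.
  have -> : cone_act ((rd (sgn q) ga, 0) : raw, 0) (eA w) =
     if tgt (val ga) == w then ((rd (sgn q) ga, 0) : raw, 0) else 0.
    rewrite /cone_act /= act_e (lin0 (dgm_linl _)).
    have -> : act_triv w ((rd (sgn q) ga, 0) : raw) = if tgt (val ga) == w then (rd (sgn q) ga, 0) else 0.
      rewrite -rd_mulr; apply: raw_ext => [|al] /=.
        by rewrite -ga_mulA pa_ee; case: eqP; rewrite // gmul0r.
      by rewrite !ffunE gmul0l if_same; case: eqP => _ /=; rewrite ffunE.
    by case: eqP.
  by case: eqP => _ //; rewrite scaler0 addr0.
by rewrite -cone_actM -ga_mulA xA_e_if; case: eqP => _ //; rewrite gmul0r; apply: lin0 (cone_act_linr t).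
Qed.

Lemma h1_er q v : h1 (q ** e v) = cone_act (h1 q) (eA v).
Proof.
move: q; apply: mut_lin_eq => [||w|c q cv qc _].
- exact: linear_compose h1_lin (@ga_linl _ B _).
- exact: linear_compose (cone_act_linl _) h1_lin.
- by rewrite pa_ee h1_e gen_e_if; case: eqP => _; rewrite ?h1_e // (lin0 h1_lin).
rewrite -ga_mulA mar_e h1_x_ // hstep_e; case: eqP => _; first exact: h1_x_.
by rewrite gmul0r (lin0 h1_lin).
Qed.

Lemma rd_ei (u : B) al : rd (u ** e i) al = rd u al.
Proof.
rewrite [u in RHS]pa_mul_e (lin_sum (@mt_rd_lin _ _ _ _ S al)) (bigD1 i) //= big1 ?addr0 // => v.
exact: rd_src.
Qed.

Lemma h1_x c q : mvalid c -> h1 (q ** m c) = hstep c q (h1 q).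
Proof.
move=> cv; rewrite -[in LHS]mar_tgt ga_mulA h1_x_ // -?ga_mulA ?pa_eev // h1_er.
case: c cv => [phi|ga|al phi|phi be|al phi be] //= cv.
- by rewrite -cone_actM pa_ex.
- by rewrite sgnM sgn_e rd_ei triv_coeff_er eqxx.
by rewrite -cone_actM ga_mulA pa_ex.
Qed.

Lemma h1_old q phi : ~~ inA i phi -> h1 (q ** m (MOld i phi)) = cone_act (h1 q) (xA phi).
Proof. by move=> h; rewrite h1_x. Qed.
Lemma h1_left q al phi : h1 (q ** m (MLeft al phi)) = cone_act (h1 q) (xA (val al) ** xA phi).
Proof.
have [ti|ti] := eqVneq (tgt phi) i; first by rewrite h1_x //=; apply/eqP.
rewrite left_invalid // gmul0r (lin0 h1_lin) -(pa_xe A (val al)) -ga_mulA pa_ex_if.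
by rewrite src_val eq_sym (negbTE ti) gmul0r (lin0 (cone_act_linr _)).
Qed.
Lemma h1_right q phi be : h1 (q ** m (MRight phi be)) = 0.
Proof.
have [cv|cv] := boolP (mvalid (MRight phi be)); first by rewrite h1_x.
by rewrite mar_invalid // gmul0r (lin0 h1_lin).
Qed.
Lemma h1_both q al phi be : h1 (q ** m (MBoth al phi be)) = 0.
Proof.
have [cv|cv] := boolP (mvalid (MBoth al phi be)); first by rewrite h1_x.
by rewrite mar_invalid // gmul0r (lin0 h1_lin).
Qed.
Lemma h1_star q ga : h1 (q ** m (MStar ga)) = ((rd (sgn q) ga, 0), triv_coeff i q *: gA ga).
Proof. by rewrite h1_x. Qed.

Definition hcone y : cone := h1 y.1 + \sum_al cone_act (h1 (y.2 al)) (xA (val al)).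

Local Notation hmap := hcone.

Lemma hcone_lin : linear hmap.
Proof.
apply: linear_add.
  exact: linear_compose h1_lin (@raw_fst_linear _ _ _ _ B).
apply: linear_bigsum => al; apply: linear_compose (cone_act_linl _) _.
exact: linear_compose h1_lin (raw_snd_linear al).
Qed.

Local Notation hmap_lin := hcone_lin.
Lemma hmap_fst b : hmap (b, 0) = h1 b.
Proof.
rewrite /hcone /= big1 ?addr0 // => al _.
by rewrite ffunE (lin0 h1_lin) cone_act0.
Qed.

Lemma hmap_arrow phi y : hmap (act_arrow phi y) = cone_act (hmap y) (xA phi).
Proof.
rewrite /hcone (linD (cone_act_linl _)) (lin_sum (cone_act_linl _)) /= (linD h1_lin) (lin_sum h1_lin).
rewrite (eq_bigr (fun al => cone_act (cone_act (h1 (y.2 al)) (xA (val al))) (xA phi))); last first.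
  by move=> al _; rewrite h1_left cone_actM.
have E be : h1 ([ffun be => (if phi == val be then y.1 ** e (tgt (val be)) else 0)
      - (y.1 ** m (MRight phi be) + \sum_al y.2 al ** m (MBoth al phi be))] be)
    = if phi == val be then cone_act (h1 y.1) (eA (tgt (val be))) else 0.
  rewrite ffunE (linB h1_lin) (linD h1_lin) (lin_sum h1_lin) h1_right.
  rewrite big1 ?addr0 => [|al _]; last exact: h1_both.
  by rewrite subr0; case: eqP => _; rewrite ?h1_er // (lin0 h1_lin).
rewrite [X in _ + X = _](eq_bigr (fun be => cone_act (if phi == val be then cone_act (h1 y.1) (eA (tgt (val be))) else 0)
   (xA (val be)))); last by move=> be _; congr cone_act; exact: E.
rewrite addrAC; congr (_ + _).
have [/inAP[al ->]|pA] := boolP (inA i phi).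
  rewrite old_A gmul0r (lin0 h1_lin) add0r (bigD1 al) //= eqxx -cone_actM pa_ex.
  rewrite big1 ?addr0 // => be /negbTE bal.
  by rewrite (inj_eq val_inj) eq_sym bal cone_act0.
rewrite h1_old // big1 ?addr0 // => be _.
by case: eqP => [pb|_]; [rewrite pb inA_val in pA | rewrite cone_act0].
Qed.

Lemma hmap_triv v y : isY y -> hmap (act_triv v y) = cone_act (hmap y) (eA v).
Proof.
move=> hy; rewrite /hcone (linD (cone_act_linl _)) (lin_sum (cone_act_linl _)) /= h1_er.
congr (_ + _); apply: eq_bigr => al _; rewrite ffunE -cone_actM xA_e_if src_val eq_sym.
case: eqP => _; first by rewrite hy.
by rewrite (lin0 h1_lin) cone_act0 (lin0 (cone_act_linr _)).
Qed.

Lemma hmap_act y x : isY y -> hmap (act y x) = cone_act (hmap y) x.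
Proof.
move=> hy; move: x; apply: pa_lin_eq => [||v|a q _ h].
- exact: linear_compose hmap_lin (act_lin y).
- exact: cone_act_linr.
- by rewrite act_e hmap_triv.
- by rewrite act_x hmap_arrow h cone_actM.
Qed.

Lemma isY_fst (u : B) : isY ((u, 0) : raw).
Proof. by move=> al; rewrite /= ffunE gmul0l. Qed.

Lemma isY_h1 u : isY (h1 u).1.
Proof.
move: u; apply: mut_lin_ind => [|b x y hx hy|v|c q cv _ h].
- by rewrite (lin0 h1_lin); apply: isY0.
- by rewrite h1_lin; apply: isYP.
- by rewrite h1_e; apply: isY0.
rewrite h1_x //; case: c cv => [phi|ga|al phi|phi be|al phi be] cv /=; try exact: isY0.
- exact: isY_act.
- exact: isY_act.
Qed.
Lemma isY_hmap y : isY (hmap y).1.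
Proof.
rewrite /hcone /=; rewrite -[(h1 y.1).1]scale1r; apply: isYP; first exact: isY_h1.
rewrite (lin_sum (@linear_fst _ _ _)); apply: isY_sum => al _; exact: isY_act.
Qed.

Lemma h1_rd u al : h1 (rd u al) = 0.
Proof.
move: u; apply: (mut_lin_eq (g := fun=> 0)) => [||v|c q cv _ _].
- exact: linear_compose h1_lin (@mt_rd_lin _ _ _ _ S al).
- exact: linear_const0.
- by rewrite mt_rd_e (lin0 h1_lin).
rewrite rd_xx; case: c cv => [phi|be|be phi|phi be|be phi ga] cv /=;
  by rewrite ?h1_right ?h1_both // gmul0r (lin0 h1_lin).
Qed.

(** The homotopy takes its values in the kQ-span of elements divided by some gamma. The homotopy and
    the projection both kill these elements and are kQ-linear. *)
Lemma hmap_h1 u : hmap (h1 u).1 = 0.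
Proof.
have fl : linear (fun u => hmap (h1 u).1).
  by apply: linear_compose hmap_lin _; exact: linear_compose (@linear_fst _ _ _) h1_lin.
move: u; apply: (mut_lin_eq (g := fun=> 0)) => [||v|c q cv _ h] //.
- exact: linear_const0.
- by rewrite h1_e (lin0 hmap_lin).
rewrite h1_x //; case: c cv => [phi|ga|al phi|phi be|al phi be] cv /=; try exact: (lin0 hmap_lin).
- by rewrite hmap_act ?h ?cone_act0 //; apply: isY_h1.
- by rewrite hmap_fst h1_rd.
- by rewrite hmap_act ?h ?cone_act0 //; apply: isY_h1.
Qed.

Lemma hmap_hmap y : hmap (hmap y).1 = 0.
Proof.
rewrite {2}/hcone /= (linD hmap_lin) hmap_h1 add0r (lin_sum (@linear_fst _ _ _)) (lin_sum hmap_lin).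
by rewrite big1 // => al _; rewrite hmap_act ?hmap_h1 ?cone_act0 //; apply: isY_h1.
Qed.

End ContractingHomotopy.

(** * The inclusion of the silting complex into Y *)

Section HomotopyOnY.
Variables (k : fieldType) (n : nat) (Q : lf_quiver n) (i : 'I_n) (S : mut_data k Q i).
Local Notation mutA := (mutA Q i).
Local Notation A := (mt_A S).
Local Notation B := (mt_B S).
Local Notation e := (@pa_e _ _ _ B).
Local Notation xA := (@pa_x _ _ _ A).
Local Notation m := (mar B).
Local Notation raw := (rawY B).
Local Notation act := (@ract _ _ _ _ A B).
Implicit Types (y z : raw) (al be : mutA).

Local Notation yA := (@gen_Y _ _ _ _ S).
Local Notation dM_lin := (@mt_dM_lin _ _ _ _ S).
Local Notation L := (mt_dga S).
Local Notation J := {j : 'I_n | j != i}.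
Variables (T : dgModule L) (G : silting_basis T).
Local Notation cA := (sb_cA G).
Local Notation cJ := (sb_cJ G).
Local Notation gA := (sb_gA G).
Local Notation gJ := (sb_gJ G).
Local Notation h1 := (hcone1 G).
Local Notation hmap := (hcone G).
Local Notation h1_lin := (hcone1_lin G).
Local Notation hmap_lin := (hcone_lin G).

Local Notation Ydg := (Ydg S).
Implicit Types (t : T) (w : Ydg).

Lemma h1_hom p u : ga_hom p u -> forall v,
  homY (p + chi i v + 1) (h1 (u ** e v)).1 /\ dgm_hom (p + chi i v) (h1 (u ** e v)).2.
Proof.
move: p u; apply: mut_hom_ind => [p v|p c x y hx hy v|v w|p c q cv hq qc h v].
- by rewrite gmul0l (lin0 h1_lin); split; [apply: homY0 | apply: grading0 (dgm_grading T) _].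
- rewrite gmulDl gmulZl h1_lin; have [a1 a2] := hx v; have [b1 b2] := hy v.
  by split; [apply: homYP | apply: (gradingP (dgm_grading T))].
- rewrite pa_ee; case: eqP => [<-|_]; last first.
    by rewrite (lin0 h1_lin); split; [apply: homY0 | apply: grading0 (dgm_grading T) _].
  by rewrite h1_e add0r; split; [apply: homY0 | apply: gen_hom].
rewrite -ga_mulA mar_e; case: eqP => [<-|_]; last first.
  by rewrite gmul0r (lin0 h1_lin); split; [apply: homY0 | apply: grading0 (dgm_grading T) _].
rewrite h1_x //; have [] := h (mtgt c); rewrite qc => a1 a2.
case: c cv hq qc a1 a2 {h} => [phi|ga|al phi|phi be|al phi be] cv hq qc a1 a2 /=;
  try by split; [apply: homY0 | apply: grading0 (dgm_grading T) _].
- have a3 := @homY_act _ _ _ _ A B (mt_noloop S) _ _ _ _ a1 (pa_hom_x A phi).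
  have a4 := @dgm_homM _ _ T _ _ _ _ a2 (pa_hom_x A phi : @ga_hom _ L _ _).
  split.
    by move: a3; rewrite (_ : _ + deg phi = p + mdeg_old i phi + chi i (src phi) + 1) //= /mdeg_old; ring.
  by move: a4; rewrite (_ : _ + deg phi = p + mdeg_old i phi + chi i (src phi)) //= /mdeg_old; ring.
- rewrite chi_ni ?(mt_noloop S) // !addr0; split.
    split=> [v'|al] /=; last by rewrite ffunE; apply: hom0.
    rewrite -rd_mulr -ga_mulA pa_ee; case: eqP => [<-|_]; last by rewrite gmul0r; apply: hom0.
    by rewrite rd_mulr chi_ni ?(mt_noloop S) // subr0; apply/rd_hom/hom_sgn.
  have [->|p0] := eqVneq p 0; last first.
    by rewrite (triv_coeff_hom i hq p0) scale0r; apply: grading0 (dgm_grading T) _.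
  by apply: (gradingZ (dgm_grading T)); apply: gA_hom.
have hx := ga_homM (pa_hom_x A (val al)) (pa_hom_x A phi); rewrite deg_val add0r in hx.
have a3 := @homY_act _ _ _ _ A B (mt_noloop S) _ _ _ _ a1 hx.
have a4 := @dgm_homM _ _ T _ _ _ _ a2 (hx : @ga_hom _ L _ _).
rewrite /= chi_ni ?(mt_noloop S) // addr0 in a3 a4.
split.
  by move: a3; rewrite (_ : _ + deg phi = p + (mdeg_old i phi - 1) + chi i (src phi) + 1) //= /mdeg_old (eqP cv) chi_i; ring.
by move: a4; rewrite (_ : _ + deg phi = p + (mdeg_old i phi - 1) + chi i (src phi)) //= /mdeg_old (eqP cv) chi_i; ring.
Qed.

Lemma homYD p y z : homY p y -> homY p z -> homY p (y + z).
Proof. by move=> hy hz; rewrite -[y]scale1r; apply: homYP. Qed.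

Lemma hmap_hom p y : isY y -> homY p y -> homY (p + 1) (hmap y).1 /\ dgm_hom p (hmap y).2.
Proof.
move=> iy [yh1 yh2].
have a v : homY (p + 1) (h1 (y.1 ** e v)).1 /\ dgm_hom p (h1 (y.1 ** e v)).2.
  have := h1_hom (yh1 v) v; rewrite -ga_mulA pa_eev (_ : p - chi i v + chi i v = p) //.
  by ring.
have b al : homY (p + 1) (cone_act (h1 (y.2 al)) (xA (val al))).1 /\
   dgm_hom p (cone_act (h1 (y.2 al)) (xA (val al))).2.
  have [] := h1_hom (yh2 al) (tgt (val al)); rewrite iy chi_ni ?(mt_noloop S) // addr0 => b1 b2.
  have := @homY_act _ _ _ _ A B (mt_noloop S) _ _ _ _ b1 (pa_hom_x A (val al)).
  have := @dgm_homM _ _ T _ _ _ _ b2 (pa_hom_x A (val al) : @ga_hom _ L _ _).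
  by rewrite deg_val !addr0.
rewrite /hcone [y.1]pa_mul_e (lin_sum h1_lin) /=.
rewrite !(lin_sum (@linear_fst _ raw T)) !(lin_sum (@linear_snd _ raw T)); split.
  apply: homYD; apply: big_ind; try exact: homY0; try exact: homYD; first by move=> v _; case: (a v).
  by move=> al _; case: (b al).
apply: dgm_homD; apply: dgm_hom_sum => j; [by case: (a j)|by case: (b j)].
Qed.

Definition Y_fst (u : B) : Ydg := to_subspace _ (isY_fst u).
Local Notation Yfst := Y_fst.
Definition siota : T -> Ydg :=
  gmap G (fun al => Yfst (m (MStar al))) (Yfst (e i)) (fun j => Yfst (e (val j))).
Local Notation iota := siota.

Lemma Yfst_star_hom al : dgm_hom 0 (Yfst (m (MStar al))).
Proof.
split=> [v|be] /=; last by rewrite ffunE; apply: hom0.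
rewrite mar_e; case: eqP => [<-|_]; last exact: hom0.
by rewrite /= chi_ni ?(mt_noloop S) // subr0; exact: (mar_hom B (MStar al)).
Qed.
Lemma Yfst_e_hom v : dgm_hom (chi i v) (Yfst (e v)).
Proof.
split=> [w|be] /=; last by rewrite ffunE; apply: hom0.
rewrite pa_ee; case: eqP => [<-|_]; last exact: hom0.
by rewrite subrr; apply: pa_hom_e.
Qed.

Lemma iota_hom : dgm_hom_of_degree 0 iota.
Proof.
apply: gmap_hom => [al||j]; first exact: Yfst_star_hom.
  by have := Yfst_e_hom i; rewrite chi_i.
by have := Yfst_e_hom (val j); rewrite chi_ni ?(valP j).
Qed.

Lemma iota_d t : iota (dgm_d t) = dgm_d (iota t).
Proof.
have s1 al : dgm_d (Yfst (m (MStar al))) = 0.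
  apply: val_inj; apply: raw_ext => [|be] /=; first exact: dM_star.
  rewrite !ffunE (lin0 dM_lin) add0r sgn_mar scale1r.
  by rewrite -[m (MStar be)]mar_tgt ga_mulA mar_e /= (negbTE (mt_noloop S al)) gmul0l.
have sj (j : J) : dgm_d (Yfst (e (val j))) = 0.
  apply: val_inj; apply: raw_ext => [|be] /=; first exact: mt_dM_e.
  by rewrite !ffunE (lin0 dM_lin) add0r sgn_e e_mar /= (negbTE (valP j)).
(* This is the counterpart in Y of [gI_d]. *)
have si : dgm_d (Yfst (e i)) = \sum_al dgm_act (Yfst (m (MStar al))) (xA (val al) : L).
  apply: val_inj; rewrite raddf_sum /=.
  have E al : act (m (MStar al), 0) (xA (val al)) = lmul (m (MStar al)) (yA al).
    rewrite -act_y1_A -act_lmul; congr act.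
    by apply: raw_ext => [|be] /=; rewrite ?ga_mul1r // !ffunE gmul0r.
  rewrite (eq_bigr _ (fun al _ => E al)); apply: raw_ext => [|be].
    rewrite (lin_sum (@raw_fst_linear _ _ _ _ B)) big1 /= ?mt_dM_e // => al _.
    by rewrite gmul0r.
  rewrite (lin_sum (raw_snd_linear be)) /= !ffunE (lin0 dM_lin) add0r sgn_e e_mar eqxx.
  rewrite (bigD1 be) //= !ffunE eqxx mar_e eqxx big1 ?addr0 // => al.
  by rewrite !ffunE eq_sym => /negbTE->; rewrite gmul0r.
apply/eqP; rewrite eq_sym -subr_eq0 -[iota (dgm_d t)]scale1r.
have h2 : dgm_hom (0 + 1) (Yfst (e i)) by have := Yfst_e_hom i; rewrite chi_i.
have hj (j : J) : dgm_hom 0 (Yfst (e (val j))).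
  by have := Yfst_e_hom (val j); rewrite chi_ni ?(valP j).
have := gmap_diff G t Yfst_star_hom h2 hj; rewrite expr0z => ->.
rewrite /gmap si scale1r subrr (lin0 (dgm_linl _)) addr0.
by rewrite !big1 ?addr0 // => [j _|al _]; rewrite ?s1 ?sj (lin0 (dgm_linl _)).
Qed.

Lemma hmap_iota t : hmap (val (iota t)) = (0, t).
Proof.
have hs al : hmap (m (MStar al), 0) = (0, gA al).
  rewrite hmap_fst -[m _]mar_tgt h1_star sgn_e mt_rd_e triv_coeff_e eqxx scale1r.
  by congr (_, _); apply: raw_ext.
rewrite [t in RHS](basis_decomp G) /siota /gmap !raddfD !raddf_sum /=.
rewrite !(linD hmap_lin) !(lin_sum hmap_lin).
rewrite (eq_bigr (fun al => cone_act (0, gA al) (cA t al))); last first.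
  by move=> al _; rewrite hmap_act ?hs //; apply: isY_fst.
rewrite [X in _ + _ + X = _](eq_bigr (fun j => cone_act (0, gJ j) (cJ t j))); last first.
  by move=> j _; rewrite hmap_act ?hmap_fst ?h1_e ?gen_j //; apply: isY_fst.
rewrite hmap_act ?hmap_fst ?h1_e ?gen_i; last exact: isY_fst.
have E (u : T) (x : A) : cone_act (0, u) x = (0, dgm_act u (x : L)).
  by rewrite /cone_act /= (lin0 (act_linl _)).
rewrite E; congr (_, _) => /=.
  rewrite !(lin_sum (@linear_fst _ raw T)) !big1 ?addr0 //= => j _; exact: lin0 (act_linl _).
by rewrite !(lin_sum (@linear_snd _ raw T)).
Qed.

End HomotopyOnY.

(** * Local nilpotency of the error of the homotopy *)

Section LocalNilpotency.
Variables (k : fieldType) (n : nat) (Q : lf_quiver n) (i : 'I_n) (S : mut_data k Q i).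
Local Notation mutA := (mutA Q i).
Local Notation A := (mt_A S).
Local Notation B := (mt_B S).
Local Notation d := (@mt_d _ _ _ _ S).
Local Notation quo := (@mt_quo _ _ _ _ S).
Local Notation lm := (@mt_lm _ _ _ _ S).
Local Notation rd := (@mt_rd _ _ _ _ S).
Local Notation dM := (@mt_dM _ _ _ _ S).
Local Notation e := (@pa_e _ _ _ B).
Local Notation eA := (@pa_e _ _ _ A).
Local Notation xA := (@pa_x _ _ _ A).
Local Notation m := (mar B).
Local Notation raw := (rawY B).
Local Notation act := (@ract _ _ _ _ A B).
Local Notation dec := (@dec_act _ _ _ _ A B).
Local Notation md := (diff_arrow d quo lm rd).
Implicit Types (y z : raw) (al be : mutA).

Local Notation y1 := (one_Y S).
Local Notation yA := (@gen_Y _ _ _ _ S).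
Local Notation dM_lin := (@mt_dM_lin _ _ _ _ S).
Local Notation Draw_lin := (@Draw_linear _ _ _ _ S).
Local Notation dec_lin := (@dec_act_linear _ _ _ _ S).
Local Notation L := (mt_dga S).
Local Notation J := {j : 'I_n | j != i}.
Variables (T : dgModule L) (G : silting_basis T).
Local Notation gA := (sb_gA G).
Local Notation h1 := (hcone1 G).
Local Notation hmap := (hcone G).
Local Notation h1_lin := (hcone1_lin G).
Local Notation hmap_lin := (hcone_lin G).
Local Notation Ydg := (Ydg S).
Local Notation iota := (siota G).
Local Notation Yfst := (@Y_fst _ _ _ _ S).
Implicit Types (t : T) (w : Ydg).

Lemma rd_mul (x y : B) al : rd (x ** y) al = x ** rd y al + triv_coeff i y *: rd x al.
Proof.
have rl := @mt_rd_lin _ _ _ _ S al.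
move: y; apply: mut_lin_eq => [||v|c q _ _ _].
- exact: linear_compose rl (@ga_linr _ B _).
- apply: linear_add; first exact: linear_compose (@ga_linr _ B _) rl.
  exact/linear_scalel/triv_coeff_lin.
- rewrite mt_rd_e gmul0r add0r triv_coeff_e eq_sym.
  have [->|vi] := eqVneq v i; first by rewrite scale1r rd_ei.
  by rewrite scale0r rd_src.
by rewrite triv_coeff_mar scale0r addr0 ga_mulA !rd_xx ga_mulA.
Qed.

(* An option encodes a left factor alpha that may be absent; remainder is the
   element of kQ whose decoration is the last term in the differential of
   phi gamma^-1 resp. alpha phi gamma^-1. *)
Definition ldeco (l : option mutA) (phi : Q) : mcode Q i :=
  if l is Some al then MLeft al phi else MOld i phi.
Definition lrdeco (l : option mutA) (phi : Q) (ga : mutA) : mcode Q i :=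
  if l is Some al then MBoth al phi ga else MRight phi ga.
Definition remainder (l : option mutA) (phi : Q) (ga : mutA) : A :=
  if l is Some al then xA (val al) ** quo (d (xA phi)) ga
  else (-1) ^ chi i (tgt phi) *: quo (d (xA phi)) ga.

Lemma rdiv_ldeco l phi ga : rdiv_arrow B (ldeco l phi) ga = m (lrdeco l phi ga).
Proof. by case: l. Qed.
Lemma ldeco_valid l phi ga : mvalid (lrdeco l phi ga) -> mvalid (ldeco l phi).
Proof. by case: l => [al|] /= /andP[]. Qed.
Lemma ldeco_src l phi ga : mvalid (lrdeco l phi ga) -> src phi = i.
Proof. by case: l => [al|] /= /andP[] => [/eqP|_ /eqP]. Qed.
Lemma remainder_src l phi ga : remainder l phi ga ** eA (tgt (val ga)) = remainder l phi ga.
Proof. by case: l => [al|]; rewrite /= ?gmulZl -?ga_mulA quo_er. Qed.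

Lemma dM_lrdeco l phi ga : mvalid (lrdeco l phi ga) ->
  dM (m (lrdeco l phi ga)) = rd (md (ldeco l phi)) ga
    + (-1) ^ mdeg (ldeco l phi) *: (m (ldeco l phi) ** m (MStar ga)) - dec (remainder l phi ga).
Proof.
move=> cv; rewrite mt_dM_x //; case: l cv => [al|] /= cv; last by rewrite (linZ dec_lin).
case/andP: cv => _ /eqP ti; rewrite lm_dec ?act_yA //.
by rewrite -quo_el -{2}d_x_tgt ti.
Qed.

(** By [rd_mul] a trivial summand here would let gamma^-1 reach the path to the left of this
    differential. *)
Lemma triv_coeff_md (ga : mutA) l phi : src phi = i -> triv_coeff i (md (ldeco l phi)) = 0.
Proof.
have tl := @triv_coeff_lin _ _ _ B i.
have te : triv_coeff i (d (xA phi)) = (if i == tgt phi then triv_coeff i (d (xA phi)) else 0).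
  by rewrite -[in LHS]d_x_tgt triv_coeff_el.
move=> si; case: l => [al|] /=.
  rewrite /diff_left triv_coeff_dec -(pa_ex A) -ga_mulA triv_coeff_el.
  by rewrite eq_sym (negbTE (mt_noloop S al)).
rewrite /diff_old (linD tl) (linZ tl) (lin_sum tl) triv_coeff_dec te.
rewrite big1 ?add0r => [|al _]; last by rewrite triv_coeff_mar.
by case: eqP => [/esym ti|_]; rewrite ?(mt_notriv S ga) // scaler0.
Qed.

Definition Y_htpy w : Ydg := to_subspace _ (isY_hmap G (val w)).
Local Notation hY := Y_htpy.
Definition Y_proj w : T := (hmap (val w)).2.
Local Notation hT := Y_proj.
Definition Y_err w : Ydg := w - dgm_d (hY w) - hY (dgm_d w) - iota (hT w).
Local Notation Eop := Y_err.

Lemma hY_linear : linear hY.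
Proof. by move=> c x y; apply: val_inj; apply: (congr1 fst (hmap_lin c (val x) (val y))). Qed.
Lemma hT_linear : linear hT.
Proof. by move=> c x y; apply: (congr1 snd (hmap_lin c (val x) (val y))). Qed.
Lemma hY_act w (x : L) : hY (dgm_act w x) = dgm_act (hY w) x.
Proof. by apply: val_inj; apply: (congr1 fst (hmap_act G x (subspaceP w))). Qed.
Lemma hT_act w (x : L) : hT (dgm_act w x) = dgm_act (hT w) x.
Proof. exact: (congr1 snd (hmap_act G x (subspaceP w))). Qed.
Lemma hY_hom p w : dgm_hom p w -> dgm_hom (p + 1) (hY w).
Proof. by move=> hw; have [] := hmap_hom G (subspaceP w) hw. Qed.
Lemma hT_hom p w : dgm_hom p w -> dgm_hom p (hT w).
Proof. by move=> hw; have [] := hmap_hom G (subspaceP w) hw. Qed.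
Lemma iota_linear : linear iota. Proof. exact: gmap_linear. Qed.
Lemma iota_act t (a : L) : iota (dgm_act t a) = dgm_act (iota t) a.
Proof. exact: gmap_act. Qed.
Lemma hY_iota t : hY (iota t) = 0.
Proof. by apply: val_inj; apply: (congr1 fst (hmap_iota G t)). Qed.
Lemma hT_iota t : hT (iota t) = t.
Proof. exact: (congr1 snd (hmap_iota G t)). Qed.
Lemma hY_hY w : hY (hY w) = 0.
Proof. by apply: val_inj; apply: (congr1 fst (hmap_hmap G (val w))). Qed.
Lemma hT_hY w : hT (hY w) = 0.
Proof. exact: (congr1 snd (hmap_hmap G (val w))). Qed.
Lemma Yd_linear : linear (@dgm_d _ _ Ydg).
Proof. exact: dgm_d_linear. Qed.

Lemma subr_cancel (V : zmodType) (a b c r s : V) : a - (b - s) - (c + s) - r = a - b - c - r.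
Proof. by congr (_ - r); rewrite opprB [s - b]addrC addrA opprD addrACA subrr addr0. Qed.

Lemma Eop_linear : linear Eop.
Proof.
apply: linear_sub; first apply: linear_sub; first apply: linear_sub => //.
- exact: linear_compose Yd_linear hY_linear.
- exact: linear_compose hY_linear Yd_linear.
- exact: linear_compose iota_linear hT_linear.
Qed.

Lemma Eop_iota t : Eop (iota t) = 0.
Proof.
rewrite /Y_err -iota_d hT_iota !hY_iota (lin0 Yd_linear) !subr0.
by rewrite subrr.
Qed.

(** Both sides reduce to h w - h d h w, as h h, h iota and the projection after h are all zero. *)
Lemma Eop_hY w : Eop (hY w) = hY (Eop w).
Proof.
rewrite /Y_err !(linB hY_linear) hY_hY hT_hY hY_iota hY_hY (lin0 Yd_linear) (lin0 iota_linear).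
by rewrite !subr0.
Qed.

Lemma Eop_hom p w : dgm_hom p w -> dgm_hom p (Eop w).
Proof.
move=> hw.
have a1 : dgm_hom p (dgm_d (hY w)).
  by rewrite -[p](addrK 1); apply: dgm_d_hom; apply: hY_hom.
have a2 : dgm_hom p (hY (dgm_d w)).
  by rewrite -[p](subrK 1); apply: hY_hom; apply: dgm_d_hom.
have a3 : dgm_hom p (iota (hT w)).
  by rewrite -[p]add0r; apply: (dgmh_deg (iota_hom G)); apply: hT_hom.
exact: dgm_homB (dgm_homB (dgm_homB hw a1) a2) a3.
Qed.

(** d itself is not kQ-linear, but its graded commutator with a kQ-linear map of degree 1 is: the
    two terms with the differential of x cancel. *)
Lemma Eop_act w (x : L) : Eop (dgm_act w x) = dgm_act (Eop w) x.
Proof.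
move: w (grading_sum (dgm_grading Ydg) w); apply: homogeneous_sum_ind => [|u v hu hv|p w hw].
- by rewrite (lin0 (dgm_linl x)) (lin0 Eop_linear) (lin0 (dgm_linl x)).
- by rewrite (linD (dgm_linl x)) !(linD Eop_linear) (linD (dgm_linl x)) hu hv.
have al := @dgm_linl _ _ Ydg x.
rewrite /Y_err (dgm_leibniz _ hw) (linD hY_linear) (linZ hY_linear) !hY_act hT_act iota_act.
rewrite (dgm_leibniz _ (hY_hom hw)) !(linB al) signzD expr1z mulrN1 scaleNr.
exact: subr_cancel.
Qed.

Definition nilp w : Prop := exists N, iter N Eop w = 0.

Lemma iter_Eop_linear N : linear (iter N Eop).
Proof. by elim: N => [|N IH] //=; apply: linear_compose Eop_linear IH. Qed.
Lemma nilpP c u v : nilp u -> nilp v -> nilp (c *: u + v).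
Proof.
move=> [p hp] [q hq]; exists (p + q)%N; rewrite iter_Eop_linear {1}addnC !iterD hp hq.
by rewrite !(lin0 (iter_Eop_linear _)) scaler0 addr0.
Qed.
Lemma nilp0 : nilp 0. Proof. by exists 0%N. Qed.
Lemma nilpD u v : nilp u -> nilp v -> nilp (u + v).
Proof. by move=> hu hv; rewrite -[u]scale1r; apply: nilpP. Qed.
Lemma nilpZ c u : nilp u -> nilp (c *: u).
Proof. by move=> hu; rewrite -[_ *: _]addr0; apply: nilpP hu nilp0. Qed.
Lemma nilp_sum (I : Type) (r : seq I) (P : pred I) (F : I -> Ydg) :
  (forall j, nilp (F j)) -> nilp (\sum_(j <- r | P j) F j).
Proof. by move=> h; apply: big_ind => //; [apply: nilp0 | apply: nilpD]. Qed.
Lemma nilp_act w (x : L) : nilp w -> nilp (dgm_act w x).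
Proof.
move=> [N hN]; exists N.
have -> : iter N Eop (dgm_act w x) = dgm_act (iter N Eop w) x.
  by elim: N {hN} => //= N ->; rewrite Eop_act.
by rewrite hN (lin0 (dgm_linl _)).
Qed.
Lemma nilp_hY w : nilp w -> nilp (hY w).
Proof.
move=> [N hN]; exists N.
have -> : iter N Eop (hY w) = hY (iter N Eop w) by elim: N {hN} => //= N ->; rewrite Eop_hY.
by rewrite hN (lin0 hY_linear).
Qed.
Lemma nilp_Eop w : nilp (Eop w) -> nilp w.
Proof. by move=> [N hN]; exists N.+1; rewrite iterSr. Qed.
Lemma nilp_iota t : nilp (iota t).
Proof. by exists 1%N; rewrite /= Eop_iota. Qed.

Lemma Yfst_linear : linear Yfst.
Proof.
move=> c x y; apply: val_inj; apply: raw_ext => [|al] //=.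
by rewrite !ffunE scaler0 addr0.
Qed.

(** x starts away from i, so no component with some beta on the right can arise. *)
Lemma act_fst_dec u x al : x ** eA (tgt (val al)) = x -> act (u, 0) x = (u ** dec x, 0).
Proof.
move=> hx; have -> : ((u, 0) : raw) = lmul u y1.
  by apply: raw_ext => [|be] /=; rewrite ?ga_mul1r // !ffunE gmul0r.
rewrite act_lmul; apply: raw_ext => [|be] //=.
by rewrite -hx act_mul_e /= !ffunE (negbTE (mt_noloop S al)) gmul0r.
Qed.

Lemma h1_mul_rd q u al : h1 (q ** rd u al) = 0.
Proof.
move: u; apply: (mut_lin_eq (g := fun=> 0)) => [||v|c u cv _ _].
- apply: linear_compose h1_lin _; exact: linear_compose (@ga_linr _ B q) (@mt_rd_lin _ _ _ _ S al).
- exact: linear_const0.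
- by rewrite mt_rd_e gmul0r (lin0 h1_lin).
rewrite rd_xx ga_mulA; case: c cv => [phi|be|be phi|phi be|be phi ga] cv /=;
  by rewrite ?h1_right ?h1_both // gmul0r (lin0 h1_lin).
Qed.

Lemma Draw_fst u (v : 'I_n) : v != i -> u ** e v = u -> Draw (u, 0) = (dM u, 0).
Proof.
move=> vi uv; apply: raw_ext => [|be] //=; rewrite !ffunE (lin0 dM_lin) add0r.
by rewrite -uv sgnM sgn_e -ga_mulA e_mar /= (negbTE vi) gmul0r.
Qed.

Lemma Eop_fst u (v : 'I_n) : v != i -> u ** e v = u -> (h1 u).2 = 0 ->
  val (Eop (Yfst u)) = (u, 0) - Draw (h1 u).1 - (h1 (dM u)).1.
Proof.
move=> vi uv hT0; have E : iota (hT (Yfst u)) = 0.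
  suff -> : hT (Yfst u) = 0 by exact: lin0 iota_linear.
  by rewrite -hT0 -(hmap_fst G).
have E1 : val (hY (Yfst u)) = (h1 u).1 by rewrite -(hmap_fst G).
have E2 : val (hY (dgm_d (Yfst u))) = (h1 (dM u)).1.
  by rewrite -(hmap_fst G) -(Draw_fst vi uv).
have VB (a b : Ydg) : val (a - b) = val a - val b :> raw by [].
by rewrite /Y_err E subr0 !VB E2 Yd_val E1.
Qed.

Lemma m_lrdeco_src l phi ga : m (lrdeco l phi ga) ** e (tgt (val ga)) = m (lrdeco l phi ga).
Proof. by rewrite mar_e; case: l => [al|] /=; rewrite eqxx. Qed.

(** The homotopy vanishes on this element. Of its differential it sees only the term with gamma^*,
    from which it recovers the element, and the remainder. What is left is an element of kQ acting
    on the homotopy of sgn(q), a path shorter by one arrow. *)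
Lemma Eop_lrdeco q l phi ga : mvalid (lrdeco l phi ga) ->
  Eop (Yfst (q ** m (lrdeco l phi ga)))
  = dgm_act (hY (Yfst (sgn q))) (remainder l phi ga : L).
Proof.
move=> cv; have h0 (x : B) : h1 (x ** m (lrdeco l phi ga)) = 0.
  by case: {+}l => [al|]; [apply: h1_both | apply: h1_right].
apply: val_inj; rewrite (@Eop_fst _ (tgt (val ga))) ?h0 //; last first.
- by rewrite -ga_mulA m_lrdeco_src.
- exact: (mt_noloop S).
rewrite (lin0 Draw_lin) subr0 dM_mul (linD h1_lin) h0 add0r dM_lrdeco //.
rewrite gmulBr gmulDr gmulZr (linB h1_lin) (linD h1_lin) (linZ h1_lin) h1_mul_rd add0r.
set s := (-1) ^ mdeg _; set r := remainder l phi ga.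
have ss : s * s = 1 by apply: signzz.
have E1 : h1 (sgn q ** (m (ldeco l phi) ** m (MStar ga)))
    = ((s *: (q ** m (lrdeco l phi ga)), 0), 0).
  rewrite ga_mulA h1_star triv_coeff_mar scale0r sgnM sgnK sgn_mar gmulZr.
  by rewrite (linZ (@mt_rd_lin _ _ _ _ S ga)) rd_xx rdiv_ldeco.
have E2 : val (dgm_act (hY (Yfst (sgn q))) (r : L)) = (h1 (sgn q ** dec r)).1.
  rewrite -(hmap_fst G) -(act_fst_dec _ (remainder_src l phi ga)).
  by rewrite (hmap_act G r (isY_fst _)).
rewrite E1 E2.
case: (h1 (sgn q ** dec r)) => z v.
change ((q ** m (lrdeco l phi ga), 0) - (s *: ((s *: (q ** m (lrdeco l phi ga)), 0) : raw) - z) = z).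
have -> : s *: ((s *: (q ** m (lrdeco l phi ga)), 0) : raw) = (q ** m (lrdeco l phi ga), 0).
  by apply: raw_ext => [|al] /=; rewrite ?scalerA ?ss ?scale1r // !ffunE scaler0.
by rewrite opprB addrC subrK.
Qed.

(** The homotopy turns gamma^* into gamma^-1. Differentiating the result returns the given element
    and the remainder; its other terms cancel against the homotopy of the differential. Again an
    element of kQ acting on the shorter path q is left. *)
Lemma Eop_star q l phi ga : mvalid (lrdeco l phi ga) ->
  Eop (Yfst (q ** m (ldeco l phi) ** m (MStar ga)))
  = (-1) ^ mdeg (ldeco l phi) *: dgm_act (Yfst q) (remainder l phi ga : L).
Proof.
move=> cv; set s := (-1) ^ mdeg _; set r := remainder l phi ga.
have ss : s * s = 1 by apply: signzz.
have rl := @mt_rd_lin _ _ _ _ S ga.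
have gi := mt_noloop S ga.
have tm := triv_coeff_md ga l (ldeco_src cv).
have ms : m (MStar ga) ** e (tgt (val ga)) = m (MStar ga) by rewrite mar_e /= eqxx.
have ml (x : B) : x ** m (lrdeco l phi ga) ** e (tgt (val ga)) = x ** m (lrdeco l phi ga).
  by rewrite -ga_mulA m_lrdeco_src.
have E1 : h1 (q ** m (ldeco l phi) ** m (MStar ga))
    = ((s *: (sgn q ** m (lrdeco l phi ga)), 0), 0).
  rewrite h1_star triv_coeff_mar scale0r sgnM sgn_mar gmulZr.
  by rewrite (linZ rl) rd_xx rdiv_ldeco.
have E2 : (h1 (dM (q ** m (ldeco l phi) ** m (MStar ga)))).1 = (- s *: (dM (sgn q)
     ** m (lrdeco l phi ga) + q ** rd (md (ldeco l phi)) ga), 0).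
  rewrite dM_mul dM_star gmul0r addr0 h1_star /= sgn_dM' sgnM sgn_mar gmulZr (linZ dM_lin).
  rewrite dM_mul sgnK (linN rl) (linZ rl) (linD rl) rd_xx rdiv_ldeco scaleNr rd_mul.
  by rewrite mt_dM_x ?(ldeco_valid cv) // tm scale0r addr0.
apply: val_inj; rewrite (@Eop_fst _ (tgt (val ga))) ?E1 ?E2 //; last by rewrite -ga_mulA ms.
rewrite (@Draw_fst _ (tgt (val ga))) //; last by rewrite gmulZl ml.
change (((q ** m (ldeco l phi) ** m (MStar ga), 0) : raw)
   - (dM (s *: (sgn q ** m (lrdeco l phi ga))), 0)
   - (- s *: (dM (sgn q) ** m (lrdeco l phi ga) + q ** rd (md (ldeco l phi)) ga), 0)
   = s *: act (q, 0) r).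
rewrite (act_fst_dec q (remainder_src l phi ga)) -/r.
rewrite (linZ dM_lin) dM_mul sgnK dM_lrdeco // -/s -/r.
apply: raw_ext => [|al]; last by rewrite !ffunE !subr0 scaler0.
rewrite /= gmulBr gmulDr gmulZr ga_mulA scaleNr opprK.
have -> (P W Z H : B) : P + (W + Z - H) = (P + W) + (Z - H) by rewrite !addrA.
rewrite [s *: (_ + (_ - _))]scalerDr scalerBr scalerA ss scale1r.
by rewrite opprD [- (s *: _) - _]addrC addrA subrK opprB addrC subrK.
Qed.

Lemma nilp_lrdeco q l phi ga : nilp (Yfst (sgn q)) -> nilp (Yfst (q ** m (lrdeco l phi ga))).
Proof.
move=> hq; have [cv|/mar_invalid->] := boolP (mvalid (lrdeco l phi ga)); last first.
  by rewrite gmul0r (lin0 Yfst_linear); apply: nilp0.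
by apply: nilp_Eop; rewrite Eop_lrdeco //; apply: nilp_act; apply: nilp_hY.
Qed.

Lemma act_fst_A u al : act (u, 0) (xA (val al)) = lmul u (yA al).
Proof.
have -> : ((u, 0) : raw) = lmul u y1.
  by apply: raw_ext => [|be] /=; rewrite ?ga_mul1r // !ffunE gmul0r.
by rewrite act_lmul act_y1_A.
Qed.

Lemma sum_lmul_yA (F : mutA -> B) be : (\sum_al lmul (F al) (yA al)).2 be = F be ** e (tgt (val be)).
Proof.
rewrite (lin_sum (raw_snd_linear be)) (bigD1 be) //= !ffunE eqxx big1 ?addr0 // => al.
by rewrite !ffunE eq_sym => /negbTE->; rewrite gmul0r.
Qed.
Lemma sum_lmul_yA_fst (F : mutA -> B) : (\sum_al lmul (F al) (yA al)).1 = 0.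
Proof.
by rewrite (lin_sum (@raw_fst_linear _ _ _ _ B)) big1 // => al _; rewrite /= gmul0r.
Qed.

(** The formula for the right action of phi, solved for the undivided arrow. *)
Lemma Yfst_arrow l phi q : mvalid (ldeco l phi) -> Yfst (q ** m (ldeco l phi)) =
  dgm_act (Yfst q) (if l is Some al then xA (val al) ** xA phi else xA phi : L)
  + \sum_be dgm_act (Yfst (q ** m (lrdeco l phi be))) (xA (val be) : L).
Proof.
move=> cv; have E : act (q, 0) (if l is Some al then xA (val al) ** xA phi else xA phi)
    = (q ** m (ldeco l phi), [ffun be => - (q ** m (lrdeco l phi be))]).
  case: l cv => [al|] /= cv.
    rewrite actM act_fst_A act_arr; apply: raw_ext => [|be] /=.
      rewrite gmul0r gmul0l add0r (bigD1 al) //= !ffunE eqxx -ga_mulA e_mar eqxx.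
      by rewrite big1 ?addr0 // => be /negbTE h; rewrite !ffunE h gmul0r gmul0l.
    rewrite !ffunE gmul0r !gmul0l if_same !add0r (bigD1 al) //= !ffunE eqxx -ga_mulA e_mar eqxx.
    by rewrite big1 ?addr0 // => ga /negbTE h; rewrite !ffunE h gmul0r gmul0l.
  rewrite act_arr; apply: raw_ext => [|be] /=.
    by rewrite big1 ?addr0 // => be _; rewrite ffunE gmul0l.
  rewrite !ffunE big1 ?addr0 => [|ga _]; last by rewrite ffunE gmul0l.
  by case: eqP => [h|_]; [rewrite h inA_val in cv | rewrite add0r].
apply: val_inj; have VD (a b : Ydg) : val (a + b) = val a + val b :> raw by [].
rewrite VD Yact_val E raddf_sum /=.
rewrite (eq_bigr _ (fun al _ => act_fst_A _ al)); apply: raw_ext => [|be].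
  have -> (u v : raw) : (u + v).1 = u.1 + v.1 by [].
  by rewrite sum_lmul_yA_fst addr0.
have -> (u v : raw) : (u + v).2 be = u.2 be + v.2 be by rewrite /= ffunE.
by rewrite sum_lmul_yA !ffunE -ga_mulA m_lrdeco_src addNr.
Qed.

(** The kQ-action does not produce q gamma^* from q, so nilpotency at q alone would not propagate
    along paths. *)
Definition nilpM q : Prop := nilp (Yfst q) /\ forall ga, nilp (Yfst (q ** m (MStar ga))).

(** One application of the error leads back to q or sgn(q), up to the homotopy and the action of kQ,
    and the error commutes with both. A product q c gamma^* is zero unless c starts in i, which
    leaves only undecorated or left-decorated arrows in the second claim. *)
Lemma nilpM_step q c : mvalid c -> nilpM q -> nilpM (sgn q) -> nilpM (q ** m c).
Proof.
move=> cv [hq hs] [hq' _].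
have hl l phi : mvalid (ldeco l phi) -> nilp (Yfst (q ** m (ldeco l phi))).
  move=> lv; rewrite Yfst_arrow //; apply: nilpD; first exact: nilp_act.
  by apply: nilp_sum => be; apply: nilp_act; apply: nilp_lrdeco.
split.
  case: c cv => [phi|ga|al phi|phi be|al phi be] cv.
  - exact: (hl None).
  - exact: hs.
  - exact: (hl (Some al)).
  - exact: (@nilp_lrdeco _ None).
  - exact: (@nilp_lrdeco _ (Some al)).
move=> ga; have [ci|ci] := eqVneq (msrc c) i; last first.
  rewrite -(mar_tgt B (MStar ga)) -!ga_mulA [m c ** _]ga_mulA mar_e (negbTE ci) gmul0l gmul0r.
  by rewrite (lin0 Yfst_linear); apply: nilp0.
have hls l phi : mvalid (lrdeco l phi ga) -> nilp (Yfst (q ** m (ldeco l phi) ** m (MStar ga))).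
  by move=> lv; apply: nilp_Eop; rewrite Eop_star //; apply: nilpZ; apply: nilp_act.
case: c cv ci => [phi|al|al phi|phi be|al phi be] cv ci.
- by apply: (hls None); rewrite /= (cv : ~~ inA i phi) -ci /= eqxx.
- by have := mt_noloop S al; rewrite -[X in _ != X]ci eqxx.
- by apply: (hls (Some al)); rewrite /= (cv : tgt phi == i) andbT; apply/eqP.
- by have := mt_noloop S be; rewrite -[X in _ != X]ci eqxx.
- by have := mt_noloop S be; rewrite -[X in _ != X]ci eqxx.
Qed.

Lemma nilpMP a u v : nilpM u -> nilpM v -> nilpM (a *: u + v).
Proof.
move=> [h1 h2] [h3 h4]; split=> [|ga]; first by rewrite Yfst_linear; apply: nilpP.
by rewrite gmulDl gmulZl Yfst_linear; apply: nilpP.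
Qed.
Lemma nilpM0 : nilpM 0.
Proof. by split=> [|ga]; rewrite ?gmul0l (lin0 Yfst_linear); apply: nilp0. Qed.

Lemma iota_gen v : iota (gen G v) = Yfst (e v).
Proof.
have E (u : 'I_n) : dgm_act (Yfst (e u)) (eA u : L) = Yfst (e u).
  apply: val_inj; rewrite Yact_val act_e; apply: raw_ext => [|al] /=; first by rewrite pa_eev.
  by rewrite !ffunE gmul0l if_same.
have [->|vi] := eqVneq v i; first by rewrite gen_i /siota gmap_gI E.
by have := gen_j G (exist _ v vi : J); rewrite /siota => ->; rewrite gmap_gJ E.
Qed.
Lemma iota_gA al : iota (gA al) = Yfst (m (MStar al)).
Proof.
rewrite /siota gmap_gA; apply: val_inj; rewrite Yact_val act_e; apply: raw_ext => [|be] /=.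
  by rewrite mar_e eqxx.
by rewrite !ffunE gmul0l if_same.
Qed.

(** sgn(q) is carried along because it appears in [Eop_lrdeco]. The induction starts with e_v and
    gamma^*, which lie in the image of T, where the error is zero. *)
Lemma nilpM_all q : nilpM q /\ nilpM (sgn q).
Proof.
have sl := @sgn_lin _ B.
move: q; apply: mut_lin_ind => [|a u v [h1 h2] [h3 h4]|v|c q cv _ [h1 h2]].
- by rewrite (lin0 sl); split; apply: nilpM0.
- by rewrite sl; split; apply: nilpMP.
- rewrite sgn_e; have h : nilpM (e v).
    split=> [|ga]; first by rewrite -iota_gen; apply: nilp_iota.
    rewrite e_mar; case: eqP => _; first by rewrite -iota_gA; apply: nilp_iota.
    by rewrite (lin0 Yfst_linear); apply: nilp0.
  by [].
split; first exact: nilpM_step.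
rewrite sgnM sgn_mar gmulZr -[_ *: _]addr0; apply: nilpMP nilpM0.
by apply: nilpM_step => //; rewrite sgnK.
Qed.

Lemma nilp_all w : nilp w.
Proof.
have -> : w = Yfst (val w).1 + \sum_al dgm_act (Yfst ((val w).2 al)) (xA (val al) : L).
  apply: val_inj; rewrite {1}(raw_decomp (subspaceP w)).
  have VD (a b : Ydg) : val (a + b) = val a + val b :> raw by [].
  rewrite VD raddf_sum /=; congr (_ + _); last by apply: eq_bigr => al _; rewrite act_fst_A.
  by apply: raw_ext => [|al] /=; rewrite ?ga_mul1r // !ffunE gmul0r.
apply: nilpD; first by case: (nilpM_all (val w).1) => -[].
apply: nilp_sum => al; apply: nilp_act.
by case: (nilpM_all ((val w).2 al)) => -[].
Qed.

End LocalNilpotency.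

(* Homological perturbation: if [d, hY] + iota hT = 1 - E with E locally
   nilpotent and vanishing on the image of iota, the Neumann series of E corrects
   (hY, hT) into a genuine homotopy inverse of iota. *)
Section Perturbation.
Variables (k : fieldType) (L : dgAlgebra k) (Y T : dgModule L).
Variables (iota : T -> Y) (hY : Y -> Y) (hT : Y -> T) (E : Y -> Y).
Hypothesis iotaP : is_dgm_morphism iota.
Hypothesis hYP : dgm_hom_of_degree 1 hY.
Hypothesis hTP : dgm_hom_of_degree 0 hT.
Hypothesis EP : dgm_hom_of_degree 0 E.
Hypothesis EE : forall w, E w = w - dgm_d (hY w) - hY (dgm_d w) - iota (hT w).
Hypothesis hY_iota : forall t, hY (iota t) = 0.
Hypothesis hT_iota : forall t, hT (iota t) = t.
Hypothesis E_nilp : forall w, exists p, iter p E w = 0.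
Implicit Types (w : Y) (t : T).

Lemma E_iota t : E (iota t) = 0.
Proof.
by rewrite EE -iotaP.2 !hY_iota hT_iota (lin0 (@dgm_d_linear _ _ Y)) !subr0 subrr.
Qed.

Lemma iter_E_linear p : linear (iter p E).
Proof. by elim: p => [|p IH] //=; apply: linear_compose (dgmh_linear EP) IH. Qed.

(** The number of terms depends on w. By [neumannE] every exponent at which E kills w gives the same
    sum, and so two elements can be given a common one. *)
Definition neumann w : Y := \sum_(j < sval (cid (E_nilp w))) iter j E w.

Lemma neumannE p w : iter p E w = 0 -> neumann w = \sum_(j < p) iter j E w.
Proof.
have z q r : iter q E w = 0 -> (q <= r)%N ->
    \sum_(j < r) iter j E w = \sum_(j < q) iter j E w.
  move=> hq qr; rewrite -(subnKC qr) big_split_ord /= [X in _ + X]big1 ?addr0 // => j _.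
  by rewrite addnC iterD hq (lin0 (iter_E_linear _)).
rewrite /neumann; case: cid => q /= hq hp.
by case/orP: (leq_total p q) => pq; rewrite (z _ _ _ pq).
Qed.

Lemma nilp_common u v : exists p, iter p E u = 0 /\ iter p E v = 0.
Proof.
have [p hp] := E_nilp u; have [q hq] := E_nilp v; exists (p + q)%N.
by rewrite {1}addnC !iterD hp hq !(lin0 (iter_E_linear _)).
Qed.

Lemma neumann_linear : linear neumann.
Proof.
move=> c u v; have [p [hu hv]] := nilp_common u v.
rewrite (neumannE hu) (neumannE hv) (@neumannE p); last first.
  by rewrite iter_E_linear hu hv scaler0 addr0.
rewrite scaler_sumr -big_split; apply: eq_bigr => j _; exact: iter_E_linear.
Qed.
Lemma neumann_act w (x : L) : neumann (dgm_act w x) = dgm_act (neumann w) x.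
Proof.
have Ea p : iter p E (dgm_act w x) = dgm_act (iter p E w) x.
  by elim: p => //= p ->; rewrite (dgmh_act EP).
have [p hp] := E_nilp w.
rewrite (neumannE hp) (@neumannE p) ?Ea ?hp ?(lin0 (dgm_linl _)) //.
by rewrite (lin_sum (dgm_linl x)); apply: eq_bigr => j _; rewrite Ea.
Qed.
Lemma neumann_hom p w : dgm_hom p w -> dgm_hom p (neumann w).
Proof.
move=> hw; rewrite /neumann; apply: big_ind => [|u v hu hv|j _].
- exact: grading0 (dgm_grading Y) _.
- by rewrite -[u]scale1r; apply: (gradingP (dgm_grading Y)).
elim: (j : nat) => //= q IH; rewrite -[p]add0r; exact: (dgmh_deg EP).
Qed.
Lemma neumann_iota t : neumann (iota t) = iota t.
Proof. by rewrite (@neumannE 1) ?big_ord1 //= E_iota. Qed.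
Lemma neumann_inv w : neumann w - E (neumann w) = w.
Proof.
have [p hp] := E_nilp w; rewrite (neumannE hp) (lin_sum (dgmh_linear EP)) -sumrB.
rewrite -(big_mkord xpredT (fun j => iter j E w - E (iter j E w))).
rewrite (telescope_sumr_eq (fun j => - iter j E w)) // => [|j _].
  by rewrite hp oppr0 add0r opprK.
by rewrite opprK addrC.
Qed.

(** [hT] is not assumed to be a chain map, so E may fail to commute with the differential. The
    defect lies in the image of [iota], which [hY] kills. *)
Lemma E_d w : exists t, E (dgm_d w) = dgm_d (E w) + iota t.
Proof.
exists (dgm_d (hT w) - hT (dgm_d w)).
rewrite !EE !(linB (@dgm_d_linear _ _ Y)) !dgm_d_sq (linB (dgmh_linear iotaP.1)) iotaP.2.
rewrite (lin0 (dgmh_linear hYP)) !subr0.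
by rewrite [RHS]addrA subrK.
Qed.

Lemma hY_iter_E_d p w : hY (iter p E (dgm_d w)) = hY (dgm_d (iter p E w)).
Proof.
suff [t ->] : exists t, iter p E (dgm_d w) = dgm_d (iter p E w) + iota t.
  by rewrite (linD (dgmh_linear hYP)) hY_iota addr0.
elim: p => [|p [t IH]] /=; first by exists 0; rewrite (lin0 (dgmh_linear iotaP.1)) addr0.
rewrite IH (linD (dgmh_linear EP)) E_iota addr0; exact: E_d.
Qed.

Lemma hY_neumann_d w : hY (neumann (dgm_d w)) = hY (dgm_d (neumann w)).
Proof.
have [p [h1 h2]] := nilp_common w (dgm_d w).
rewrite (neumannE h1) (neumannE h2) (lin_sum (@dgm_d_linear _ _ Y)).
rewrite !(lin_sum (dgmh_linear hYP)); apply: eq_bigr => j _; exact: hY_iter_E_d.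
Qed.

Lemma dgm_hom_comp (X1 X2 X3 : dgModule L) p q (f : X2 -> X3) (g : X1 -> X2) :
  dgm_hom_of_degree p f -> dgm_hom_of_degree q g -> dgm_hom_of_degree (p + q) (f \o g).
Proof.
move=> hf hg; split=> [||r x hx] /=.
- exact: linear_compose (dgmh_linear hf) (dgmh_linear hg).
- by move=> x a /=; rewrite (dgmh_act hg) (dgmh_act hf).
- by rewrite -addrA; apply/(dgmh_deg hf)/(dgmh_deg hg).
Qed.

Lemma perturbation : exists (f : Y -> T) (s : Y -> Y), [/\ is_dgm_morphism f,
  dgm_hom_of_degree 1 s, forall t, f (iota t) = t &
  forall w, w = dgm_d (s w) + s (dgm_d w) + iota (f w)].
Proof.
have NP : dgm_hom_of_degree 0 neumann.
  by split; [exact: neumann_linear | exact: neumann_act | move=> p w; rewrite add0r; apply: neumann_hom].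
have H w : w = dgm_d (hY (neumann w)) + hY (neumann (dgm_d w)) + iota (hT (neumann w)).
  rewrite -[w in LHS]neumann_inv EE hY_neumann_d.
    set a := dgm_d (hY _); set b := hY _; set c := iota _; set z := neumann w.
have -> : z - a - b - c = z - (a + b + c) by rewrite !opprD !addrA.
  by rewrite opprB addrC subrK.
exists (hT \o neumann), (hY \o neumann); split.
- split; first by rewrite -[0]addr0; apply: dgm_hom_comp.
  (* Comparing the differential of [H w] with [H (dgm_d w)] gives the chain map property after
     [iota], which is injective by [hT_iota]. *)
  move=> w /=; rewrite -[LHS]hT_iota -[RHS]hT_iota; congr hT; rewrite iotaP.2.
  have dl := @dgm_d_linear _ _ Y.
  have := congr1 (@dgm_d _ _ Y) (H w); have := H (dgm_d w).
  rewrite !(linD dl) !dgm_d_sq (lin0 neumann_linear) (lin0 (dgmh_linear hYP)) addr0 add0r.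
  by move=> {1}-> /addrI.
- by rewrite -[1]addr0; apply: dgm_hom_comp.
- by move=> t /=; rewrite neumann_iota.
- exact: H.
Qed.

End Perturbation.

(** * Null-homotopies and homotopy retracts *)

Section HomotopyRetract.
Variables (k : fieldType) (L : dgAlgebra k) (Y T : dgModule L).
Variables (iota : T -> Y) (f : Y -> T) (s : Y -> Y).
Hypothesis iotaP : is_dgm_morphism iota.
Hypothesis fP : is_dgm_morphism f.
Hypothesis sP : dgm_hom_of_degree 1 s.
Hypothesis f_iota : forall t, f (iota t) = t.
Hypothesis iota_f : forall w, w = dgm_d (s w) + s (dgm_d w) + iota (f w).

Lemma retract_quasi_iso : dgm_quasi_iso f.
Proof.
split=> //; split=> [w dw [t ft]|t dt].
  exists (s w + iota t); rewrite {1}(iota_f w) dw (lin0 (dgmh_linear sP)) addr0 ft.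
  by rewrite (linD (@dgm_d_linear _ _ Y)) iotaP.2.
exists (iota t); first by rewrite -iotaP.2 dt (lin0 (dgmh_linear iotaP.1)).
by exists 0; rewrite f_iota subrr (lin0 (@dgm_d_linear _ _ T)).
Qed.

Lemma dgm_hom_lincomb (X Z : dgModule L) p c (g g' : X -> Z) :
  dgm_hom_of_degree p g -> dgm_hom_of_degree p g' ->
  dgm_hom_of_degree p (fun w => g w + c *: g' w).
Proof.
move=> hg hg'; split=> [|x a|q x hx].
- exact: linear_add (dgmh_linear hg) (linear_scale _ (dgmh_linear hg')).
- by rewrite (dgmh_act hg) (dgmh_act hg') (linD (dgm_linl a)) (linZ (dgm_linl a)).
rewrite -[g x]scale1r; apply: (gradingP (dgm_grading Z)); first exact: (dgmh_deg hg).
by apply: (gradingZ (dgm_grading Z)); apply: (dgmh_deg hg').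
Qed.

(** F splits as F (d s + s d) + F iota f. As F is a cycle, the first summand is the boundary of
    (-1)^m F s; the second is the boundary of G0 f. This serves both for acyclic targets and for
    endomorphisms of Y. *)
Lemma extend_homotopy (X : dgModule L) m (F : Y -> X) (G0 : T -> X) :
  dgm_hom_of_degree m F -> (forall w, dgm_d (F w) - (-1) ^ m *: F (dgm_d w) = 0) ->
  dgm_hom_of_degree (m + 1) G0 ->
  (forall t, F (iota t) = dgm_d (G0 t) - (-1) ^ (m + 1) *: G0 (dgm_d t)) ->
  exists2 g : Y -> X, dgm_hom_of_degree (m + 1) g &
    forall w, F w = dgm_d (g w) - (-1) ^ (m + 1) *: g (dgm_d w).
Proof.
move=> hF cF hG GE; exists (fun w => G0 (f w) + (-1) ^ m *: F (s w)).
  apply: (@dgm_hom_lincomb _ _ _ _ (G0 \o f) (F \o s)).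
    by rewrite -[m + 1]addr0; apply: dgm_hom_comp fP.1.
  exact: dgm_hom_comp.
move=> w; have dl := @dgm_d_linear _ _ X; have Fl := dgmh_linear hF.
have cF' v : dgm_d (F v) = (-1) ^ m *: F (dgm_d v) by apply/eqP; rewrite -subr_eq0 cF.
rewrite (linD dl) (linZ dl) cF' scalerA signzz scale1r fP.2 scalerDr opprD addrACA -GE.
rewrite signzD expr1z mulrN1 !scaleNr opprK scalerA signzz scale1r -(linD Fl) -(linD Fl).
by congr F; rewrite [RHS]addrC -iota_f.
Qed.

(** [acyclic] provides a preimage of mixed degree; its component of degree p + 1 already has
    boundary x. *)
Lemma acyclic_hom (X : dgModule L) p (x : X) : acyclic X -> dgm_hom p x -> dgm_d x = 0 ->
  exists2 y : X, dgm_hom (p + 1) y & x = dgm_d y.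
Proof.
move=> acX hx /acX [y0 xy].
have [pr [prl prh pr1 pr0]] := homogeneous_part (dgm_grading X) (p + 1).
have [pr' [prl' prh' pr1' pr0']] := homogeneous_part (dgm_grading X) p.
have dl := @dgm_d_linear _ _ X.
exists (pr y0) => //; rewrite -(pr1' _ hx) xy.
move: y0 {xy} (grading_sum (dgm_grading X) y0); apply: homogeneous_sum_ind => [|u v hu hv|q u hu].
- by rewrite (lin0 prl) !(lin0 dl) (lin0 prl').
- by rewrite (linD prl) !(linD dl) (linD prl') hu hv.
have [qp|qp] := eqVneq q (p + 1).
  rewrite pr1 -?qp // pr1' //.
  by have := dgm_d_hom hu; rewrite qp addrK.
rewrite (pr0 q u) // (lin0 dl) (pr0' (q - 1)) //; last exact: dgm_d_hom.
by apply: contraNneq qp => <-; rewrite subrK.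
Qed.

End HomotopyRetract.

(** * K-projectivity of Y *)

Section ResolutionKProjective.
Variables (k : fieldType) (n : nat) (Q : lf_quiver n) (i : 'I_n) (S : mut_data k Q i).
Local Notation mutA := (mutA Q i).
Local Notation A := (mt_A S).
Local Notation B := (mt_B S).
Local Notation xA := (@pa_x _ _ _ A).
Local Notation raw := (rawY B).
Implicit Types (y z : raw) (al be : mutA).

Local Notation L := (mt_dga S).
Variables (T : dgModule L) (G : silting_basis T).
Local Notation gA := (sb_gA G).
Local Notation gI := (sb_gI G).
Local Notation gJ := (sb_gJ G).
Local Notation Ydg := (Ydg S).
Local Notation iota := (siota G).
Implicit Types (t : T) (w : Ydg).
Local Notation hY := (Y_htpy G).
Local Notation hT := (Y_proj G).
Local Notation Eop := (Y_err G).

Lemma basis_lift (X : dgModule L) p (H : T -> X) : acyclic X ->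
  dgm_hom_of_degree p H -> (forall t, dgm_d (H t) - (-1) ^ p *: H (dgm_d t) = 0) ->
  exists2 G0 : T -> X, dgm_hom_of_degree (p + 1) G0 &
    forall t, H t = dgm_d (G0 t) - (-1) ^ (p + 1) *: G0 (dgm_d t).
Proof.
move=> acX hH cH; have dl := @dgm_d_linear _ _ X; have Hl := dgmh_linear hH.
have cH' t : dgm_d (H t) = (-1) ^ p *: H (dgm_d t) by apply/eqP; rewrite -subr_eq0 cH.
have exA al : exists y : X, dgm_hom (p + 1) y /\ H (gA al) = dgm_d y.
  have [||y hy ->] := @acyclic_hom _ _ X p (H (gA al)) acX; last by exists y.
    by rewrite -[p]addr0; apply: (dgmh_deg hH); apply: gA_hom.
  by rewrite cH' gA_d (lin0 Hl) scaler0.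
have exJ j : exists y : X, dgm_hom (p + 1) y /\ H (gJ j) = dgm_d y.
  have [||y hy ->] := @acyclic_hom _ _ X p (H (gJ j)) acX; last by exists y.
    by rewrite -[p]addr0; apply: (dgmh_deg hH); apply: gJ_hom.
  by rewrite cH' gJ_d (lin0 Hl) scaler0.
have [ya hya] := choice exA; have [yj hyj] := choice exJ.
(* By triangularity the cycles [gA al] and [gJ j] are lifted first. The equation at [gI] then
   contains the chosen [ya], and since the boundary of [gI] is sum_alpha [gA] alpha, the element to
   be lifted is a cycle. *)
have [||yi hyi yiE] := @acyclic_hom _ _ X (p + 1)
    (H gI + (-1) ^ (p + 1) *: \sum_al dgm_act (ya al) (xA (val al) : L)) acX.
- apply: dgm_homD; first by apply: (dgmh_deg hH); apply: gI_hom.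
  apply: dgm_homZ; apply: dgm_hom_sum => al; rewrite -[p + 1]addr0; apply: dgm_homM.
    by case: (hya al).
  by have := pa_hom_x A (val al); rewrite deg_val.
- rewrite (linD dl) (linZ dl) cH' gI_d (lin_sum Hl) (lin_sum dl) signzD expr1z mulrN1 scaleNr.
  apply/eqP; rewrite subr_eq0; apply/eqP; congr (_ *: _); apply: eq_bigr => al _.
  have [h1a h2a] := hya al; rewrite (dgmh_act hH) h2a (dgm_leibniz _ h1a).
  have -> : dga_d (xA (val al) : L) = 0 by exact: mt_d_A.
  by rewrite act0 scaler0 addr0.
have a1 al : dgm_hom (p + 1) (ya al) by case: (hya al).
have a2 j : dgm_hom (p + 1) (yj j) by case: (hyj j).
exists (gmap G ya yi yj); first exact: gmap_hom.
move=> t; rewrite gmap_diff // -yiE addrK.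
rewrite {1}(gmap_eq G Hl (dgmh_act hH)) /gmap; congr (_ + _ + _).
  by apply: eq_bigr => al _; rewrite (hya al).2.
by apply: eq_bigr => j _; rewrite (hyj j).2.
Qed.

Lemma Y_retract : exists (f : Ydg -> T) (s : Ydg -> Ydg), [/\ is_dgm_morphism f,
  dgm_hom_of_degree 1 s, forall t, f (iota t) = t &
  forall w, w = dgm_d (s w) + s (dgm_d w) + iota (f w)].
Proof.
apply: (@perturbation k L Ydg T iota hY hT Eop).
- by split; [exact: iota_hom | exact: iota_d].
- split; [exact: hY_linear | exact: hY_act |].
  by move=> p w hw; rewrite addrC; apply: hY_hom.
- split; [exact: hT_linear | exact: hT_act |].
  by move=> p w hw; rewrite add0r; apply: hT_hom.
- split; [exact: Eop_linear | by move=> w a; apply: Eop_act |].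
  by move=> p w hw; rewrite add0r; apply: Eop_hom.
- by [].
- exact: hY_iota.
- exact: hT_iota.
- exact: nilp_all.
Qed.

Lemma iota_morphism : is_dgm_morphism iota.
Proof. by split; [exact: iota_hom | exact: iota_d]. Qed.

Lemma Y_K_projective : K_projective Ydg.
Proof.
have [f [s [fP sP f_iota iota_f]]] := Y_retract.
move=> X acX p F hF cF.
have hH : dgm_hom_of_degree p (F \o iota) by rewrite -[p]addr0; apply: dgm_hom_comp (iota_hom G).
have [|G0 hG0 GE] := basis_lift acX hH; first by move=> t /=; rewrite iota_d cF.
exact: (extend_homotopy fP sP iota_f hF cF hG0 GE).
Qed.

End ResolutionKProjective.

Lemma dgEnd_d_val (k : fieldType) (L : dgAlgebra k) (X : dgModule L) (F : dgEnd X) :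
  val (dga_d F) = dgend_diff (val F).
Proof. by []. Qed.

(** * A criterion for a map to an endomorphism algebra to be a quasi-isomorphism *)

Section EndomorphismRetract.
Variables (k : fieldType) (L : dgAlgebra k) (X : dgModule L) (C : dgAlgebra k).
Variables (phi : C -> dgEnd X) (ev : (X -> X) -> C).
Hypothesis phiP : is_dga_morphism phi.
Hypothesis ev_lin : linear ev.
Hypothesis ev_phi : forall c, ev (val (phi c)) = c.
Hypothesis ev_d : forall F : dgEnd X, ev (val (dga_d F)) = dga_d (ev (val F)).
Hypothesis ev_hom : forall p F, dgend_hom p F -> ga_hom p (ev F).
Hypothesis ev_exact : forall p F, dgend_hom p F ->
  (forall w, dgm_d (F w) - (-1) ^ p *: F (dgm_d w) = 0) -> ev F = 0 ->
  exists2 g : X -> X, dgm_hom_of_degree (p + 1) g &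
    forall w, F w = dgm_d (g w) - (-1) ^ (p + 1) *: g (dgm_d w).

Lemma end_retract_hom p (F : dgEnd X) : ga_hom p F -> dga_d F = 0 ->
  exists H : dgEnd X, F - phi (ev (val F)) = dga_d H.
Proof.
move=> hF dF; set F' := F - phi _.
have hF' : ga_hom p F'.
  by apply: homD => //; apply: homN; apply: (dgam_hom phiP); apply: ev_hom.
have dF' : dga_d F' = 0.
  rewrite (linB (diff_linear (dga_diff (dgEnd X)))) dF -(dgam_d phiP) -ev_d dF.
  have -> : ev (val (0 : dgEnd X)) = 0 by exact: lin0 ev_lin.
  by rewrite (lin0 (dgam_linear phiP)) subrr.
have cF w : dgm_d (val F' w) - (-1) ^ p *: val F' (dgm_d w) = 0.
  by rewrite -(dgend_diffE _ hF') -dgEnd_d_val dF'.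
have eF : ev (val F') = 0.
  have -> : ev (val F') = ev (val F) - ev (val (phi (ev (val F)))) by exact: linB ev_lin _ _.
  by rewrite ev_phi subrr.
have [g hg gE] := ev_exact hF' cF eF.
exists (to_subspace (dgend_subspace X) (homogeneous_sum1 hg)).
by apply: val_inj; apply/funext => w; rewrite gE -(dgend_diffE _ hg).
Qed.

(** Injectivity on homology comes from the retraction [ev]. For surjectivity a cycle is split into
    homogeneous components, since [ev_exact] speaks of homogeneous maps. *)
Lemma end_retract_quasi_iso : dga_quasi_iso phi.
Proof.
have dl := diff_linear (dga_diff (dgEnd X)); have pl := dgam_linear phiP.
split=> //; split=> [x dx [F xF]|F dF].
  by exists (ev (val F)); rewrite -ev_d -xF ev_phi.
have [r [Fm [ur hFm FE]]] := homogeneous_seq (ga_grading (dgEnd X)) F.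
(* The boundaries of the components lie in distinct degrees, each lowered by one, and sum to
   zero. *)
have dFm q : q \in r -> dga_d (Fm q) = 0.
  apply: (grading_direct (grading_shift 1 (ga_grading (dgEnd X))) ur (f := fun q => dga_d (Fm q))).
    by move=> q' /=; apply: (diff_hom (dga_diff (dgEnd X))).
  by rewrite -(lin_sum dl) -FE.
have evl : linear (fun G : dgEnd X => ev (val G)) by move=> c u v; apply: ev_lin.
exists (ev (val F)); first by rewrite -ev_d dF; apply: (lin0 evl).
have ex q : exists H : dgEnd X, q \in r -> Fm q - phi (ev (val (Fm q))) = dga_d H.
  have [qr|qr] := boolP (q \in r); last by exists 0.
  by have [H HE] := end_retract_hom (hFm q) (dFm q qr); exists H.
have [H hH] := choice ex; exists (\sum_(q <- r) H q).
rewrite (lin_sum dl) FE (lin_sum evl) (lin_sum pl) -sumrB big_seq [RHS]big_seq.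
by apply: eq_bigr => q; apply: hH.
Qed.
End EndomorphismRetract.

(** * Endomorphisms of Y up to homotopy *)

Section EndomorphismsOfY.
Variables (k : fieldType) (n : nat) (Q : lf_quiver n) (i : 'I_n) (S : mut_data k Q i).
Local Notation mutA := (mutA Q i).
Local Notation A := (mt_A S).
Local Notation B := (mt_B S).
Local Notation dM := (@mt_dM _ _ _ _ S).
Local Notation e := (@pa_e _ _ _ B).
Local Notation eA := (@pa_e _ _ _ A).
Local Notation xA := (@pa_x _ _ _ A).
Local Notation m := (mar B).
Local Notation raw := (rawY B).
Local Notation act := (@ract _ _ _ _ A B).
Implicit Types (y z : raw) (al be : mutA).

Local Notation yA := (@gen_Y _ _ _ _ S).
Local Notation dM_lin := (@mt_dM_lin _ _ _ _ S).
Local Notation L := (mt_dga S).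
Local Notation J := {j : 'I_n | j != i}.
Variables (T : dgModule L) (G : silting_basis T).
Local Notation h1 := (hcone1 G).
Local Notation Ydg := (Ydg S).
Local Notation iota := (siota G).
Local Notation Yfst := (@Y_fst _ _ _ _ S).
Implicit Types (t : T) (w : Ydg).

Local Notation Eend := (dgEnd Ydg).

Lemma act_A_fst y al : (act y (xA (val al))).1 = 0.
Proof.
rewrite act_arr /= old_A gmul0r add0r big1 // => be _.
by rewrite left_invalid ?gmul0r //; apply: (mt_noloop S).
Qed.

Lemma Yfst_d u : dgm_d (Yfst u)
  = Yfst (dM u) + \sum_al dgm_act (Yfst (sgn u ** m (MStar al))) (xA (val al) : L).
Proof.
apply: val_inj; have VD (a b : Ydg) : val (a + b) = val a + val b :> raw by [].
rewrite VD raddf_sum /= (eq_bigr _ (fun al _ => act_fst_A _ al)).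
apply: raw_ext => [|be].
  have -> (x z : raw) : (x + z).1 = x.1 + z.1 by [].
  by rewrite sum_lmul_yA_fst addr0.
have -> (x z : raw) : (x + z).2 be = x.2 be + z.2 be by rewrite /= ffunE.
rewrite sum_lmul_yA !ffunE (lin0 dM_lin) !add0r -ga_mulA mar_e /= eqxx.
by [].
Qed.

(* This retraction of b |-> L_b is a chain map because y alpha has no kM-component. *)
Definition Y_eval (F : Ydg -> Ydg) : B := (val (F (Yfst (ga_one B)))).1.

Lemma Y_eval_d p (F : Ydg -> Ydg) : dgend_hom p F -> Y_eval (dgend_diff F) = dM (Y_eval F).
Proof.
move=> hF; rewrite /Y_eval (dgend_diffE _ hF).
have -> (a b : Ydg) c : (val (a - c *: b)).1 = (val a).1 - c *: (val b).1 by [].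
have -> : (val (F (dgm_d (Yfst (ga_one B))))).1 = 0; last by rewrite scaler0 subr0.
rewrite Yfst_d dM_one (lin0 (@Yfst_linear _ _ _ _ S)) add0r (lin_sum (dgmh_linear hF)).
rewrite raddf_sum (lin_sum (@raw_fst_linear _ _ _ _ B)) big1 // => al _.
by rewrite (dgmh_act hF); apply: act_A_fst.
Qed.

Lemma Y_eval_linear : linear Y_eval. Proof. by []. Qed.

Lemma Y_eval_end (F : Eend) : Y_eval (val (dga_d F)) = dM (Y_eval (val F)).
Proof.
have dl : linear (fun F : Ydg -> Ydg => Y_eval (dgend_diff F)).
  by apply: linear_compose Y_eval_linear _; apply: dgend_diff_linear.
have dl' : linear (fun F : Ydg -> Ydg => dM (Y_eval F)).
  exact: linear_compose dM_lin Y_eval_linear.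
rewrite dgEnd_d_val.
have := subspaceP F; move: (val F : Ydg -> Ydg) => F0; move: F0.
apply: (homogeneous_sum_ind (P := fun F => Y_eval (dgend_diff F) = dM (Y_eval F))).
- by rewrite (lin0 dl) (lin0 dl').
- by move=> u v hu hv; rewrite (linD dl) (linD dl') hu hv.
- exact: Y_eval_d.
Qed.

Lemma Y_eval_lmul (b : B) : Y_eval (Ylmul b) = b.
Proof. exact: ga_mul1r. Qed.

Lemma Yfst_act_e u v : dgm_act (Yfst u) (eA v : L) = Yfst (u ** e v).
Proof.
apply: val_inj; rewrite Yact_val act_e; apply: raw_ext => [|al] //=.
by rewrite !ffunE gmul0l if_same.
Qed.

Lemma end_triv p (F : Ydg -> Ydg) u v : dgend_hom p F ->
  val (F (Yfst (u ** e v))) = act_triv v (val (F (Yfst u))).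
Proof. by move=> hF; rewrite -Yfst_act_e (dgmh_act hF) Yact_val act_e. Qed.

(** 1 is in general not homogeneous in Y, as e_i has degree 1 and the other e_v have degree 0; so
    the degree is checked vertex by vertex. *)
Lemma Y_eval_hom p (F : Ydg -> Ydg) : dgend_hom p F -> ga_hom p (Y_eval F).
Proof.
move=> hF; rewrite [Y_eval F]pa_mul_e; apply: hom_sum => v _.
have h : homY (p + chi i v) (val (F (Yfst (e v)))) := dgmh_deg hF (Yfst_e_hom S v).
have [/(_ v) h1 _] := h; move: h1; rewrite addrK.
have -> : Yfst (e v) = Yfst (ga_one B ** e v) by rewrite ga_mul1l.
by rewrite (end_triv _ _ hF) /= -ga_mulA pa_eev.
Qed.

Lemma end_basis p (F : Ydg -> Ydg) : dgend_hom p F ->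
  (forall w, dgm_d (F w) - (-1) ^ p *: F (dgm_d w) = 0) -> Y_eval F = 0 ->
  exists2 G0 : T -> Ydg, dgm_hom_of_degree (p + 1) G0 &
    forall t, F (iota t) = dgm_d (G0 t) - (-1) ^ (p + 1) *: G0 (dgm_d t).
Proof.
move=> hF cF pF; have Fl := dgmh_linear hF.
pose v := (val (F (Yfst (e i)))).2.
have fe u : (val (F (Yfst (e u)))).1 = 0.
  by rewrite -[e u]ga_mul1l (end_triv _ _ hF) /= -/(Y_eval F) pF gmul0l.
have Fj (j : J) : F (Yfst (e (val j))) = 0.
  apply: val_inj; apply: raw_ext => [|al]; first exact: fe.
  by rewrite -[e _]ga_mul1l (end_triv _ _ hF) /= !ffunE (negbTE (valP j)).
have Fs al : exists b : B, F (Yfst (m (MStar al))) = Yfst b /\ b ** e (tgt (val al)) = b.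
  exists (val (F (Yfst (m (MStar al))))).1.
  have E : val (F (Yfst (m (MStar al)))) = act_triv (tgt (val al)) (val (F (Yfst (m (MStar al))))).
    by rewrite -(end_triv _ _ hF) mar_e eqxx.
  split; last by rewrite {1}E /= -ga_mulA pa_eev -[RHS]/(_.1) {2}E.
  apply: val_inj; apply: raw_ext => [|be] //; rewrite {1}E /= !ffunE.
  by rewrite (negbTE (mt_noloop S al)).
have [b hb] := choice Fs.
have vE : isY (val (F (Yfst (e i)))) := subspaceP _.
have dv al : dM (v al) = (-1) ^ p *: b al.
  have := cF (Yfst (e i)); rewrite Yfst_d mt_dM_e (lin0 (@Yfst_linear _ _ _ _ S)) add0r.
  rewrite (lin_sum Fl) => /eqP; rewrite subr_eq0 => /eqP.
  move/(congr1 (fun z : Ydg => (val z).2 al)).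
  have -> (z : Ydg) c : (val (c *: z)).2 al = c *: (val z).2 al by rewrite /= ffunE.
  have -> (W : mutA -> Ydg) : (val (\sum_be W be)).2 al = (\sum_be val (W be)).2 al.
    by rewrite raddf_sum.
  rewrite Yd_val [LHS]ffunE fe (lin0 (@sgn_lin _ B)) gmul0l addr0 => ->; congr (_ *: _).
  rewrite (eq_bigr (fun be => lmul (b be) (yA be))); first by rewrite sum_lmul_yA (hb al).2.
  move=> be _; rewrite sgn_e e_mar /= eqxx (dgmh_act hF) (hb be).1.
  exact: act_fst_A.
have hv : homY (p + 1) (val (F (Yfst (e i)))).
  by have := dgmh_deg hF (Yfst_e_hom S i); rewrite chi_i.
have hva al : dgm_hom (p + 1) (Yfst (v al)).
  have [_ /(_ al) h] := hv; split=> [u|be] /=; last by rewrite ffunE; apply: hom0.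
  rewrite -/(v al) -(vE al) -ga_mulA pa_ee; case: eqP => [<-|_]; last by rewrite gmul0r; apply: hom0.
  by rewrite vE chi_ni ?(mt_noloop S) // subr0.
exists (gmap G (fun al => (-1) ^ p *: Yfst (v al)) 0 (fun=> 0)).
  apply: gmap_hom => [al||j]; first exact: dgm_homZ.
    exact: grading0 (dgm_grading Ydg) _.
  exact: grading0 (dgm_grading Ydg) _.
move=> t; have h1' al : dgm_hom (p + 1) ((-1) ^ p *: Yfst (v al)) by apply: dgm_homZ.
have z q : dgm_hom q (0 : Ydg) by exact: grading0 (dgm_grading Ydg) _.
rewrite gmap_diff //.
have Fi : linear (fun t => F (iota t)) := linear_compose Fl (iota_linear G).
have Fa u a : F (iota (dgm_act u a)) = dgm_act (F (iota u)) a by rewrite iota_act (dgmh_act hF).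
rewrite (gmap_eq G Fi Fa) /gmap; congr (_ + _ + _).
- apply: eq_bigr => al _; congr dgm_act; rewrite iota_gA (hb al).1.
  rewrite (linZ (@dgm_d_linear _ _ Ydg)); apply: val_inj.
  have -> c (z0 : Ydg) : val (c *: z0) = c *: val z0 :> raw by [].
  rewrite Yd_val (Draw_fst (mt_noloop S al) (vE al)) dv.
  apply: raw_ext => [|be] /=; first by rewrite scalerA signzz scale1r.
  by rewrite !ffunE scaler0.
- congr dgm_act; rewrite -gen_i iota_gen (lin0 (@dgm_d_linear _ _ Ydg)) sub0r.
  under eq_bigr do rewrite (linZ (dgm_linl _)).
  rewrite -scaler_sumr scalerA signzD expr1z mulrN1 mulNr signzz scaleNr scale1r opprK.
  apply: val_inj; rewrite raddf_sum.
  rewrite (eq_bigr (fun be => lmul (v be) (yA be))); last first.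
    by move=> be _; apply: act_fst_A.
  apply: raw_ext => [|al]; first by rewrite fe sum_lmul_yA_fst.
  by rewrite sum_lmul_yA vE.
apply: eq_bigr => j _; congr dgm_act.
by rewrite -gen_j iota_gen Fj (lin0 (@dgm_d_linear _ _ Ydg)).
Qed.

Lemma Ylmul_quasi_iso : dga_quasi_iso (@Ylmul_end _ _ _ _ S).
Proof.
have [f [s [fP sP f_iota iota_f]]] := Y_retract G.
apply: (@end_retract_quasi_iso k L Ydg (mt_mutated S) _ Y_eval).
- exact: Ylmul_morphism.
- exact: Y_eval_linear.
- exact: Y_eval_lmul.
- exact: Y_eval_end.
- by move=> p F; apply: Y_eval_hom.
move=> p F hF cF pF; have [G0 hG0 GE] := end_basis hF cF pF.
exact: (extend_homotopy fP sP iota_f hF cF hG0 GE).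
Qed.

Lemma mutated_derived_End : is_derived_End T (mt_mutated S).
Proof.
have [f [s [fP sP f_iota iota_f]]] := Y_retract G.
exists Ydg, f; split.
- exact: Y_K_projective G.
- exact: (retract_quasi_iso (iota_morphism G) fP sP f_iota iota_f).
exact: Zigzag_bwd Ylmul_quasi_iso (Zigzag_refl _).
Qed.

End EndomorphismsOfY.

(** * The concrete path algebra satisfies the abstract interface *)

Lemma malg_lin_ind (k : fieldType) (K : choiceType) (P : {malg k[K]} -> Prop) :
  P 0 -> (forall c x y, P x -> P y -> P (c *: x + y)) -> (forall u, P << u >>) -> forall x, P x.
Proof.
move=> P0 PP Pu x; have -> : x = \sum_(u <- msupp x) x@_u *: << u >>.
  rewrite {1}[x]monalgE; apply: eq_bigr => u _.
  by apply/malgP => v; rewrite mcoeffZ !mcoeffU mulr_natr.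
apply: big_ind => // [y z hy hz|u _]; first by rewrite -[y]scale1r; apply: PP.
by rewrite -[_ *: _]addr0; apply: PP.
Qed.

Section PathAlgebraInstance.
Variables (k : fieldType) (n : nat) (Q : quiver n).
Local Notation kQ := (kpath k Q).
Local Notation mul := (@kpath_mul k n Q).
Implicit Types (a : Q) (s : seq Q) (v w : 'I_n).

Lemma pelt_walk v s : is_walk v s -> exists2 p : qpath Q,
  pelt (v, s) = << p >> :> kQ & val p = (v, s).
Proof. by move=> h; exists (Sub (v, s) h : qpath Q); rewrite -?peltE SubK. Qed.

Lemma kpath_lin_ind (P : kQ -> Prop) : P 0 -> (forall c x y, P x -> P y -> P (c *: x + y)) ->
  (forall v s, is_walk v s -> P (pelt (v, s))) -> forall x, P x.
Proof.
move=> P0 PP Pp; apply: malg_lin_ind => // -[[v s] h].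
by rewrite -peltE; apply: Pp.
Qed.

Lemma kpath_lin_eq (V : lmodType k) (f g : kQ -> V) : linear f -> linear g ->
  (forall v s, is_walk v s -> f (pelt (v, s)) = g (pelt (v, s))) -> f =1 g.
Proof.
move=> fl gl h; apply: kpath_lin_ind => // [|c x y hx hy].
  by rewrite (lin0 fl) (lin0 gl).
by rewrite fl gl hx hy.
Qed.

Lemma pelt_mul v s w s' : is_walk v s -> is_walk w s' ->
  mul (pelt (w, s')) (pelt (v, s)) = if walk_end v s == w then pelt (v, s ++ s') else 0.
Proof.
move=> hs hs'; have [p -> pE] := pelt_walk hs; have [q -> qE] := pelt_walk hs'.
rewrite kpath_mulU /path_mul /path_tgt /path_src /path_arrows pE qE /=.
by case: eqP.
Qed.

Lemma pelt_cons a s : is_walk (tgt a) s ->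
  mul (pelt (tgt a, s)) (arr a) = pelt (src a, a :: s).
Proof.
move=> h; rewrite /arr pelt_mul //=; last by rewrite eqxx.
by rewrite /walk_end /= eqxx.
Qed.

Lemma triv_mul v w : mul (triv v) (triv w) = if v == w then triv v else 0.
Proof. by rewrite pelt_mul //= /walk_end /= eq_sym; case: eqP => [->|]. Qed.
Lemma arr_triv a : mul (arr a) (triv (src a)) = arr a.
Proof. by rewrite /arr pelt_mul /= ?eqxx // /walk_end /= eqxx. Qed.
Lemma tgt_arr a : mul (triv (tgt a)) (arr a) = arr a.
Proof. by rewrite pelt_mul /= ?eqxx // /walk_end /= eqxx. Qed.
Lemma pelt_triv v s w : is_walk v s ->
  mul (pelt (v, s)) (triv w) = if w == v then pelt (v, s) else 0.
Proof. by move=> h; rewrite pelt_mul //= /walk_end /=; case: eqP => [->|]. Qed.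

Lemma triv_hom v : @ga_hom _ (path_algebra k Q) 0 (triv v).
Proof. by rewrite trivE; apply: kpath_homU; rewrite /path_deg big_nil. Qed.
Lemma arr_hom a : @ga_hom _ (path_algebra k Q) (deg a) (arr a).
Proof.
have [|p pE ps] := @pelt_walk (src a) [:: a]; first by rewrite /= eqxx.
by rewrite /arr pE; apply: kpath_homU; rewrite /path_deg /path_arrows ps big_seq1.
Qed.
Lemma pelt_hom v s : is_walk v s ->
  @ga_hom _ (path_algebra k Q) (\sum_(a <- s) deg a) (pelt (v, s)).
Proof.
move=> h; have [p -> ps] := pelt_walk h.
by apply: kpath_homU; rewrite /path_deg /path_arrows ps.
Qed.

Lemma path_ind_right (P : int -> path_algebra k Q -> Prop) :
  (forall m, P m 0) -> (forall m c x y, P m x -> P m y -> P m (c *: x + y)) ->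
  (forall v, P 0 (triv v)) ->
  (forall m a q, ga_hom m q -> q ** triv (tgt a) = q -> P m q -> P (m + deg a) (q ** arr a)) ->
  forall x, homogeneous_sum (fun m x => ga_hom m x /\ P m x) x.
Proof.
move=> P0 PP Pe Px; apply: kpath_lin_ind => [|c x y hx hy|v s h].
- exact: homogeneous_sum0.
- apply: homogeneous_sum_closed => // m b u [h1 h2]; split; first exact: homZ.
  by rewrite -[_ *: _]addr0; apply: PP.
apply: (@homogeneous_sum1 _ _ _ (\sum_(a <- s) deg a)); split; first exact: pelt_hom.
elim: s v h => [|a s IH] v /=; first by rewrite big_nil => _; apply: Pe.
case/andP => /eqP <- h; rewrite big_cons addrC -pelt_cons //; apply: Px; last exact: IH.
  exact: pelt_hom.
by rewrite /= pelt_triv // eqxx.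
Qed.

Section RightRecursion.
Variables (V : lmodType k) (f0 : 'I_n -> V) (G : Q -> path_algebra k Q -> V -> V).
Hypothesis Gl : forall a, linear (fun p : (path_algebra k Q * V)%type => G a p.1 p.2).

Fixpoint rec_walk v s : V :=
  if s is a :: s' then G a (pelt (tgt a, s')) (rec_walk (tgt a) s') else f0 v.

Lemma path_ext : exists f : path_algebra k Q -> V, [/\ linear f,
  forall v, f (triv v) = f0 v &
  forall a q, q ** triv (tgt a) = q -> f (q ** arr a) = G a q (f q)].
Proof.
pose f := lin_ext (fun p : qpath Q => rec_walk (path_src p) (path_arrows p)).
have fl : linear f by apply: lin_ext_linear.
have fE v s : is_walk v s -> f (pelt (v, s)) = rec_walk v s.
  move=> h; have [p -> pE] := pelt_walk h.
  by rewrite /f lin_extU /path_src /path_arrows pE.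
exists f; split=> // [v|a q qa]; first by rewrite fE.
have tl : linear (fun x : kQ => mul x (triv (tgt a))) by apply: kpath_linl.
have lhs : linear (fun x : kQ => f (mul (mul x (triv (tgt a))) (arr a))).
  by apply: linear_compose fl _; apply: linear_compose (kpath_linl _) tl.
have rhs : linear (fun x : kQ => G a (mul x (triv (tgt a))) (f (mul x (triv (tgt a))))).
  exact: linear_compose (Gl a) (linear_pair tl (linear_compose fl tl)).
(* With x e_(t a) in place of q the condition on q disappears, and the identity, now linear in x,
   can be checked on paths. *)
suff H (x : kQ) : f (mul (mul x (triv (tgt a))) (arr a))
    = G a (mul x (triv (tgt a))) (f (mul x (triv (tgt a)))).
  by have := H q; rewrite [mul q _]qa.
move: x; apply: (kpath_lin_eq lhs rhs) => v s h.
rewrite pelt_triv //; case: eqP => [av|_]; last first.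
  by rewrite kpath_mul0l (lin0 fl); apply/esym/(lin0 (Gl a)).
by move: h; rewrite -av => h; rewrite pelt_cons // !fE //= eqxx.
Qed.
End RightRecursion.

Definition path_alg_of : path_alg k Q :=
  @PathAlg k n Q (path_algebra k Q) triv arr erefl triv_mul arr_triv tgt_arr triv_hom arr_hom
    path_ind_right path_ext.
End PathAlgebraInstance.

Section RightEquations.
Variables (k : fieldType) (n : nat) (Q : quiver n).
Local Notation A := (path_alg_of k Q).
Local Notation kQ := (path_algebra k Q).
Implicit Types (a : Q) (s : seq Q) (v w : 'I_n).

(** Carries a recursion known for lists of arrows over to elements, again by replacing q with x e_(t
    a) for arbitrary x. *)
Lemma right_equation (V : lmodType k) (f F : kQ -> V) a : linear f -> linear F ->
  (forall s, is_walk (tgt a) s -> f (pelt (src a, a :: s)) = F (pelt (tgt a, s))) ->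
  forall q : A, q ** pa_e A (tgt a) = q -> f (q ** pa_x A a) = F q.
Proof.
move=> fl Fl h q qa.
have tl : linear (fun x : kpath k Q => kpath_mul x (triv (tgt a))) by apply: kpath_linl.
have lhs : linear (fun x : kpath k Q => f (kpath_mul (kpath_mul x (triv (tgt a))) (arr a))).
  by apply: linear_compose fl _; apply: linear_compose (kpath_linl _) tl.
have rhs : linear (fun x : kpath k Q => F (kpath_mul x (triv (tgt a)))).
  exact: linear_compose Fl tl.
have H (x : kpath k Q) : f (kpath_mul (kpath_mul x (triv (tgt a))) (arr a))
    = F (kpath_mul x (triv (tgt a))).
  move: x; apply: (kpath_lin_eq lhs rhs) => v s hs.
  rewrite pelt_triv //; case: eqP => [av|_]; last by rewrite kpath_mul0l (lin0 fl) (lin0 Fl).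
  by move: hs; rewrite -av => hs; rewrite pelt_cons // h.
by have := H q; rewrite [kpath_mul q _]qa.
Qed.

Lemma lin_ext_pelt (V : lmodType k) (g : qpath Q -> V) (g' : 'I_n -> seq Q -> V) v s :
  (forall p, g p = g' (path_src p) (path_arrows p)) -> is_walk v s ->
  lin_ext g (pelt (v, s)) = g' v s.
Proof.
move=> gg h; have [p -> pE] := pelt_walk k h.
by rewrite lin_extU gg /path_src /path_arrows pE.
Qed.

Lemma pa_pelt_cons a s : is_walk (tgt a) s ->
  (pelt (src a, a :: s) : A) = (pelt (tgt a, s) : A) ** pa_x A a.
Proof. by move=> h; rewrite -pelt_cons. Qed.

(** Links the coefficient defined by recursion with the one in the hypothesis on d phi in the
    theorem. *)
Lemma triv_coeffE v (x : A) : triv_coeff v x = (x : kpath k Q)@_(triv_path Q v).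
Proof.
have tl := @triv_coeff_lin _ _ _ A v.
have cl : linear (fun x : kpath k Q => (x@_(triv_path Q v) : k^o)).
  by move=> c y z; rewrite mcoeffD mcoeffZ.
move: x; apply: (kpath_lin_eq tl cl) => w s.
case: s => [|a s] h.
  have := triv_coeff_e A v w; rewrite [pa_e A w]/(pelt (w, [::])) => ->.
  rewrite -[pelt _]/(triv w) trivE mcoeffU.
  congr (nat_of_bool _)%:R; apply/eqP/eqP => [-> //|].
  by move/(congr1 (fun p : qpath Q => (val p).1)).
have [p pq pE] := pelt_walk k h; rewrite [in RHS]pq mcoeffU.
case: eqP => [pv|_]; first by move/(congr1 (fun p : qpath Q => (val p).2)): pv; rewrite pE.
by case/andP: h => /eqP <- hs; rewrite pa_pelt_cons // triv_coeff_x.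
Qed.
End RightEquations.

Lemma foldl_mul (k : fieldType) (R : grAlgebra k) (I : Type) (g : I -> R) (u : seq I) (x : R) :
  foldl (fun y b => g b ** y) x u = foldl (fun y b => g b ** y) (ga_one R) u ** x.
Proof.
elim: u x => [|b u IH] x /=; first by rewrite ga_mul1l.
by rewrite IH [in RHS]IH ga_mul1r ga_mulA.
Qed.

(** * Division and attachment of arrows on concrete paths *)

Section MutationOperations.
Variables (k : fieldType) (n : nat) (Q : lf_quiver n) (i : 'I_n).
Local Notation mutA := (mutA Q i).
Local Notation MQ := (mutated_quiver Q i).
Local Notation A := (path_alg_of k Q).
Local Notation B := (path_alg_of k MQ).
Local Notation m := (mar B).
Implicit Types (al be : mutA) (a b : MQ) (c : mcode Q i) (u : seq MQ).

Lemma quo_lin al : linear (fun x : A => quo x al : A). Proof. exact: lin_ext_linear. Qed.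
Lemma quo_pelt v s al : is_walk v s -> quo (pelt (v, s) : A) al
  = (if s is a :: s' then if a == val al then pelt (tgt a, s') else 0 else 0) :> A.
Proof.
exact: (@lin_ext_pelt k n Q A _ (fun _ s => if s is a :: s' then
  if a == val al then pelt (tgt a, s') else 0 else 0)).
Qed.
Lemma quo_triv v al : quo (pa_e A v) al = 0 :> A.
Proof. exact: (@quo_pelt v [::]). Qed.
Lemma quo_arr (a : Q) (q : A) al : q ** pa_e A (tgt a) = q ->
  quo (q ** pa_x A a) al = if a == val al then q else 0 :> A.
Proof.
apply: (@right_equation k n Q A (fun x => quo x al) (fun x => if a == val al then x else 0)).
- exact: quo_lin.
- by apply: linear_if => //; apply: linear_const0.
by move=> s h; rewrite quo_pelt //= eqxx.
Qed.

Lemma is_walk_cons a u : is_walk (tgt a) u -> is_walk (src a) (a :: u).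
Proof. by move=> h; apply/andP. Qed.

Lemma arrow_prod_cons a u : arrow_prod k (a :: u) = (arrow_prod k u : B) ** pa_x B a.
Proof.
by apply: etrans (foldl_mul _ _ (pa_x B a ** ga_one B)) _; rewrite ga_mul1r.
Qed.

(** The empty product of arrows is 1 and forgets the vertex; the factor e_v restores it. *)
Lemma arrow_prod_triv v u : is_walk v u -> (arrow_prod k u : B) ** pa_e B v = pelt (v, u).
Proof.
elim: u v => [|a u IH] v h; first exact: ga_mul1l.
case/andP: h => /eqP <- h; rewrite arrow_prod_cons -ga_mulA pa_xe -(pa_ex B) ga_mulA IH //.
by rewrite pa_pelt_cons.
Qed.

Lemma arrow_prod_pelt a u : is_walk (tgt a) u ->
  arrow_prod k (a :: u) = pelt (src a, a :: u) :> B.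
Proof.
by move=> h; rewrite arrow_prod_cons -(pa_ex B) ga_mulA arrow_prod_triv // pa_pelt_cons.
Qed.

Lemma rdivA_lin al : linear (fun x : B => rdivA x al : B). Proof. exact: lin_ext_linear. Qed.
Lemma rdivA_pelt v u al : is_walk v u -> rdivA (pelt (v, u) : B) al
  = (if u is a :: u' then (arrow_prod k u' : B) ** rdiv_arrow B (val a) al else 0) :> B.
Proof.
apply: (@lin_ext_pelt k n MQ B _ (fun _ u => if u is a :: u' then
  (arrow_prod k u' : B) ** rdiv_arrow B (val a) al else 0)) => p.
by case: (path_arrows p).
Qed.
Lemma rdivA_triv v al : rdivA (pa_e B v) al = 0 :> B.
Proof. exact: (@rdivA_pelt v [::]). Qed.
Lemma rdiv_arrow_tgt c al : pa_e B (mtgt c) ** rdiv_arrow B c al = rdiv_arrow B c al.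
Proof. by case: c => [phi|be|be phi|phi be|be phi ga]; rewrite /rdiv_arrow ?gmul0r // e_mar eqxx. Qed.
Lemma rdivA_arr al c (q : B) : mvalid c -> q ** pa_e B (mtgt c) = q ->
  rdivA (q ** m c) al = q ** rdiv_arrow B c al :> B.
Proof.
move=> /(mar_valid B)[a <- ->].
apply: (@right_equation k n MQ B (fun x => rdivA x al) (fun x => x ** rdiv_arrow B (val a) al)).
- exact: rdivA_lin.
- exact: (@ga_linl _ B).
move=> u h; apply: etrans (rdivA_pelt al (is_walk_cons h)) _.
rewrite -(arrow_prod_triv h) -ga_mulA; congr (_ ** _).
exact/esym/(@rdiv_arrow_tgt (val a)).
Qed.

Lemma lmulA_lin al : linear (lmulA al : B -> B). Proof. exact: lin_ext_linear. Qed.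
Lemma lmulA_pelt v u al : is_walk v u -> lmulA al (pelt (v, u) : B)
  = (if u is a :: u' then lmul_arrow B al (val (last a u')) ** (arrow_prod k (belast a u') : B) else 0) :> B.
Proof.
apply: (@lin_ext_pelt k n MQ B _ (fun _ u => if u is a :: u' then
  lmul_arrow B al (val (last a u')) ** (arrow_prod k (belast a u') : B) else 0)) => p.
by case: (path_arrows p).
Qed.
Lemma lmulA_triv v al : lmulA al (pa_e B v) = 0 :> B.
Proof. exact: (@lmulA_pelt v [::]). Qed.
Lemma lmul_arrow_tgt c al : mtgt c != i -> lmul_arrow B al c = 0.
Proof.
case: c => [phi|be|be phi|phi be|be phi ga] //= h; first exact: (left_invalid B al h).
exact: (both_invalid_tgt B al be h).
Qed.
Lemma lmulA_arr al c (q : B) : mvalid c -> q ** pa_e B (mtgt c) = q ->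
  lmulA al (q ** m c) = (lmulA al q : B) ** m c + triv_coeff i q *: lmul_arrow B al c :> B.
Proof.
move=> /(mar_valid B)[a <- ->].
apply: (@right_equation k n MQ B (lmulA al)
  (fun q => (lmulA al q : B) ** pa_x B a + triv_coeff i (q : B) *: lmul_arrow B al (val a))).
- exact: lmulA_lin.
- apply: linear_add; first exact/mulr_linear/lmulA_lin.
  by apply: linear_scalel; exact: (@triv_coeff_lin _ _ _ B i).
(* For a single arrow a, the recursion starts at e_(t a): its coefficient at i is 1 if a ends in i,
   and otherwise attaching alpha to a gives 0. *)
move=> [|b u] h; apply: etrans (lmulA_pelt al (is_walk_cons h)) _.
  have -> : lmulA al (pelt (tgt a, [::])) = 0 :> B by exact: (@lmulA_triv (tgt a)).
  have -> : (pelt (tgt a, [::]) : B) = pa_e B (tgt a) by [].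
  rewrite gmul0l add0r triv_coeff_e; apply: etrans (ga_mul1r _) _.
  case: eqP => [_|]; first by rewrite scale1r.
  by move/eqP; rewrite eq_sym => h'; rewrite scale0r; apply: (@lmul_arrow_tgt (val a)).
have -> : lmulA al (pelt (tgt a, b :: u)) = lmul_arrow B al (val (last b u))
    ** (arrow_prod k (belast b u) : B) by exact: lmulA_pelt h.
case/andP: (h) => /eqP <- hu; rewrite (pa_pelt_cons _ hu) triv_coeff_x scale0r addr0.
rewrite -ga_mulA; congr (_ ** _); exact: arrow_prod_cons.
Qed.

End MutationOperations.

(** * Decoration of paths as the action on 1 *)

Section DecorationWalks.
Variables (k : fieldType) (n : nat) (Q : lf_quiver n) (i : 'I_n).
Variables (A : path_alg k Q) (B : path_alg k (mutated_quiver Q i)).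
Hypothesis noloop : forall al : mutA Q i, tgt (val al) != i.
Local Notation mutA := (mutA Q i).
Local Notation m := (mar B).
Local Notation act := (@ract _ _ _ _ A B).
Local Notation raw := (rawY B).
Local Notation e := (@pa_e _ _ _ B).
Local Notation y1 := ((ga_one B, 0) : raw).
Implicit Types (al be : mutA) (phi psi : Q) (y : raw).

Definition mdeco (l : option mutA) phi (r : option mutA) : B :=
  m match l, r with
    | None, None => MOld i phi
    | Some al, None => MLeft al phi
    | None, Some be => MRight phi be
    | Some al, Some be => MBoth al phi be
    end.

(* pth v s is the path with arrows s from v; dw satisfies the recursion defining
   dec_walk. *)
Variables (pth : 'I_n -> seq Q -> A) (dw : option mutA -> seq Q -> B).
Hypothesis pth_nil : forall v, pth v [::] = pa_e A v.
Hypothesis pth_cons : forall a s, is_walk (tgt a) s ->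
  pth (src a) (a :: s) = pth (tgt a) s ** pa_x A a.
Hypothesis dw_nil : dw None [::] = ga_one B.
Hypothesis dw_one : forall r phi, dw r [:: phi] = mdeco None phi r.
Hypothesis dw_cons : forall r phi psi s, dw r [:: phi, psi & s] =
  if toA i psi is Some al then dw None s ** mdeco (Some al) phi r
  else if tgt phi == i then dw None (psi :: s) ** mdeco None phi r
    - \sum_al dw (Some al) (psi :: s) ** mdeco (Some al) phi r
  else dw None (psi :: s) ** mdeco None phi r.

Lemma act_arrow_A al y : act_arrow (val al) y
  = (0, [ffun be => if be == al then y.1 ** e (tgt (val al)) else 0]).
Proof.
have ti := noloop al; apply: raw_ext => [|be]; rewrite /= ?ffunE.
  by rewrite old_A gmul0r add0r big1 // => be _; rewrite left_invalid ?gmul0r.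
rewrite right_A gmul0r add0r big1 ?subr0 => [|ga _]; last by rewrite both_invalid_tgt ?gmul0r.
by rewrite (inj_eq val_inj) eq_sym; case: eqP => // ->.
Qed.

Lemma dec_act_A (x : A) al : dec_act B (x ** pa_x A (val al)) = 0.
Proof. by rewrite /dec_act act_x act_arrow_A. Qed.

(** The argument [Some be] records the beta^-1 chosen at the preceding Delta, whose minus sign is
    the sign in the second claim. A first arrow beta is excluded there because it adds a term
    without beta^-1 to the beta-component of the action. The default of [head] is never taken, s
    being nonempty. *)
Lemma walk_arrows v s : is_walk v s -> s != [::] ->
  dw None s = (act y1 (pth v s)).1 /\
  forall be, ~~ inA i (head (val be) s) -> dw (Some be) s = - (act y1 (pth v s)).2 be.
Proof.
(* Induction on a bound for the length: an arrow of A in second position merges with the first, and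
   the recursion then passes over two arrows at once. *)
elim: {s}(size s).+1 {-2}s (ltnSn (size s)) v => // N IHN [//|phi s] sN v /andP[/eqP <-] hs _.
have mt al r : tgt phi != i -> mdeco (Some al) phi r = 0.
  by case: r => [be|] h; [exact: (both_invalid_tgt B al be h) | exact: (left_invalid B al h)].
rewrite pth_cons // act_x; case: s sN hs => [|psi s] sN hs.
  rewrite pth_nil -act_x pa_ex act_arr !dw_one /=; split=> [|be pA].
    by rewrite ga_mul1l big1 ?addr0 // => al _; rewrite ffunE gmul0l.
  rewrite dw_one !ffunE ga_mul1l big1 ?addr0 => [|al _]; last by rewrite ffunE gmul0l.
  by case: eqP => [pb|_]; [rewrite pb inA_val in pA | rewrite sub0r opprK ga_mul1l].
have [IH1 IH2] := IHN (psi :: s) sN (tgt phi) hs isT; case/andP: hs => /eqP st hs'.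
move: IH1 IH2; rewrite -st (pth_cons hs') act_x.
set y0 := act y1 (pth (tgt psi) s).
case E: (toA i psi) => [al|].
  move=> _ _; rewrite (toAP E) act_arrow_A.
  (* For an empty rest [dw] gives 1, while the action gives a trivial path; the factor e_(t alpha)
     makes them agree. *)
  have h0 : dw None s ** e (tgt (val al)) = y0.1 ** e (tgt (val al)).
    rewrite -(toAP E) /y0; case: s {E y0} sN hs' => [|a s] sN hs'.
      by rewrite dw_nil pth_nil act_e /= !ga_mul1l pa_eev.
    by have [|-> _] := IHN (a :: s) _ (tgt psi) hs' isT; first exact: ltnW.
  have h1 r : dw None s ** mdeco (Some al) phi r
      = \sum_be [ffun be => if be == al then y0.1 ** e (tgt (val al)) else 0] be ** mdeco (Some be) phi r.
    rewrite (bigD1 al) //= ffunE eqxx big1 => [|be /negbTE h]; last by rewrite ffunE h gmul0l.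
    by rewrite addr0 -h0 -ga_mulA; case: r => [be|]; rewrite e_mar eqxx.
  split=> [|be pA]; rewrite dw_cons toA_val h1 /=; first by rewrite gmul0l add0r.
  rewrite !ffunE !gmul0l if_same !add0r opprK; by [].
move=> IH1 IH2; have pA : ~~ inA i psi by rewrite -toA_inA E.
set y' := act_arrow psi y0; rewrite -/y' in IH1 IH2.
have h1 r : \sum_al y'.2 al ** mdeco (Some al) phi r =
    if tgt phi == i then - \sum_al dw (Some al) (psi :: s) ** mdeco (Some al) phi r else 0.
  case: eqP => [_|/eqP ti]; last by rewrite big1 // => al _; rewrite mt // gmul0r.
  by rewrite -sumrN; apply: eq_bigr => al _; rewrite IH2 // gmulNl opprK.
have h2 r : dw r [:: phi, psi & s] = y'.1 ** mdeco None phi r + \sum_al y'.2 al ** mdeco (Some al) phi r.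
  by rewrite dw_cons E h1 IH1; case: eqP; rewrite // addr0.
split=> [|be pA']; first exact: h2.
rewrite h2 /= ffunE.
by case: eqP => [pb|_]; [rewrite /= pb inA_val in pA' | rewrite sub0r opprK].
Qed.

End DecorationWalks.

(** * The given differential obeys the abstract recursion *)

Section MutationInstance.
Variables (k : fieldType) (n : nat) (Q : lf_quiver n) (i : 'I_n).
Local Notation mutA := (mutA Q i).
Local Notation MQ := (mutated_quiver Q i).
Local Notation A := (path_alg_of k Q).
Local Notation B := (path_alg_of k MQ).
Local Notation m := (mar B).
Implicit Types (al be : mutA) (a b : MQ) (c : mcode Q i) (u : seq MQ).
Hypothesis noloop : forall al : mutA, tgt (val al) != i.

Lemma dec_act_lin : linear (@dec_act k n Q i A B).
Proof. exact: (linear_compose (@raw_fst_linear _ _ _ _ _) (@ract_lin _ _ _ _ A B _)). Qed.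

Lemma dec_pelt v s : is_walk v s -> dec i (pelt (v, s) : A)
  = (if s is [::] then triv v else dec_walk k None s) :> B.
Proof.
apply: (@lin_ext_pelt k n Q B _ (fun v s => if s is [::] then triv v else dec_walk k None s)) => p.
by case: (path_arrows p).
Qed.

Lemma dec_dec_act (x : A) : dec i x = dec_act B x.
Proof.
have dl : linear (fun x : A => dec i x : B) by exact: lin_ext_linear.
move: x; apply: (kpath_lin_eq dl dec_act_lin) => v [|phi s] h.
  apply: etrans (dec_pelt h) _; apply/esym.
  apply: etrans (congr1 fst (@act_e _ _ _ _ A B _ v)) _; exact: ga_mul1l.
apply: etrans (dec_pelt h) _.
have [] := @walk_arrows k n Q i A B noloop (fun v s => pelt (v, s)) (@dec_walk k n Q i)
  (fun=> erefl) (@pa_pelt_cons k n Q) erefl (fun _ _ => erefl) (fun _ _ _ _ => erefl) v (phi :: s) h isT.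
by [].
Qed.

Lemma red_pelt v s : is_walk v s -> red i (pelt (v, s) : A)
  = (if s is a :: _ then if inA i a then 0 else pelt (v, s) else pelt (v, s)) :> A.
Proof.
apply: (@lin_ext_pelt k n Q A _ (fun v s => if s is a :: _ then
  if inA i a then 0 else pelt (v, s) else pelt (v, s))) => p.
by rewrite -peltE; case: p => -[v' [|a s']] h.
Qed.

(** A path starting in A acts on 1 without any kM-part, so [dec_act] already ignores what [red]
    removes. *)
Lemma dec_act_red (x : A) : dec_act B (red i x : A) = dec_act B x.
Proof.
have rl : linear (fun x : A => dec_act B (red i x : A)).
  exact: (linear_compose dec_act_lin (@lin_ext_linear _ _ _ _)).
move: x; apply: (kpath_lin_eq rl dec_act_lin) => v [|phi s] h.
  by congr (dec_act B _); apply: red_pelt h.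
have := red_pelt h; case: ifP => [/inAP[al pE]|_] E; last by congr (dec_act B _).
apply: etrans (congr1 (dec_act B) E) _; rewrite (lin0 dec_act_lin).
move: h; rewrite pE => /andP[/eqP <- hs]; apply/esym.
apply: etrans (congr1 (dec_act B) (pa_pelt_cons _ hs)) _; exact: dec_act_A.
Qed.

Lemma dec_act_arr_red al (x : A) : dec_act B (pa_x A (val al) ** (red i x : A))
  = dec_act B (pa_x A (val al) ** x).
Proof.
have ml : linear (fun x : A => dec_act B (pa_x A (val al) ** x)).
  exact: (linear_compose dec_act_lin (@ga_linr _ A _)).
have rl : linear (fun x : A => dec_act B (pa_x A (val al) ** (red i x : A))).
  exact: (linear_compose ml (@lin_ext_linear _ _ _ _)).
move: x; apply: (kpath_lin_eq rl ml) => v [|phi s] h.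
  by congr (dec_act B (_ ** _)); apply: red_pelt h.
have := red_pelt h; case: ifP => [/inAP[be pE]|_] E; last by congr (dec_act B (_ ** _)).
apply: etrans (congr1 (fun z : A => dec_act B (pa_x A (val al) ** z)) E) _.
rewrite gmul0r (lin0 dec_act_lin).
move: h; rewrite pE => /andP[/eqP <- hs]; apply/esym.
apply: etrans (congr1 (fun z : A => dec_act B (pa_x A (val al) ** z)) (pa_pelt_cons _ hs)) _.
rewrite ga_mulA; exact: dec_act_A.
Qed.

Section Differential.
Variable d : A -> A.

Lemma mdiff_old_eq phi : mdiff_old i d phi = diff_old B d phi :> B.
Proof.
have E : dec i (red i (d (arr phi))) = dec_act B (d (arr phi)) :> B.
  by apply: etrans (dec_dec_act _) _; apply: dec_act_red.
rewrite /mdiff_old /diff_old /chi; case: eqP => [ti|/eqP ti].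
  apply: etrans (congr1 (fun z : B => _ - z) E) _.
  by rewrite expr1z scaleN1r.
apply: etrans E _; rewrite expr0z scale1r big1 ?add0r // => al _.
by rewrite left_invalid // gmul0r.
Qed.
Lemma mdiff_left_eq al phi : mdiff_left d al phi = diff_left B d al phi :> B.
Proof.
by apply: etrans (dec_dec_act _) _; apply: dec_act_arr_red.
Qed.

Lemma mdiff_arrow_eq c : mdiff_arrow d c
  = @diff_arrow k n Q i A B d (fun x al => quo x al) (fun al => lmulA al) (fun x al => rdivA x al) c :> B.
Proof.
case: c => [phi|be|be phi|phi be|be phi ga].
- exact: mdiff_old_eq.
- by [].
- exact: mdiff_left_eq.
- rewrite /mdiff_arrow /diff_arrow mdiff_old_eq.
  by congr (_ + _ - _ *: _); apply: dec_dec_act.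
rewrite /mdiff_arrow /diff_arrow mdiff_left_eq.
by congr (_ + _ - lmulA _ _); apply: dec_dec_act.
Qed.

Local Notation md := (@diff_arrow k n Q i A B d (fun x al => quo x al) (fun al => lmulA al) (fun x al => rdivA x al)).

Lemma mutated_diff_lin : linear (fun x : B => mutated_diff d x : B).
Proof. exact: lin_ext_linear. Qed.
Lemma mutated_diff_pelt v u : is_walk v u -> mutated_diff d (pelt (v, u) : B) = mdiff_walk d u :> B.
Proof. exact: (@lin_ext_pelt k n MQ B _ (fun _ u => mdiff_walk d u)). Qed.
Lemma mutated_diff_triv v : mutated_diff d (pa_e B v) = 0 :> B.
Proof. exact: (@mutated_diff_pelt v [::]). Qed.

Lemma mutated_diff_cons a u : is_walk (tgt a) u ->
  mutated_diff d (pelt (src a, a :: u) : B)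
  = (mutated_diff d (pelt (tgt a, u)) : B) ** pa_x B a
    + (-1) ^ (\sum_(b <- u) deg b) *: ((arrow_prod k u : B) ** md (val a)) :> B.
Proof.
move=> h; apply: etrans (mutated_diff_pelt (is_walk_cons h)) _.
exact: (congr2 (fun w z : B => w ** pa_x B a + (-1) ^ (\sum_(b <- u) deg b) *: ((arrow_prod k u : B) ** z))
  (esym (mutated_diff_pelt h)) (mdiff_arrow_eq (val a))).
Qed.

Lemma mutated_diff_arr c : mvalid c -> mutated_diff d (m c) = md c :> B.
Proof.
move=> /(mar_valid B)[a <- ->].
have h : is_walk (tgt a) ([::] : seq MQ) by [].
apply: etrans (mutated_diff_cons h) _.
rewrite big_nil expr0z scale1r.
have -> : mutated_diff d (pelt (tgt a, [::])) = 0 :> B by exact: (@mutated_diff_triv (tgt a)).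
by rewrite gmul0l add0r; apply: ga_mul1l.
Qed.

Lemma sgn_pelt v u : is_walk v u ->
  sgn (pelt (v, u) : B) = (-1) ^ (\sum_(b <- u) deg b) *: (pelt (v, u) : B).
Proof. by move=> h; apply: sgn_hom; apply: pelt_hom. Qed.

(** The presence of b0 makes the path to the left of c nonempty, so that [arrow_prod] is the path
    itself and its sign is given by [sgn]. *)
Lemma mutated_diff_arr2 (b0 : mcode Q i) c (q : B) : mvalid b0 -> mvalid c -> msrc b0 = mtgt c ->
  q ** pa_e B (mtgt b0) = q ->
  mutated_diff d (q ** m b0 ** m c) = (mutated_diff d (q ** m b0) : B) ** m c
      + sgn (q ** m b0) ** md c :> B.
Proof.
move=> /(mar_valid B)[b <- ->] /(mar_valid B)[a <- ->] ba.
pose F (q : B) : B := (mutated_diff d (q ** pa_x B b) : B) ** pa_x B a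
  + sgn (q ** pa_x B b) ** md (val a).
have Fl : linear F.
  apply: linear_add; apply: mulr_linear.
    exact: (linear_compose mutated_diff_lin (@ga_linl _ B _)).
  exact: (linear_compose (@sgn_lin _ B) (@ga_linl _ B _)).
have fl : linear (fun q : B => mutated_diff d (q ** pa_x B a) : B).
  exact: (linear_compose mutated_diff_lin (@ga_linl _ B _)).
apply: (@right_equation k n MQ B (fun q : B => mutated_diff d (q ** pa_x B a)) F b fl Fl) => u h.
have hb : is_walk (tgt a) (b :: u) by rewrite -[tgt a]ba; apply: is_walk_cons.
have e1 : (pelt (src b, b :: u) : B) ** pa_x B a = pelt (src a, a :: b :: u).
  have e2 : src b = tgt a := ba.
  by rewrite [in LHS]e2 (pa_pelt_cons k hb).
have e3 : (pelt (tgt b, u) : B) ** pa_x B b = pelt (src b, b :: u) by rewrite (pa_pelt_cons k h).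
rewrite /F; rewrite [in RHS]e3 e1.
apply: etrans (mutated_diff_cons hb) _.
have e4 : pelt (tgt a, b :: u) = pelt (src b, b :: u) :> B by rewrite -[tgt a]ba.
rewrite (arrow_prod_pelt k h) (sgn_pelt (is_walk_cons h)) gmulZl.
exact: (congr1 (fun z : B => (mutated_diff d z : B) ** pa_x B a
  + (-1) ^ (\sum_(b' <- b :: u) deg b') *: ((pelt (src b, b :: u) : B) ** md (val a))) e4).
Qed.

End Differential.
End MutationInstance.

(** * Coordinates on the silting mutation *)

Section SiltingConeBasis.
Variables (k : fieldType) (n : nat) (Q : lf_quiver n) (i : 'I_n) (S : mut_data k Q i).
Local Notation mutA := (mutA Q i).
Local Notation A := (mt_A S).
Local Notation B := (mt_B S).
Local Notation eA := (@pa_e _ _ _ A).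
Local Notation xA := (@pa_x _ _ _ A).
Local Notation raw := (rawY B).
Implicit Types (y z : raw) (al be : mutA).

Local Notation L := (mt_dga S).
Local Notation J := {j : 'I_n | j != i}.
Variable he : forall j, @dg_idempotent k L (eA j).
Local Notation PI := (projsum (fun _ : unit => he i)).
Local Notation PA := (projsum (fun al : mutA => he (tgt (val al)))).
Local Notation PJ := (projsum (fun j : J => he (val j))).
Variable approx : PI -> PA.
Hypothesis approxP : is_dgm_morphism approx.
Hypothesis approxE : forall (x : PI) (al : mutA),
  val (approx x) al = (xA (val al) : L) ** val x tt.
Local Notation T := (dgm_sum (dgm_cone approxP) PJ).

(** [projsum_inj] multiplies by the idempotent of the summand, so its value at 1 is the generator
    e_(t alpha). *)
Definition injA (al : mutA) : PA := projsum_inj (fun al : mutA => he (tgt (val al))) al (ga_one L).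
Definition injI : PI := projsum_inj (fun _ : unit => he i) tt (ga_one L).
Definition injJ (j : J) : PJ := projsum_inj (fun j : J => he (val j)) j (ga_one L).

Lemma projsum_decomp (I : finType) (F : I -> L) (hF : forall a, dg_idempotent (F a))
    (x : projsum hF) :
  x = \sum_a dgm_act (projsum_inj hF a (ga_one L) : projsum hF) (val x a).
Proof.
apply/val_inj/ffunP => b; rewrite raddf_sum sum_ffunE (bigD1 b) //= big1 => [|a]; last first.
  by rewrite !ffunE eq_sym => /negbTE->; rewrite gmul0l.
by rewrite addr0 !ffunE eqxx ga_mul1r (subspaceP x).
Qed.

Lemma projsum_inj_hom (I : finType) (F : I -> L) (hF : forall a, dg_idempotent (F a)) a :
  dgm_hom 0 (projsum_inj hF a (ga_one L) : projsum hF).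
Proof.
move=> b; rewrite /= ffunE; case: eqP => _; last exact: hom0.
by rewrite ga_mul1r; case: (hF b).
Qed.

Lemma cone_decomp (t : T) : t = \sum_al dgm_act ((injA al, 0, 0) : T) (val t.1.1 al)
    + dgm_act ((0, injI, 0) : T) (val t.1.2 tt) + \sum_j dgm_act ((0, 0, injJ j) : T) (val t.2 j).
Proof.
case: t => [[ta ti] tj].
have E1 : \sum_al dgm_act ((injA al, 0, 0) : T) (val ta al) = (ta, 0, 0).
  have l : linear (fun u : PA => (u, 0, 0) : T).
    exact: linear_pair (linear_pair (@linear_id _ PA) (@linear_const0 _ PA PI)) (@linear_const0 _ PA PJ).
  rewrite (eq_bigr (fun al => (dgm_act (injA al) (val ta al), 0, 0) : T)); last first.
    by move=> al _; congr (_, _, _); exact: lin0 (dgm_linl _).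
  by rewrite -(lin_sum l) -projsum_decomp.
have E2 : dgm_act ((0, injI, 0) : T) (val ti tt) = (0, ti, 0).
  congr (_, _, _); try exact: lin0 (dgm_linl _).
  by apply/val_inj/ffunP => -[]; rewrite !ffunE (ga_mul1r (eA _ : L)) (subspaceP ti).
have E3 : \sum_j dgm_act ((0, 0, injJ j) : T) (val tj j) = (0, 0, tj).
  have l : linear (fun u : PJ => (0, 0, u) : T).
    exact: linear_pair (linear_pair (@linear_const0 _ PJ PA) (@linear_const0 _ PJ PI)) (@linear_id _ PJ).
  rewrite (eq_bigr (fun j => (0, 0, dgm_act (injJ j) (val tj j)) : T)); last first.
    by move=> j _; congr (_, _, _); exact: lin0 (dgm_linl _).
  by rewrite -(lin_sum l) -projsum_decomp.
rewrite /= in E1 E2 E3 *; rewrite E1 E2 E3; congr (_, _, _); first by rewrite /= !addr0.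
  by rewrite /= addr0 add0r.
by rewrite /= !add0r.
Qed.

Lemma cone_fst_linear : linear (fun t : T => t.1.1 : PA).
Proof. exact: linear_compose (@linear_fst _ PA PI) (@linear_fst _ (dgm_cone approxP) PJ). Qed.
Lemma cone_snd_linear : linear (fun t : T => t.1.2 : PI).
Proof. exact: linear_compose (@linear_snd _ PA PI) (@linear_fst _ (dgm_cone approxP) PJ). Qed.

Definition cone_basis : silting_basis T.
Proof.
refine (@SiltingBasis k n Q i S T (fun t al => val t.1.1 al) (fun t => val t.1.2 tt)
  (fun t j => val t.2 j) (fun al => (injA al, 0, 0)) (0, injI, 0) (fun j => (0, 0, injJ j))
  _ _ _ _ _ _ _ _ _ _ _ _ _ _ _ _ _ _ _ _ _ _ _ _ cone_decomp).
- abstract (by move=> al c u v;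
  exact: etrans (congr1 (fun z : PA => val z al) (cone_fst_linear c u v))
    (projsum_linE c (u.1.1 : PA) (v.1.1 : PA) al)).
- abstract (by move=> c u v;
  exact: etrans (congr1 (fun z : PI => val z tt) (cone_snd_linear c u v))
    (projsum_linE c (u.1.2 : PI) (v.1.2 : PI) tt)).
- abstract (by move=> j c u v; exact: (projsum_linE c (u.2 : PJ) v.2 j)).
- abstract (by move=> t a al; exact: (projsum_actE (t.1.1 : PA) a al)).
- abstract (by move=> t a; exact: (projsum_actE (t.1.2 : PI) a tt)).
- abstract (by move=> t a j; exact: (projsum_actE (t.2 : PJ) a j)).
- abstract (by move=> p t al [[h _] _]; apply: h).
- abstract (by move=> p t [[_ h] _]; apply: h).
- abstract (by move=> p t j [_ h]; apply: h).
- abstract (by move=> t al; rewrite /= !ffunE approxE).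
- abstract (by move=> t; rewrite /= !ffunE).
- abstract (by move=> t j; rewrite /= !ffunE).
- abstract (by move=> al be; rewrite /= ffunE ga_mul1r; case: eqP => [->|]).
- abstract (by move=> al; rewrite /= ffunE).
- abstract (by move=> al j; rewrite /= ffunE).
- abstract (by move=> al; rewrite /= ffunE).
- abstract (by rewrite /= ffunE; apply: ga_mul1r).
- abstract (by move=> j; rewrite /= ffunE).
- abstract (by move=> j al; rewrite /= ffunE).
- abstract (by move=> j; rewrite /= ffunE).
- abstract (by move=> j l; rewrite /= ffunE ga_mul1r; case: eqP => [->|]).
- abstract (by move=> al; split;
  [split; [apply: projsum_inj_hom | apply: grading0 (dgm_grading PI) _] |
   apply: grading0 (dgm_grading PJ) _]).
- abstract (by split;
  [split; [apply: grading0 (dgm_grading PA) _ | apply: projsum_inj_hom] |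
   apply: grading0 (dgm_grading PJ) _]).
- abstract (by move=> j; split;
  [split; [apply: grading0 (dgm_grading PA) _ | apply: grading0 (dgm_grading PI) _] |
   apply: projsum_inj_hom]).
Defined.

End SiltingConeBasis.

(** * Assembly of the data and conclusion *)

Section MutationData.
Variables (k : fieldType) (n : nat) (Q : lf_quiver n) (i : 'I_n).
Local Notation A := (path_alg_of k Q).
Local Notation B := (path_alg_of k (mutated_quiver Q i)).
Variable d : A -> A.
Hypothesis hd : is_differential d.
Hypothesis he : forall j, d (pa_e A j) = 0.
Hypothesis no_loops : forall phi : Q, src phi = i -> tgt phi = i -> deg phi <> 0.
Hypothesis no_triv : forall (al : mutA Q i) (phi : Q), src phi = i -> tgt phi = i ->
  (d (pa_x A phi) : kpath k Q)@_(triv_path Q i) = 0.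

Lemma mutA_no_loop (al : mutA Q i) : tgt (val al) != i.
Proof. by apply/eqP => /(no_loops (src_val al)); rewrite deg_val. Qed.

Lemma diff_triv_coeff (al : mutA Q i) (phi : Q) : src phi = i -> tgt phi = i ->
  triv_coeff i (d (pa_x A phi)) = 0.
Proof. by move=> si ti; rewrite triv_coeffE; apply: no_triv. Qed.

Definition mutation_data : mut_data k Q i :=
  @MutData k n Q i A B d hd he (d_arrA (i := i) hd) mutA_no_loop diff_triv_coeff
    (fun x al => quo x al) (@quo_lin k n Q i) (@quo_triv k n Q i) (@quo_arr k n Q i)
    (fun al => lmulA al) (@lmulA_lin k n Q i) (@lmulA_triv k n Q i) (@lmulA_arr k n Q i)
    (fun x al => rdivA x al) (@rdivA_lin k n Q i) (@rdivA_triv k n Q i) (@rdivA_arr k n Q i)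
    (fun x => mutated_diff d x) (@mutated_diff_lin k n Q i d) (@mutated_diff_triv k n Q i d)
    (mutated_diff_arr mutA_no_loop d) (mutated_diff_arr2 mutA_no_loop d).
End MutationData.

Theorem theorem1p1 (k : fieldType) (n : nat) (Q : lf_quiver n)
    (d : path_algebra k Q -> path_algebra k Q)
    (hd : is_differential d) (he : forall j : 'I_n, d (triv j) = 0)
    (i : 'I_n)
    (no_loops : forall phi : Q, src phi = i -> tgt phi = i -> deg phi <> 0)
    (* The formulas for the differential of kM apply "alpha -" and "- alpha^-1"
       to the part of d phi not starting with an arrow of A, which is only
       defined on nontrivial paths: e_i must not occur there. *)
    (no_triv : forall (al : mutA Q i) (phi : Q), src phi = i -> tgt phi = i ->
       (d (arr phi))@_(triv_path Q i) = 0) :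
  exists hM : is_differential (mutated_diff (i := i) d),
    is_derived_End (silting_mutation i hd he) (DgAlgebra hM).
Proof.
pose S := mutation_data (i := i) hd he no_loops no_triv.
exists (dM_is_differential S).
apply: (@mutated_derived_End k n Q i S (silting_mutation i hd he)).
exact: (@cone_basis k n Q i S (triv_idempotent hd he) _ (approx_morphism i hd he)
  (@approxE k n Q i d hd he)).
Qed.
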